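(* For any irrational $\alpha\in\mathbb{R}$ such that $\liminf_{q\to\infty} q\|q\alpha\|=0$, there exist a function $\phi:\mathbb{T}\to\mathbb{Z}$ and the associated skew product $$F:\mathbb{T}\times\mathbb{Z}\to\mathbb{T}\times\mathbb{Z},\qquad F(x,y)=(x+\alpha,\,y+\phi(x)),$$ such that (a) $\phi$ belongs to $L^p(\mathbb{T})$ for every $p\ge 1$, and (b) $F$ is ergodic. If $\alpha$ is also divisible, then moreover (c) $F$ is rationally ergodic along a subsequence of iterates; in particular, $F$ has a law of large numbers.
   Context: $\mathbb{T}=\mathbb{R}/\mathbb{Z}$, $\lambda$ is Lebesgue measure on $\mathbb{T}$, $L^p(\mathbb{T})=L^p(\mathbb{T},\lambda)$, and $\mathbb{T}\times\mathbb{Z}$ carries the infinite measure $\mu=\lambda\times(\text{counting measure on }\mathbb{Z})$, which $F$ preserves. Ergodicity, conservativity and the properties below are with respect to $\mu$. For $x\in\mathbb{R}$, $\|x\|$ is the distance from $x$ to the closest integer; in the $\liminf$, $q$ runs over positive integers. Continuants: if $\alpha=[a_0;a_1,a_2,\ldots]$ is the continued fraction expansion of an irrational $\alpha$, with convergents $p_n/q_n=[a_0;a_1,\ldots,a_n]$ in lowest terms, the denominators $q_n$ are the continuants of $\alpha$. The irrational number $\alpha$ is divisible if there is a sequence $(q_{n_j})_j$ of its continuants (with $n_j$ increasing) such that $2q_{n_j}$ divides $q_{n_{j+1}}$ for all $j$ and $\lim_{j\to\infty}q_{n_j}\|q_{n_j}\alpha\|=0$. Rational ergodicity along a subsequence: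 a conservative ergodic measure-preserving system $(X,\mathcal{A},\mu,F)$ is rationally ergodic along a subsequence of iterates if there are a set $A\in\mathcal{A}$ with $0<\mu(A)<\infty$, an increasing sequence $(n_k)$ of positive integers and a constant $C>0$ such that for all $k$ $$\int_A S_{n_k}(A)^2\,d\mu\le C\left(\int_A S_{n_k}(A)\,d\mu\right)^2,$$ where $S_n(A)=\sum_{j=0}^{n-1}\mathbf{1}_A\circ F^j$. Law of large numbers: a law of large numbers for a conservative ergodic measure-preserving system $(X,\mathcal{A},\mu,F)$ is a function $L:\{0,1\}^{\mathbb{N}}\to[0,\infty]$ such that for every $A\in\mathcal{A}$ the equality $L(\mathbf{1}_A(x),\mathbf{1}_A(Fx),\mathbf{1}_A(F^2x),\ldots)=\mu(A)$ holds for $\mu$-almost every $x\in X$. *)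

(* Defs.v *)
From HB Require Import structures.
From mathcomp Require Import all_boot all_order all_algebra.
From mathcomp Require Import generic_quotient ring_quotient.
From mathcomp Require Import all_classical all_reals all_analysis.

Set Implicit Arguments.
Unset Strict Implicit.
Unset Printing Implicit Defensive.

Import Order.TTheory GRing.Theory Num.Theory.
Import numFieldNormedType.Exports.

Local Open Scope classical_set_scope.
Local Open Scope ring_scope.

Section circle.
Context (R : realType).

Definition integers : {pred R} := fun x => x \is a Num.int.

Fact integers_zmod_closed : zmod_closed integers.
Proof. by split=> [|x y]; [exact: rpred0|exact: rpredB]. Qed.

HB.instance Definition _ := GRing.isZmodClosed.Build R integers
  integers_zmod_closed.

(* The additive group R/Z. *)
Definition circle : Type := Quotient.quot integers.

HB.instance Definition _ := GRing.Zmodule.on circle.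
HB.instance Definition _ := isPointed.Build circle 0.

Definition to_circle (x : R) : circle := (\pi_(Quotient.quot integers) x)%qT.

(* Borel sets of R/Z: the quotient sigma-algebra of that of R. *)
Definition circle_measurable : set (set circle) :=
  image_set_system setT to_circle (@measurable _ (measurableTypeR R)).

Fact circle_measurable0 : circle_measurable set0.
Proof. by rewrite /circle_measurable /image_set_system/= preimage_set0 setI0. Qed.

Fact circle_measurableC A : circle_measurable A -> circle_measurable (~` A).
Proof.
rewrite /circle_measurable /image_set_system/= !setTI preimage_setC.
exact: measurableC.
Qed.

Fact circle_measurableU (A : (set circle)^nat) :
  (forall i, circle_measurable (A i)) -> circle_measurable (\bigcup_i A i).
Proof.
rewrite /circle_measurable /image_set_system/= setTI preimage_bigcup => mA.
by apply: bigcupT_measurable => i; have := mA i; rewrite setTI.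
Qed.

HB.instance Definition _ := @isMeasurable.Build default_measure_display circle
  circle_measurable circle_measurable0 circle_measurableC circle_measurableU.

Fact measurable_to_circle :
  measurable_fun [set: measurableTypeR R]
    (to_circle : measurableTypeR R -> circle).
Proof. by move=> _ A. Qed.

(* `[0, 1[ is a fundamental domain of the projection R -> R/Z. *)
Definition circle_measure : set circle -> \bar R :=
  pushforward (mrestr (@lebesgue_measure R)
                 (measurable_itv (`[0, 1[ : interval (measurableTypeR R))))
    (to_circle : measurableTypeR R -> circle).

Let pushforward_circle : {measure set circle -> \bar R} :=
  measure_function_pushforward__canonical__measure_function_Measure
    (mrestr (@lebesgue_measure R)
       (measurable_itv (`[0, 1[ : interval (measurableTypeR R))))
    measurable_to_circle.

HB.instance Definition _ := Measure.copy circle_measure pushforward_circle.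

End circle.

HB.instance Definition _ := isPointed.Build int 0.
HB.instance Definition _ := @isMeasurable.Build default_measure_display int
  discrete_measurable discrete_measurable0
  discrete_measurableC discrete_measurableU.

Fact sigma_finite_counting_int (R : realType) :
  sigma_finite [set: int] (@counting int R).
Proof.
have absM n : finite_set [set k : int | (`|k| <= n)%N].
  apply: (@sub_finite_set _ _ ((Posz @` `I_n.+1) `|` (Negz @` `I_n.+1))).
    move=> [k|k] /= kn; [left|right]; exists k => //=.
    by rewrite ltnS ltnW.
  by rewrite finite_setU; split; exact: finite_image.
exists (fun n => [set k : int | (`|k| <= n)%N]).
  by apply/seteqP; split => // k _; exists `|k|%N => /=.
by move=> n; split => //; rewrite /counting asboolT// ltry.
Qed.

HB.instance Definition _ (R : realType) :=
  @Measure_isSigmaFinite.Build _ _ _ (@counting int R) (sigma_finite_counting_int R).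

Definition cylinder_measure (R : realType) : set (circle R * int) -> \bar R :=
  (@circle_measure R \x @counting int R)%E.

HB.instance Definition _ (R : realType) := Measure.on (@cylinder_measure R).

Definition skew_product (R : realType) (alpha : R) (phi : circle R -> int)
    (z : circle R * int) : circle R * int :=
  (z.1 + to_circle alpha, z.2 + phi z.1).

Section dynamics.
Context d (X : measurableType d) (R : realType).
Implicit Types (mu : {measure set X -> \bar R}) (F : X -> X).

Definition measure_preserving mu F :=
  measurable_fun [set: X] F /\
  forall A, measurable A -> mu (F @^-1` A) = mu A.

Definition ergodic mu F :=
  forall A, measurable A -> F @^-1` A = A -> mu A = 0%E \/ mu (~` A) = 0%E.

(* Every wandering set is null. *)
Definition conservative mu F :=
  forall W, measurable W -> trivIset setT (fun n => iter n F @^-1` W) ->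
    mu W = 0%E.

Definition conservative_ergodic mu F :=
  [/\ measure_preserving mu F, conservative mu F & ergodic mu F].

Definition birkhoff_sum F (A : set X) (n : nat) (x : X) : R :=
  \sum_(j < n) \1_A (iter j F x).

Definition rationally_ergodic_subseq mu F :=
  conservative_ergodic mu F /\
  exists (A : set X) (n : nat -> nat) (C : R),
    [/\ measurable A,
        (0 < mu A < +oo)%E,
        (forall k, (0 < n k)%N) /\ {homo n : i j / (i < j)%N},
        0 < C &
        forall k,
          (\int[mu]_(x in A) ((birkhoff_sum F A (n k) x) ^+ 2)%:E <=
           C%:E * (\int[mu]_(x in A) (birkhoff_sum F A (n k) x)%:E) ^+ 2)%E].

Definition has_law_of_large_numbers mu F :=
  conservative_ergodic mu F /\
  exists L : (nat -> bool) -> \bar R,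
    (forall s, (0 <= L s)%E) /\
    forall A, measurable A ->
      {ae mu, forall x, L (fun n => iter n F x \in A) = mu A}.

End dynamics.

Section continued_fraction.
Context (R : realType).
Implicit Types (alpha x : R) (n : nat).

Definition dist_int x : R := inf [set `|x - k%:~R| | k in [set: int]].

Definition complete_quotient alpha n : R :=
  iter n (fun x => (x - (Num.floor x)%:~R)^-1) alpha.

Definition partial_quotient alpha n : int :=
  Num.floor (complete_quotient alpha n).

(* The innermost step reads b + 0^-1 = b, since 0^-1 = 0 in rat. *)
Definition cf_value (a : seq int) : rat := foldr (fun (b : int) (x : rat) => b%:~R + x^-1) 0 a.

Definition convergent alpha n : rat :=
  cf_value (mkseq (partial_quotient alpha) n.+1).

(* denq is the positive denominator in lowest terms. *)
Definition continuant alpha n : nat := `|denq (convergent alpha n)|%N.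

Definition divisible alpha :=
  exists n : nat -> nat,
    [/\ {homo n : i j / (i < j)%N},
        forall j, (2 * continuant alpha (n j) %| continuant alpha (n j.+1))%N &
        (continuant alpha (n j))%:R *
          dist_int ((continuant alpha (n j))%:R * alpha) @[j --> \oo] --> (0 : R)].

End continued_fraction.

(* Main.v *)
(* The cocycle is [phi = \sum_j (h_j (x + alpha) - h_j x)] for staircases [h_j x = floor (M_j x) mod N_j] with
   [N_j = 2 ^ (j + 1)] and [M_j = N_j K_j], where [K_j alpha] is within [th_j] of an integer and
   [|K_j| th_j] decreases so fast that on most of the circle only the first [j] coboundaries contribute to
   the Birkhoff sums up to time [1 / th_j]. The measure of the exceptional set beats the bound
   [2 ^ (j + 2)] of the remaining terms, which gives all moments.

   Along multiples of [K_j], i.e. almost without moving the point, [h_j] climbs slowly; at a suitable time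
   the Birkhoff sum is 1 on most of the circle, so an invariant set has the same measure in small balls of
   consecutive levels, and Lebesgue density makes it invariant under the vertical translation. It is then
   determined by a set invariant under the irrational rotation.

   During the time [L_j ~ 1 / th_j] of a turn, the sums take [O(N_j)] values, and outside a small set each of
   them at most [O(1 / (N_j th_j))] times. By pigeonhole on pairs of times, the expected number of
   returns to [T * {0}] is of the same order; hence the bounded second moments along [L_j]. The upper limit
   of [N_j th_j S_(L_j)] on this set is almost everywhere finite and not almost everywhere zero, hence a positive
   constant by ergodicity, and Hopf's maximal inequality compares any other set with
   [T * {0}], which makes the normalized upper limit a law of large numbers. *)

Require Import Defs.
From HB Require Import structures.
From mathcomp Require Import all_boot all_order all_algebra.
From mathcomp Require Import all_classical all_reals all_analysis.
From mathcomp Require Import measurable_realfun lebesgue_integral_differentiation.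
From mathcomp Require Import zify ring lra.

Set Implicit Arguments.
Unset Strict Implicit.
Unset Printing Implicit Defensive.

Import Order.TTheory GRing.Theory Num.Theory.
Import numFieldNormedType.Exports.

Local Open Scope classical_set_scope.
Local Open Scope ring_scope.

(** The factor [N_j] in [M_j = N_j K_j] serves twice: it makes [h_j] well defined on the circle, and
    it turns the rotation by [alpha] into an advance of [N_j th_j] modulo [N_j], so that a full
    cycle takes time [1 / th_j]. Since [N_j] doubles, the staircases of index at most [j] add up to
    less than [2 N_j]. [K_j] is signed so that [th_j] is positive and every staircase climbs. Two
    scales must be separated: staircases of larger index have to rest during the time [1 / th_j],
    those of smaller index under displacements of order [1 / |K_j|]; the vanishing liminf supplies
    both at once. The exponents are quadratic in [j] because one cocycle must have all moments: the
    bad sets have to beat [2 ^ (j p)] for every [p]. In infinite measure no normalization makes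
    Birkhoff sums converge to a nonzero constant, whence the upper limit; their ratios are
    controlled by Hopf's inequality. It also gives conservativity, which therefore comes after
    ergodicity: a wandering set is visited at most once, while the visits to the base level are
    unbounded. *)

Section lebesgue_translation.
Context (R : realType).
Local Notation leb := (@lebesgue_measure R).

Lemma measurable_addr (t : R) :
  measurable_fun [set: measurableTypeR R] (fun x : measurableTypeR R => x + t : measurableTypeR R).
Proof. by apply: measurable_funD; [exact: measurable_id|exact: measurable_cst]. Qed.

Lemma lebesgue_measure_translation (t : R) (A : set (measurableTypeR R)) :
  measurable A -> leb ((fun x => x + t) @^-1` A) = leb A.
Proof.
move=> mA.
pose f := (fun x : measurableTypeR R => x + t : measurableTypeR R).
suff : leb A = pushforward leb f A by move=> ->.
pose nu := measure_function_pushforward__canonical__measure_function_Measure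
  leb (measurable_addr t).
apply: (@lebesgue_measure_unique R nu) => //.
move=> X [[a b] /= ab <-].
rewrite /nu/= /pushforward.
have -> : f @^-1` [set` `]a, b]] = [set` `](a - t), (b - t)]].
  by apply/seteqP; split => x /=; rewrite !in_itv/= /f ltrBlDr lerBrDr.
rewrite !lebesgue_measure_itv/= !lte_fin ltrD2r; case: ifP => // _.
by rewrite -!EFinB; congr EFin; ring.
Qed.
End lebesgue_translation.

(** * The circle as a probability space with invariant measure *)

Section circle_basics.
Context (R : realType).
Local Notation T := (circle R).
Local Notation lam := (@circle_measure R).
Local Notation leb := (@lebesgue_measure R).
Local Notation pi := (@to_circle R).

Lemma to_circleD (x y : R) : pi (x + y) = pi x + pi y.
Proof. by rewrite /to_circle; exact: raddfD. Qed.

Lemma to_circle_eqP (x y : R) : pi x = pi y <-> x - y \is a Num.int.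
Proof.
rewrite /to_circle; split.
  by move=> /eqP; rewrite -Quotient.idealrBE.
by move=> H; apply/eqP; rewrite -Quotient.idealrBE.
Qed.

Lemma to_circle_repr (z : T) : pi (repr z) = z.
Proof. exact: reprK. Qed.

Lemma to_circle_int (x : R) : x \is a Num.int -> pi x = 0.
Proof.
by move=> xZ; rewrite -(raddf0 (\pi_(Quotient.quot (@integers R)))%qT); apply/to_circle_eqP; rewrite subr0.
Qed.

Lemma to_circleDint (x y : R) : y \is a Num.int -> pi (x + y) = pi x.
Proof. by move=> yZ; rewrite to_circleD (to_circle_int yZ) addr0. Qed.

Lemma to_circleMn (n : nat) (x : R) : pi (n%:R * x) = pi x *+ n.
Proof.
rewrite mulr_natl; elim: n => [|n ih]; first by rewrite !mulr0n to_circle_int// rpred0.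
by rewrite !mulrS to_circleD ih.
Qed.

Lemma circle_measurableE (S : set T) : measurable S = measurable (pi @^-1` S : set (measurableTypeR R)).
Proof.
by rewrite /measurable/= /circle_measurable /image_set_system/= setTI.
Qed.

Lemma circle_measureE (S : set T) : lam S = leb (pi @^-1` S `&` `[0, 1[).
Proof. by []. Qed.

(** Cut the window at [k + 1], where [k] is the floor of [a]; translations by integers, which
    [to_circle] does not see, reassemble the two pieces into [[0, 1[]. *)
Lemma circle_measure_window (S : set T) (a : R) : measurable S ->
  leb (pi @^-1` S `&` `[a, a + 1[) = lam S.
Proof.
rewrite circle_measurableE => mS.
have mI (x y : R) : measurable (pi @^-1` S `&` `[x, y[).
  by apply: measurableI => //; exact: measurable_itv.
have tr (k : R) (x y : R) : k \is a Num.int ->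
    leb (pi @^-1` S `&` `[x + k, y + k[) = leb (pi @^-1` S `&` `[x, y[).
  move=> kZ; rewrite -(@lebesgue_measure_translation _ k (pi @^-1` S `&` `[x + k, y + k[)); last exact: mI.
  congr (leb _); apply/seteqP; split => z /=; rewrite to_circleDint// !in_itv/= => -[? ?]; split => //; lra.

have split3 (x y z : R) : x <= y -> y <= z ->
    leb (pi @^-1` S `&` `[x, z[) = (leb (pi @^-1` S `&` `[x, y[) + leb (pi @^-1` S `&` `[y, z[))%E.
  move=> xy yz; rewrite -measureU; [|exact: mI|exact: mI|].
    congr (leb _); rewrite -setIUr; congr (_ `&` _).
    apply/seteqP; split => w /=; rewrite !in_itv/=.
      by move=> /andP[? ?]; have [?|?] := ltP w y; [left|right]; apply/andP.
    by move=> [] /andP[? ?]; apply/andP; split; lra.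
  rewrite -subset0 => w /=; rewrite !in_itv/= => -[[_ /andP[? ?]] [_ /andP[? ?]]]; lra.
set k := (Num.floor a)%:~R : R.
have kZ : k \is a Num.int by rewrite intr_int.
have := floor_itv a; rewrite intrD -/k => /andP[ka ak].
rewrite (split3 a (k + 1)); [|lra|lra].
rewrite circle_measureE (split3 0 (a - k)); [|lra|lra].
have congI (x x' y y' : R) : x = x' -> y = y' ->
  leb (pi @^-1` S `&` `[x, y[) = leb (pi @^-1` S `&` `[x', y'[) by move=> -> ->.
rewrite -(tr k 0 (a - k) kZ) -(tr k (a - k) 1 kZ) addeC; congr (_ + _)%E; last by apply: congI; ring.
by rewrite -(tr 1 (0 + k)) ?rpred1//; apply: congI; ring.
Qed.

Lemma circle_measureT : lam [set: T] = 1%E.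
Proof.
rewrite circle_measureE preimage_setT setTI lebesgue_measure_itv/= lte_fin ltr01.
by rewrite sube0.
Qed.

Lemma measurable_circle_add (w : T) : measurable_fun [set: T] (fun z => z + w).
Proof.
move=> _ S; rewrite setTI !circle_measurableE => mS.
have := measurable_addr (repr w) measurableT mS; rewrite setTI.
congr measurable; apply/seteqP; split => x /=; by rewrite to_circleD to_circle_repr.
Qed.

(** A translated fundamental domain is again a window of length 1, so the invariance of Lebesgue
    measure on the line descends to the circle. *)
Lemma circle_measure_add (w : T) (S : set T) : measurable S ->
  lam ((fun z => z + w) @^-1` S) = lam S.
Proof.
move=> mS; rewrite circle_measureE -(circle_measure_window (repr w) mS).
rewrite -[RHS](@lebesgue_measure_translation _ (repr w)).
  congr (leb _); apply/seteqP; split => x /=; rewrite to_circleD to_circle_repr !in_itv/= => -[? ?]; split => //; lra.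
by apply: measurableI; [rewrite -circle_measurableE|exact: measurable_itv].
Qed.

Lemma circle_measure_le1 (S : set T) : measurable S -> (lam S <= 1)%E.
Proof. by move=> mS; rewrite -circle_measureT; apply: le_measure; rewrite ?inE. Qed.

Lemma circle_measure_fin (S : set T) : measurable S -> lam S \is a fin_num.
Proof.
move=> mS; rewrite ge0_fin_numE//; apply: le_lt_trans (circle_measure_le1 mS) _; exact: ltry.
Qed.

Lemma circle_null_lebesgue (S : set T) : measurable S -> leb (pi @^-1` S) = 0%E -> lam S = 0%E.
Proof.
move=> mS S0; apply/eqP; rewrite eq_le measure_ge0 andbT -S0 circle_measureE.
apply: le_measure; rewrite ?inE//; last by rewrite -circle_measurableE.
by apply: measurableI; [rewrite -circle_measurableE|exact: measurable_itv].
Qed.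
End circle_basics.

(** * Neighbourhoods of the points where a multiple is an integer *)

Section near_integer.
Context (R : realType).
Local Notation T := (circle R).
Local Notation lam := (@circle_measure R).
Local Notation leb := (@lebesgue_measure R).
Local Notation pi := (@to_circle R).

(** The jumps of a staircase of frequency [M] lie where [M * x] is an integer, so these sets collect
    the points too close to a jump. The choice of the lift [repr z] is immaterial because [M] is an
    integer. *)
Definition near_int (M : int) (c : R) : set T :=
  [set z | exists k : int, `|M%:~R * repr z - k%:~R| <= c].

Lemma near_intE (M : int) (c : R) (x : R) :
  near_int M c (pi x) <-> exists k : int, `|M%:~R * x - k%:~R| <= c.
Proof.
have : pi (repr (pi x)) = pi x by rewrite to_circle_repr.
move=> /to_circle_eqP/intrP[m xm]; rewrite /near_int /=.
split=> -[k hk]; [exists (k - M * m)|exists (k + M * m)];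
  rewrite ?intrB ?intrD intrM -xm; apply: le_trans hk; rewrite le_eqVlt; apply/orP; left; apply/eqP;
  congr (`| _ |); ring.
Qed.

Lemma measurable_near_int (M : int) (c : R) : measurable (near_int M c).
Proof.
rewrite circle_measurableE.
have -> : pi @^-1` near_int M c =
    \bigcup_(k : int) ((fun x : measurableTypeR R => M%:~R * x - k%:~R) @^-1` [set` `[- c, c]]).
  apply/seteqP; split => x /=; first by move=> /near_intE[k]; rewrite ler_norml => hk; exists k => //=; rewrite in_itv.
  by move=> [k _ /=]; rewrite in_itv/= -ler_norml => hk; apply/near_intE; exists k.
apply: countable_bigcupT_measurable; first exact: countableP.
move=> k; rewrite -[X in measurable X]setTI.
have : measurable_fun [set: measurableTypeR R] (fun x : measurableTypeR R => M%:~R * x - k%:~R : measurableTypeR R).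
  by apply: measurable_funB => //; apply: measurable_funM => //.
by apply => //; exact: measurable_itv.
Qed.

(** Covering by [M + 1] intervals of length [2 * c / M], one for each integer from [0] to [M], costs
    a factor [1 + 1 / M <= 2] over the sharp constant 2. *)
Lemma circle_measure_near_int (M : int) (c : R) : M != 0 -> 0 <= c ->
  (lam (near_int M c) <= (4 * c)%:E)%E.
Proof.
wlog M0 : M / 0 < M.
  move=> H Mn c0; have [/H|M0] := ltP 0 M; first exact.
  have -> : near_int M c = near_int (- M) c.
    apply/seteqP; split => z [k hk]; exists (- k); rewrite -normrN; apply: le_trans hk;
      by rewrite le_eqVlt; apply/orP; left; apply/eqP; rewrite !intrN; congr (`| _ |); ring.
  by apply: H; rewrite ?oppr_eq0// oppr_gt0 lt_neqAle Mn.
move=> _ c0.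
have M0' : 0 < (M%:~R : R) by rewrite ltr0z.
pose n := `|M|%N.
have nM : n%:R = M%:~R :> R by rewrite -[in RHS](gtz0_abs M0).
pose I (i : nat) : set R := [set` `[(i%:R - c) / M%:~R, (i%:R + c) / M%:~R]].
have [c1|c1] := ltP c 1; last first.
  apply: le_trans (circle_measure_le1 (measurable_near_int _ _)) _; rewrite lee_fin; lra.
rewrite circle_measureE.
have mI i : measurable (I i : set (measurableTypeR R)) by exact: measurable_itv.
have sub : pi @^-1` near_int M c `&` `[0, 1[ `<=` \big[setU/set0]_(i < n.+1) I i.
  move=> x [/near_intE[k hk]] /=; rewrite in_itv/= => /andP[x0 x1].
  have Mx0 : 0 <= M%:~R * x by rewrite mulr_ge0// ltW.
  have Mx1 : M%:~R * x < M%:~R by rewrite gtr_pMr.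
  have k0 : 0 <= k.
    rewrite -ltzD1 -(ltr0z R) intrD; move: hk; rewrite ler_norml => /andP[]; lra.
  have kn : (`|k| < n.+1)%N.
    suff : k < M + 1 by rewrite /n; lia.
    rewrite -(ltr_int R) intrD; move: hk; rewrite ler_norml => /andP[]; lra.
  rewrite -bigcup_mkord; exists `|k|%N => //=; rewrite /I/= in_itv/=.
  have -> : `|k|%:R = k%:~R :> R by rewrite -[in RHS](gez0_abs k0).
  rewrite ler_pdivrMr// ler_pdivlMr// [x * _]mulrC; move: hk; rewrite ler_norml => /andP[? ?].
  by apply/andP; split; lra.
apply: (@le_trans _ _ (\sum_(i < n.+1) leb (I i))%E).
  apply: (content_subadditive leb _ _ sub) => //.
    apply: measurableI; [rewrite -circle_measurableE; exact: measurable_near_int|exact: measurable_itv].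
apply: (@le_trans _ _ (\sum_(i < n.+1) ((2 * c) / M%:~R)%:E)%E).
  apply: lee_sum => i _; rewrite /I lebesgue_measure_itv/=; case: ifPn => _.
    by rewrite -EFinB lee_fin le_eqVlt; apply/orP; left; apply/eqP; field; rewrite gt_eqF.
  by rewrite lee_fin divr_ge0//; [lra|exact: ltW].
have nM1 : n.+1%:R = M%:~R + 1 :> R by rewrite -natr1 nM.
rewrite sumEFin lee_fin sumr_const card_ord -[X in X <= _]mulr_natr nM1.
have : 1 <= M%:~R :> R by rewrite (ler_int R 1).
move=> M1; rewrite mulrDr mulr1 mulfVK ?gt_eqF//.
have : 2 * c / M%:~R <= 2 * c by rewrite ler_piMr ?invf_le1//; lra.
by lra.
Qed.
End near_integer.

(** * Geometric series and sums of indicators *)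

Lemma geometric_eseries_le (R : realType) (f : nat -> \bar R) (c : R) : 0 <= c ->
  (forall i, (0 <= f i)%E) -> (forall i, (f i <= (c / 2 ^+ i.+1)%:E)%E) ->
  (\big[+%E/0%E]_(0 <= i <oo) f i <= c%:E)%E.
Proof.
move=> c0 f0 H.
apply: (@le_trans _ _ (\big[+%E/0%E]_(0 <= i <oo) (0 + (c / (2 ^ i.+1)%:R)%:E))%E).
  by apply: lee_nneseries => // i _; rewrite add0e natrX.
apply: le_trans (epsilon_trick _ _ _) _ => //.
by rewrite eseries0 ?add0e.
Qed.

Section indicator_sums.
Context d (X : measurableType d) (R : realType) (mu : {measure set X -> \bar R}).

(** Markov's inequality for a finite sum of indicators. *)
Lemma measure_le_sum_indic (I : Type) (s : seq I) (A : I -> set X) (D : set X) (c : R) :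
  0 <= c -> measurable D -> (forall i, measurable (A i)) ->
  (forall x, D x -> c <= \sum_(i <- s) \1_(A i) x) ->
  (c%:E * mu D <= \sum_(i <- s) mu (A i))%E.
Proof.
move=> c0 mD mA H.
have -> : (c%:E * mu D = \int[mu]_x (c * \1_D x)%:E)%E.
  under eq_integral do rewrite EFinM.
  rewrite ge0_integralZl//; last by apply/measurable_EFinP.
  by rewrite integral_indic// setIT.
have -> : (\sum_(i <- s) mu (A i) = \int[mu]_x (\sum_(i <- s) (\1_(A i) x)%:E))%E.
  rewrite ge0_integral_sum//; last by move=> i; apply/measurable_EFinP.
  by apply: eq_bigr => i _; rewrite integral_indic// setIT.
apply: ge0_le_integral => //.
- by move=> x _; rewrite lee_fin mulr_ge0.
- by apply/measurable_EFinP; apply: measurable_funM.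
- by apply: emeasurable_sum => i; apply/measurable_EFinP.
- move=> x _; rewrite sumEFin lee_fin indicE; case: (boolP (x \in D)) => [|_].
    by rewrite inE mulr1 => /H.
  by rewrite mulr0 sumr_ge0.
Qed.

Lemma measure_bigcup_geometric (A : nat -> set X) (c : R) : 0 <= c ->
  (forall i, measurable (A i)) ->
  (forall i, (mu (A i) <= (c / 2 ^+ i.+1)%:E)%E) ->
  (mu (\bigcup_i A i) <= c%:E)%E.
Proof.
move=> c0 mA H.
apply: le_trans (generalized_Boole_inequality mu mA _) _; first exact: bigcupT_measurable.
exact: geometric_eseries_le.
Qed.
End indicator_sums.

(** * Consequences of the Lebesgue density theorem *)

Section density.
Context (R : realType).
Local Notation leb := (@lebesgue_measure R).

Lemma lebesgue_density_eq (A B : set (measurableTypeR R)) : measurable A -> measurable B ->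
  (forall x r, 0 < r -> r < 2^-1 -> leb (A `&` ball x r) = leb (B `&` ball x r)) ->
  {ae leb, forall x, A x <-> B x}.
Proof.
move=> mA mB AB.
have := lebesgue_density mA; apply: filter_app; first exact: (ae_filter_ringOfSetsType leb).
have := lebesgue_density mB; apply: filter_app; first exact: (ae_filter_ringOfSetsType leb).
apply: aeW => x /= hB hA.
suff : (\1_A x)%:E = (\1_B x)%:E :> \bar R.
  rewrite !indicE => -[]; case: (boolP (x \in A)); case: (boolP (x \in B));
    rewrite ?inE ?notin_setE => ? ?.
  - by [].
  - by move=> /eqP; rewrite oner_eq0.
  - by move=> /eqP; rewrite eq_sym oner_eq0.
  - by [].
apply: (@cvg_unique _ (@ereal_hausdorff R) _ _ _ _ hA).
apply: cvg_trans hB; apply: near_eq_cvg.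
near=> r.
have r0 : 0 < r by [].
have r1 : r < 2^-1 by near: r; exact: nbhs_right_lt.
by congr (_ * _)%E; rewrite -AB.
Unshelve. all: by end_near. Qed.

(** A density point of [A] and one of its complement would share their averages over small balls,
    which tend to 1 and to 0. *)
Lemma lebesgue_density_const (A : set (measurableTypeR R)) : measurable A ->
  (forall x y r, 0 < r -> r < 2^-1 -> leb (A `&` ball x r) = leb (A `&` ball y r)) ->
  leb A = 0%E \/ leb (~` A) = 0%E.
Proof.
move=> mA AA.
have [N [mN N0 hN]] := lebesgue_density mA.
have [[x [Ax Nx]]|hx] := pselect (exists x, A x /\ ~ N x); last first.
  left; apply/eqP; rewrite eq_le measure_ge0 andbT -N0; apply: le_measure; rewrite ?inE// => x Ax.
  by apply: contrapT => Nx; apply: hx; exists x.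
right; apply/eqP; rewrite eq_le measure_ge0 andbT -N0; apply: le_measure; rewrite ?inE//.
  exact: measurableC.
move=> y Ay; apply: contrapT => Ny.
have cvgN z : ~ N z -> (leb (A `&` ball z r) * (leb (ball z r))^-1)%E @[r --> 0^'+] --> (\1_A z)%:E.
  by move=> Nz; apply: contrapT => H; apply: Nz; apply: hN.
have := cvgN _ Nx; have := cvgN _ Ny => hy hx.
suff : (\1_A x)%:E = (\1_A y)%:E :> \bar R.
  by rewrite !indicE (mem_set Ax) (memNset Ay) => -[] /eqP; rewrite oner_eq0.
apply: (@cvg_unique _ (@ereal_hausdorff R) _ _ _ _ hx).
apply: cvg_trans hy; apply: near_eq_cvg.
near=> r.
have r0 : 0 < r by [].
have r1 : r < 2^-1 by near: r; exact: nbhs_right_lt.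
have bxy : leb (ball y r) = leb (ball x r).
  by rewrite (@lebesgue_measure_ball _ x)// ?ltW// (@lebesgue_measure_ball _ y)// ?ltW.
congr (_ * _^-1)%E; [exact: AA|exact: bxy].
Unshelve. all: by end_near. Qed.
End density.

(** * Hopf's maximal inequality *)

Section hopf.
Context d (X : measurableType d) (R : realType) (mu : {measure set X -> \bar R})
  (F : X -> X) (mpF : measure_preserving mu F).

Lemma measurable_fun_iter (n : nat) : measurable_fun [set: X] (iter n F).
Proof.
elim: n => [|n ih]; first exact: measurable_id.
by apply: measurableT_comp => //; exact: mpF.1.
Qed.

Lemma integral_measure_preserving (f : X -> \bar R) : measurable_fun [set: X] f ->
  (forall x, (0 <= f x)%E) -> (\int[mu]_x f (F x) = \int[mu]_x f x)%E.
Proof.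
move=> mf f0; have [mF pF] := mpF.
have := @ge0_integral_pushforward _ _ _ _ _ _ mF mu setT f measurableT mf (fun y _ => f0 y).
rewrite preimage_setT => <-; apply: eq_measure_integral => A mA _.
by rewrite /= /pushforward pF.
Qed.

(** This is the maximum of the ergodic sums of lengths [0] to [n]. The recursion is exactly the
    relation that Garsia's proof of the maximal inequality uses. *)
Fixpoint hopf_max (h : X -> R) (n : nat) (x : X) : R :=
  if n is n'.+1 then Num.max 0 (h x + hopf_max h n' (F x)) else 0.

Definition ergodic_sum (h : X -> R) (n : nat) (x : X) : R := \sum_(j < n) h (iter j F x).

Lemma ergodic_sumS (h : X -> R) n x : ergodic_sum h n.+1 x = h x + ergodic_sum h n (F x).
Proof.
rewrite /ergodic_sum big_ord_recl /=; congr (_ + _).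
by apply: eq_bigr => i _; rewrite /bump/= -iterSr.
Qed.

Lemma hopf_max_ge0 (h : X -> R) n x : 0 <= hopf_max h n x.
Proof. by case: n => //= n; rewrite le_max lexx. Qed.

Lemma hopf_max_mono (h : X -> R) n x : hopf_max h n x <= hopf_max h n.+1 x.
Proof.
elim: n x => [|n ih] x; first exact: hopf_max_ge0.
change (Num.max 0 (h x + hopf_max h n (F x)) <= Num.max 0 (h x + hopf_max h n.+1 (F x))).
by rewrite ge_max !le_max lexx /= lerD2l ih orbT.
Qed.

Lemma hopf_max_ge_sum (h : X -> R) n x : ergodic_sum h n x <= hopf_max h n x.
Proof.
elim: n x => [|n ih] x; first by rewrite /ergodic_sum big_ord0.
by rewrite ergodic_sumS /= le_max; apply/orP; right; rewrite lerD2l.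
Qed.

Lemma measurable_hopf_max (h : X -> R) n : measurable_fun [set: X] h ->
  measurable_fun [set: X] (hopf_max h n).
Proof.
move=> mh; elim: n => [|n ih] /=; first exact: measurable_cst.
apply: measurable_maxr; first exact: measurable_cst.
by apply: measurable_funD => //; apply: measurableT_comp => //; exact: mpF.1.
Qed.

(** The measure may be infinite, so boundedness would not be enough to subtract integrals of these
    maxima. *)
Lemma integrable_hopf_max (h : X -> R) n : mu.-integrable [set: X] (EFin \o h) ->
  mu.-integrable [set: X] (EFin \o hopf_max h n).
Proof.
move=> ih; have mh : measurable_fun [set: X] h.
  by apply/measurable_EFinP; exact: measurable_int ih.
elim: n => [|n IH]; first exact: integrable0.
have mm := measurable_hopf_max n mh.
have IF : mu.-integrable [set: X] (EFin \o (hopf_max h n \o F)).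
  apply/integrableP; split.
    by apply/measurable_EFinP; apply: measurableT_comp => //; exact: mpF.1.
  have /integrableP[_] := IH; rewrite -(@integral_measure_preserving (fun x => `|(EFin \o hopf_max h n) x|%E))//.
  by apply: measurableT_comp => //; apply/measurable_EFinP.
apply: (le_integrable measurableT _ _ (integrableD measurableT (integrable_abse ih) IF)).
  by apply/measurable_EFinP; exact: measurable_hopf_max.
move=> x _ /=; rewrite lee_fin ger0_norm; last by rewrite le_max lexx.
rewrite ger0_norm; last by rewrite addr_ge0// hopf_max_ge0.
by rewrite ge_max addr_ge0 ?hopf_max_ge0//= lerD2r ler_norm.
Qed.

(** Garsia's argument: where the maximum of order [n.+1] is positive, [h] equals it minus the
    maximum of order [n] at [F x]; elsewhere this difference is at most 0. Its integral is
    nonnegative since [F] preserves [mu] and the maxima increase with [n]. *)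
Lemma hopf_maximal_ineq (h : X -> R) n : mu.-integrable [set: X] (EFin \o h) ->
  (0 <= \int[mu]_x (h x * \1_[set y | 0 < hopf_max h n y] x)%:E)%E.
Proof.
move=> ih; have mh : measurable_fun [set: X] h.
  by apply/measurable_EFinP; exact: measurable_int ih.
case: n => [|n].
  rewrite integral0_eq// => x _; rewrite indicE memNset ?mulr0//=.
  by rewrite ltxx.
have mE : measurable [set y | 0 < hopf_max h n.+1 y].
  rewrite -[X in measurable X]setTI; have := measurable_hopf_max n.+1 mh measurableT (measurable_itv `]0, +oo[).
  by congr (measurable (_ `&` _)); apply/seteqP; split => x /=; rewrite in_itv/= andbT.
have mm := measurable_hopf_max n mh.
have i0 := integrable_hopf_max n ih.
have i1 := integrable_hopf_max n.+1 ih.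
have iF : mu.-integrable [set: X] (EFin \o (hopf_max h n \o F)).
  apply/integrableP; split.
    by apply/measurable_EFinP; apply: measurableT_comp => //; exact: mpF.1.
  have /integrableP[_] := i0; rewrite -(@integral_measure_preserving (fun x => `|(EFin \o hopf_max h n) x|%E))//.
  by apply: measurableT_comp => //; apply/measurable_EFinP.
apply: (@le_trans _ _ (\int[mu]_x ((EFin \o hopf_max h n.+1) x - (EFin \o (hopf_max h n \o F)) x))%E).
  rewrite integralB// [X in (_ - X)%E](_ : _ = \int[mu]_x (hopf_max h n x)%:E)%E; last first.
    apply: (@integral_measure_preserving (EFin \o hopf_max h n)); first exact/measurable_EFinP.
    by move=> x; rewrite lee_fin hopf_max_ge0.
  rewrite sube_ge0; last by rewrite (integrable_fin_num measurableT i0).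
  apply: ge0_le_integral => //.
  - by move=> x _; rewrite lee_fin hopf_max_ge0.
  - exact/measurable_EFinP.
  - by apply/measurable_EFinP; exact: measurable_hopf_max.
  - by move=> x _; rewrite lee_fin hopf_max_mono.
apply: le_integral => //.
- exact: integrableB.
- apply: (le_integrable measurableT _ _ ih); first by apply/measurable_EFinP; exact: measurable_funM.
  move=> x _ /=; rewrite lee_fin normrM ler_piMr// indicE.
  by case: (_ \in _); rewrite ?normr1 ?normr0.
- move=> x _; rewrite -EFinB lee_fin indicE.
  have [hx|hx] := ltP 0 (hopf_max h n.+1 x).
    rewrite mem_set// mulr1; move: hx => /=; rewrite lt_max ltxx/= => hx.
    by rewrite max_r ?(ltW hx)// addrK.
  rewrite memNset; last by rewrite /= -/(hopf_max h n.+1 x) /= ltNge hx.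
  by rewrite mulr0 subr_le0 (le_trans hx)// hopf_max_ge0.
Qed.

(* The set where the sums are unbounded is invariant, hence conull if not null, and then the
   maximal inequality passes to the limit. *)
Lemma ergodic_sum_bounded_above (h : X -> R) : ergodic mu F ->
  (exists C, forall x, `|h x| <= C) ->
  mu.-integrable [set: X] (EFin \o h) -> (\int[mu]_x (h x)%:E < 0)%E ->
  {ae mu, forall x, exists M : R, forall n, ergodic_sum h n x <= M}.
Proof.
move=> ergF [C hC] ih hneg; have mh : measurable_fun [set: X] h.
  by apply/measurable_EFinP; exact: measurable_int ih.
have msum n : measurable_fun [set: X] (ergodic_sum h n).
  apply: measurable_sum => i; apply: measurableT_comp => //; exact: measurable_fun_iter.
pose E := [set x | forall M : nat, exists n, M%:R < ergodic_sum h n x].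
have mE : measurable E.
  have -> : E = \bigcap_M \bigcup_n (ergodic_sum h n @^-1` [set` `]M%:R, +oo[]).
    apply/seteqP; split => x /=.
      by move=> H M _; have [n hn] := H M; exists n => //=; rewrite in_itv/= andbT.
    by move=> H M; have [n _ /=] := H M I; rewrite in_itv/= andbT => ?; exists n.
  apply: bigcapT_measurable => M; apply: bigcupT_measurable => n.
  rewrite -[X in measurable X]setTI; exact: msum.
have C0 x : `|h x| <= C by [].
(* Passing from [x] to [F x] drops the term [h x], of size at most [C]; hence the threshold is
   raised from [M] to an integer above [M + C]. *)
have invE : F @^-1` E = E.
  apply/seteqP; split => x /= H M.
    have [n] := H (`|Num.ceil (M%:R + C)|%N).
    exists n.+1; rewrite ergodic_sumS.
    have := hC x; rewrite ler_norml => /andP[? _].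
    have : M%:R + C <= (`|Num.ceil (M%:R + C)|%N)%:R :> R.
      apply: le_trans (ceil_ge _) _; rewrite natr_absz ler_int; exact: ler_norm.
    by move=> ?; lra.
  have [n] := H (`|Num.ceil (M%:R + C)|%N).
  case: n => [|n].
    by rewrite /ergodic_sum big_ord0 ltNge ler0n.
  rewrite ergodic_sumS => hn; exists n.
  have := hC x; rewrite ler_norml => /andP[_ ?].
  have : M%:R + C <= (`|Num.ceil (M%:R + C)|%N)%:R :> R.
    apply: le_trans (ceil_ge _) _; rewrite natr_absz ler_int; exact: ler_norm.
  by move=> ?; lra.
have [E0|Ec0] := ergF _ mE invE.
  exists E; split => // x /= nM; apply: contrapT => nE; apply: nM.
  have [M hM] : exists M : nat, forall n, ergodic_sum h n x <= M%:R.
    apply: contrapT => H; apply: nE => M; apply: contrapT => H1; apply: H; exists M => n.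
    by rewrite leNgt; apply/negP => ?; apply: H1; exists n.
  by exists M%:R.
exfalso.
pose g n := fun x => (h x * \1_[set y | 0 < hopf_max h n y] x)%:E.
have mEn n : measurable [set y | 0 < hopf_max h n y].
  rewrite -[X in measurable X]setTI; have := measurable_hopf_max n mh measurableT (measurable_itv `]0, +oo[).
  by congr (measurable (_ `&` _)); apply/seteqP; split => x /=; rewrite in_itv/= andbT.
have [] := @dominated_convergence _ _ _ mu setT measurableT g (EFin \o h) (EFin \o (fun x => `|h x|)).
- by move=> n; apply/measurable_EFinP; exact: measurable_funM.
- exact/measurable_EFinP.
- exists (~` E); split => //; first exact: measurableC.
  move=> x /= H Ex; apply: H => _; apply: cvg_near_cst.
  (* On [E] some sum is positive, and the maxima increase, so [g n x] equals [h x] from that [n]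
     on. *)
  have [n hn] := Ex 0%N.
  exists n => // m /= nm; rewrite /g indicE mem_set ?mulr1//=.
  apply: (lt_le_trans hn); apply: le_trans (hopf_max_ge_sum _ _ _) _.
  rewrite -(subnK nm); elim: (m - n)%N => // k ihk; apply: le_trans ihk _.
  by rewrite addSn hopf_max_mono.
- exact: integrable_norm.
- apply: aeW => x n _ /=; rewrite lee_fin normrM ler_piMr// indicE.
  by case: (_ \in _); rewrite ?normr1 ?normr0.
move=> _ _ cv.
have : (0 <= \int[mu]_x (h x)%:E)%E.
  rewrite -(cvg_lim (@ereal_hausdorff R) cv); apply: lime_ge.
    by apply/cvg_ex; eexists; exact: cv.
  by apply: nearW => n; exact: hopf_maximal_ineq.
by rewrite leNgt hneg.
Qed.
End hopf.

(** * Rapidly improving rational approximations *)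

Section approximations.
Context (R : realType).

(* The exponent leaves room for the factors [steps j ^ 2 = 4 ^ j.+1] and for a geometric summation of
   the measures of the exceptional sets. *)
Definition growth (j : nat) : R := 2 ^+ (j * j + 5 * j + 10).

(** [fa_K] makes displacements of order [1 / |K j.+1|] negligible for the staircases of index at
    most [j]; [fa_th] keeps the staircase of index [j.+1] nearly at rest during the time
    [1 / th j]. *)
Record fast_approximation (alpha : R) (K : nat -> int) (th : nat -> R) : Prop := {
  fa_gt0 : forall j, 0 < th j;
  fa_int : forall j, (K j)%:~R * alpha - th j \is a Num.int;
  fa_first : `|K 0%N|%:~R * th 0%N * growth 0 <= 1;
  fa_K0 : K 0%N != 0;
  fa_K : forall j, growth j.+1 <= `|K j.+1|%:~R * th j;
  fa_th : forall j, `|K j.+1|%:~R * th j.+1 * growth j.+1 <= th j }.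

Lemma good_approximation (alpha G : R) : irrational alpha ->
  limn_einf (fun q : nat => (q%:R * dist_int (q%:R * alpha))%:E) = 0%E ->
  0 < G -> exists Kt : int * R, [/\ 0 < Kt.2, G <= `|Kt.1|%:~R, Kt.1 != 0,
    `|Kt.1|%:~R * Kt.2 * G <= 1 & Kt.1%:~R * alpha - Kt.2 \is a Num.int].
Proof.
move=> irr lim0 G0.
pose n0 := (`|Num.ceil G|%N).+1.
have Gn0 : G <= n0%:R.
  apply: le_trans (ceil_ge _) _; rewrite /n0 -natr1 natr_absz.
  by apply: le_trans (_ : `|Num.ceil G|%:~R <= _); [rewrite ler_int ler_norm|rewrite lerDl].
have [q [n0q hq]] : exists q : nat, (n0 <= q)%N /\ q%:R * dist_int (q%:R * alpha) < G^-1.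
  apply: contrapT => H.
  suff : ((G^-1)%:E <= 0 :> \bar R)%E by rewrite lee_fin leNgt invr_gt0 G0.
  rewrite -lim0 limn_einf_lim; apply: lime_ge; first exact: is_cvg_einfs.
  exists n0 => // n /= n0n; apply: le_ereal_inf_tmp => _ [m /= nm <-].
  rewrite lee_fin leNgt; apply/negP => hm; apply: H; exists m; split => //.
  exact: leq_trans nm.
have q0 : 0 < (q%:R : R) by rewrite ltr0n; apply: leq_ltn_trans n0q.
have : dist_int (q%:R * alpha) < G^-1 / q%:R by rewrite ltr_pdivlMr// mulrC.
move=> /inf_lt[].
  by exists (`|q%:R * alpha - 0%:~R|); exists 0.
move=> _ [k _ <-]; rewrite ltr_pdivlMr// => hk.
pose t := `|q%:R * alpha - k%:~R|.
have t0 : 0 < t.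
  rewrite normr_gt0; apply/negP => /eqP e; apply: irr.
  exists (k%:~R / q%:R) => //; rewrite fmorph_div /= ratr_int ratr_nat.
  by apply: (mulfI (lt0r_neq0 q0)); rewrite mulrCA mulfV ?gt_eqF// mulr1; apply/esym/eqP; rewrite -subr_eq0 e.
have tG : q%:R * t * G <= 1.
  by rewrite -ler_pdivlMr// div1r mulrC ltW.
have qG : G <= q%:R by apply: le_trans Gn0 _; rewrite ler_nat.
(* The sign of the error goes into the multiplier, so that the error itself is positive. *)
have [s0|s0] := leP 0 (q%:R * alpha - k%:~R).
  have qn0 : q != 0%N by rewrite -lt0n -(ltr_nat R).
  exists (q%:Z, t); split => //=.
  by rewrite /t ger0_norm// opprB addrC subrK intr_int.
exists (- q%:Z, t); rewrite /= normrN; split => //.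
  by rewrite oppr_eq0 eqz_nat -lt0n -(ltr_nat R).
rewrite /t ltr0_norm// intrN.
have -> : - q%:~R * alpha - - (q%:R * alpha - k%:~R) = (- k)%:~R.
  by rewrite intrN -pmulrn; ring.
exact: intr_int.
Qed.

Lemma fast_approximation_exists (alpha : R) : irrational alpha ->
  limn_einf (fun q : nat => (q%:R * dist_int (q%:R * alpha))%:E) = 0%E ->
  exists K th, fast_approximation alpha K th.
Proof.
move=> irr lim0.
have c0 j : 0 < growth j by rewrite exprn_gt0.
(* The implication sits under the existential so that choice yields a total function of [G]. *)
have H (G : R) : exists Kt : int * R, 0 < G -> [/\ 0 < Kt.2, G <= `|Kt.1|%:~R, Kt.1 != 0,
    `|Kt.1|%:~R * Kt.2 * G <= 1 & Kt.1%:~R * alpha - Kt.2 \is a Num.int].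
  have [G0|G0] := ltP 0 G; last by exists (0, 0); rewrite ltNge G0.
  by have [Kt] := good_approximation irr lim0 G0; exists Kt.
have [f hf] := choice H.
(* One threshold [G] serves both conditions: [G <= |K|] is [fa_K], and [|K| * th * G <= 1] is
   [fa_th]. *)
pose st := fix st n := if n is m.+1 then f (growth m.+1 / (st m).2) else f (growth 0).
have st0 n : 0 < (st n).2.
  by elim: n => [|n ih] /=; [have [] := hf _ (c0 0%N)|have [] := hf _ (divr_gt0 (c0 n.+1) ih)].
exists (fun n => (st n).1), (fun n => (st n).2); split => //.
- by case=> [|n] /=; [have [] := hf _ (c0 0%N)|have [] := hf _ (divr_gt0 (c0 n.+1) (st0 n))].
- by have [] := hf _ (c0 0%N).
- by have [] := hf _ (c0 0%N).
- by move=> n; have [_ + _ _ _] := hf _ (divr_gt0 (c0 n.+1) (st0 n)); rewrite ler_pdivrMr.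
- by move=> n; have [_ _ _ + _] := hf _ (divr_gt0 (c0 n.+1) (st0 n)); rewrite mulrA ler_pdivrMr// mul1r.
Qed.
End approximations.

Section approximation_bounds.
Context (R : realType) (alpha : R) (K : nat -> int) (th : nat -> R).
Hypothesis fa : fast_approximation alpha K th.
Let Q j : nat := `|K j|%N.

Lemma growth_gt0 j : 0 < growth R j. Proof. by rewrite exprn_gt0. Qed.

Lemma growth_ge j m : (m <= j * j + 5 * j + 10)%N -> 2 ^+ m <= growth R j.
Proof. by move=> mj; rewrite /growth ler_weXn2l// ler1n. Qed.

Lemma growth_ge1 j : 1 <= growth R j.
Proof. exact: (@growth_ge j 0). Qed.

Lemma fa_absK j : `|K j|%:~R = (Q j)%:R :> R.
Proof. by rewrite /Q natr_absz. Qed.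

Lemma fa_Q_gt0 j : (0 < Q j)%N.
Proof.
rewrite /Q absz_gt0; case: j => [|j]; first exact: (fa_K0 fa).
apply/negP => /eqP Kj; have := fa_K fa j; rewrite Kj normr0 mul0r leNgt.
by rewrite growth_gt0.
Qed.

Lemma fa_Q_ge1 j : 1 <= (Q j)%:R :> R.
Proof. by rewrite ler1n fa_Q_gt0. Qed.

Lemma fa_th_decr i j : (i <= j)%N -> th j <= th i.
Proof.
move=> /subnK <-; elim: (j - i)%N => // k ih; apply: le_trans ih; rewrite addSn.
have := fa_th fa (k + i); rewrite fa_absK; apply: le_trans.
rewrite -mulrA mulrCA ler_peMr ?(ltW (fa_gt0 fa _))//.
by rewrite -[leLHS]mulr1 ler_pM// ?fa_Q_ge1 ?growth_ge1.
Qed.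

Lemma fa_K_lt i j : (i < j)%N -> growth R j <= (Q j)%:R * th i.
Proof.
case: j => // j ij; have := fa_K fa j; rewrite fa_absK => /le_trans; apply.
by rewrite ler_pM2l ?fa_th_decr// ltr0n fa_Q_gt0.
Qed.

Lemma fa_th_lt i j : (i < j)%N -> (Q j)%:R * th j * growth R j <= th i.
Proof.
case: j => // j ij; have := fa_th fa j; rewrite fa_absK => /le_trans; apply.
exact: fa_th_decr.
Qed.

Lemma fa_th_le1 j : (Q j)%:R * th j * growth R j <= 1.
Proof.
have H0 : (Q 0%N)%:R * th 0%N * growth R 0 <= 1 by rewrite -fa_absK; exact: fa_first fa.
case: j => // j; apply: le_trans (fa_th_lt (ltn0Sn j)) _; apply: le_trans H0.
rewrite -mulrA mulrCA ler_peMr ?(ltW (fa_gt0 fa _))//.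
by rewrite -[leLHS]mulr1 ler_pM// ?fa_Q_ge1 ?growth_ge1.
Qed.
End approximation_bounds.

(** * Measurability of integer-valued functions *)

Section integer_valued.
Context d (X : measurableType d).

Lemma measurable_int_preimage (f : X -> int) (Y : set int) :
  (forall k, measurable (f @^-1` [set k])) -> measurable (f @^-1` Y).
Proof.
move=> mf; have -> : f @^-1` Y = \bigcup_k (if k \in Y then f @^-1` [set k] else set0).
  apply/seteqP; split => x /=.
    by move=> Yf; exists (f x) => //; rewrite mem_set.
  by move=> [k _]; case: ifPn => //; rewrite inE => Yk /= ->.
apply: countable_bigcupT_measurable; first exact: countableP.
by move=> k; case: ifP.
Qed.

Lemma measurable_fun_intP (f : X -> int) :
  measurable_fun [set: X] f <-> (forall k, measurable (f @^-1` [set k])).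
Proof.
split=> [mf k|mf _ Y _]; first by rewrite -[X in measurable X]setTI; exact: mf.
by rewrite setTI; exact: measurable_int_preimage.
Qed.

Lemma measurable_int_op (op : int -> int -> int) (f g : X -> int) :
  measurable_fun [set: X] f -> measurable_fun [set: X] g ->
  measurable_fun [set: X] (fun x => op (f x) (g x)).
Proof.
move=> /measurable_fun_intP mf /measurable_fun_intP mg; apply/measurable_fun_intP => k.
have -> : (fun x => op (f x) (g x)) @^-1` [set k] =
    \bigcup_i (f @^-1` [set i] `&` g @^-1` [set j | op i j = k]).
  apply/seteqP; split => x /=; first by move=> h; exists (f x).
  by move=> [i _ [/= <-]].
apply: countable_bigcupT_measurable; first exact: countableP.
by move=> i; apply: measurableI => //; exact: measurable_int_preimage.
Qed.

Lemma measurable_int_sum (I : Type) (s : seq I) (f : I -> X -> int) :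
  (forall i, measurable_fun [set: X] (f i)) ->
  measurable_fun [set: X] (fun x => \sum_(i <- s) f i x).
Proof.
move=> mf; elim: s => [|i s ih].
  by under eq_fun do rewrite big_nil; exact: measurable_cst.
by under eq_fun do rewrite big_cons; exact: measurable_int_op.
Qed.
End integer_valued.

(** * A single staircase under rotation *)

Section staircase.
Context (R : realType).
Local Notation T := (circle R).
Local Notation pi := (@to_circle R).
Variables (N : nat) (K : int).
Hypothesis N0 : (0 < N)%N.

Definition stair_freq : int := N%:Z * K.
Local Notation M := stair_freq.

(* [repr z] may be any lift of [z]: adding an integer changes [M * repr z] by a multiple of [N]. *)
Definition staircase (z : T) : int := (Num.floor (M%:~R * repr z) %% N)%Z.

Lemma staircaseE (x : R) : staircase (pi x) = (Num.floor (M%:~R * x) %% N)%Z.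
Proof.
have : pi (repr (pi x)) = pi x by rewrite to_circle_repr.
move=> /to_circle_eqP/intrP[m xm]; rewrite /staircase.
have -> : M%:~R * repr (pi x) = M%:~R * x + (M * m)%:~R.
  by rewrite intrM -xm; ring.
rewrite floorDrz ?intr_int// intrKfloor addrC /stair_freq -mulrA mulrC.
by rewrite modzMDl.
Qed.

Lemma staircase_ge0 z : 0 <= staircase z.
Proof. by rewrite modz_ge0// eqz_nat -lt0n. Qed.

Lemma staircase_lt z : staircase z < N%:Z.
Proof. by rewrite ltz_pmod. Qed.

Lemma measurable_staircase : measurable_fun [set: T] staircase.
Proof.
apply/measurable_fun_intP => k; rewrite circle_measurableE.
pose f := (fun x : measurableTypeR R => Num.floor (M%:~R * x) : int).
have mf : measurable_fun [set: measurableTypeR R] f.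
  apply/measurable_fun_intP => m.
  have -> : f @^-1` [set m] = (fun x : measurableTypeR R => M%:~R * x) @^-1` [set` `[m%:~R, (m + 1)%:~R[].
    apply/seteqP; split => x /=; rewrite in_itv/= /f.
      by move=> /eqP; rewrite floor_eq.
    by rewrite -floor_eq => /eqP.
  rewrite -[X in measurable X]setTI.
  have : measurable_fun [set: measurableTypeR R] (fun x : measurableTypeR R => M%:~R * x : measurableTypeR R).
    exact: measurable_funM.
  by apply => //; exact: measurable_itv.
have := measurable_int_preimage [set m | (m %% N)%Z = k] ((measurable_fun_intP _).1 mf).
by congr measurable; apply/seteqP; split => x /=; rewrite staircaseE.
Qed.

Lemma floor_shift (u s c : R) : (forall k : int, c < `|u - k%:~R|) -> `|s| <= c ->
  Num.floor (u + s) = Num.floor u.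
Proof.
move=> H /[!ler_norml]/andP[s1 s2]; apply/eqP; rewrite floor_eq.
have /andP[f1 f2] := floor_itv u.
have := H (Num.floor u); have := H (Num.floor u + 1); rewrite !lter_normr.
move: f2; rewrite !intrD => f2 h1 h2.
apply/andP; split.
  by case/orP: h2 => h2; lra.
by case/orP: h1 => h1; lra.
Qed.

Lemma staircase_small_shift (z : T) (t c : R) : ~ near_int M c z ->
  `|M%:~R * t| <= c -> staircase (z + pi t) = staircase z.
Proof.
move=> nz tc; rewrite -(to_circle_repr z) -to_circleD !staircaseE mulrDr.
rewrite (@floor_shift _ _ c)// => k; rewrite ltNge; apply/negP => hk; apply: nz.
by exists k.
Qed.

Variables (alpha th : R).
Hypothesis Kth : K%:~R * alpha - th \is a Num.int.

(** [M * alpha] differs from [N * th] by [N] times an integer, which is invisible modulo [N]; so the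
    fast rotation is seen by the staircase as a slow drift. *)
Lemma staircase_rot (x : R) (n : nat) :
  staircase (pi x + pi alpha *+ n) = (Num.floor (M%:~R * x + n%:R * (N%:R * th)) %% N)%Z.
Proof.
have -> : pi x + pi alpha *+ n = pi (x + n%:R * alpha).
  by rewrite to_circleD to_circleMn.
rewrite staircaseE; have /intrP[m hm] := Kth.
have -> : M%:~R * (x + n%:R * alpha) = M%:~R * x + n%:R * (N%:R * th) + (n%:Z * N%:Z * m)%:~R.
  have MR : M%:~R = N%:R * K%:~R :> R by rewrite /stair_freq intrM -pmulrn.
  by rewrite MR !intrM -!pmulrn -hm; ring.
rewrite floorDrz ?intr_int// intrKfloor addrC mulrAC.
by rewrite modzMDl.
Qed.

Lemma staircase_near_shift (z : T) (n : nat) (c : R) : 0 <= th -> ~ near_int M c z ->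
  n%:R * (N%:R * th) <= c -> staircase (z + pi alpha *+ n) = staircase z.
Proof.
move=> th0 nz tc; rewrite -(to_circle_repr z) staircase_rot staircaseE.
rewrite (@floor_shift _ _ c)//; last by rewrite ger0_norm// !mulr_ge0.
move=> k; rewrite ltNge; apply/negP => hk; apply: nz.
by exists k.
Qed.

(* A shift by nearly one step raises the staircase by one, except near a jump and on the top step. *)
Lemma staircase_step (z : T) (n : nat) (c : R) : 0 <= c -> ~ near_int M c z ->
  ~ near_int K N%:R^-1 z ->
  1 - c <= n%:R * (N%:R * th) -> n%:R * (N%:R * th) <= 1 ->
  staircase (z + pi alpha *+ n) = staircase z + 1.
Proof.
move=> c0 nz nK s1 s2; rewrite -(to_circle_repr z) staircase_rot staircaseE.
set u := M%:~R * repr z; set s := n%:R * _ in s1 s2 *.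
have N0' : 0 < N%:R :> R by rewrite ltr0n.
have H k : c < `|u - k%:~R|.
  by rewrite ltNge; apply/negP => hk; apply: nz; exists k.
have /andP[f1 f2] := floor_itv u.
have fs : Num.floor (u + s) = Num.floor u + 1.
  apply/eqP; rewrite floor_eq !intrD; move: f2; rewrite intrD => f2.
  have := H (Num.floor u); have := H (Num.floor u + 1); rewrite !lter_normr !intrD => h1 h2.
  apply/andP; split; last by lra.
  by case/orP: h2 => h2; lra.
rewrite fs; set f := Num.floor u in f1 f2 *.
(* On the top step [M * x] is within 1 below a multiple of [N], so [K * x] is within [1 / N] of an
   integer, which [nK] excludes. *)
have top : (f %% N)%Z != N%:Z - 1.
  apply/negP => /eqP e; apply: nK; exists ((f %/ N)%Z + 1).
  have fE : f = (f %/ N)%Z * N%:Z + N%:Z - 1 by rewrite {1}(divz_eq f N) e addrA.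
  have uE : u = N%:R * (K%:~R * repr z).
    by rewrite /u /stair_freq intrM mulrA -pmulrn.
  rewrite -(ler_pM2l N0') mulfV ?gt_eqF// -[X in X * _]gtr0_norm// -normrM mulrBr -uE.
  have fR : f%:~R = (f %/ N)%Z%:~R * N%:R + N%:R - 1 :> R.
    by rewrite {1}fE intrB intrD intrM -!pmulrn.
  move: f1 f2; rewrite !intrD fR ler_norml => ? ?; apply/andP; split; rewrite mulrDr mulr1; lra.
rewrite -modzDml modz_small//; have := ltz_pmod f (N0 : 0 < N%:Z); have := modz_ge0 f (lt0r_neq0 (N0 : 0 < N%:Z)).
by move: top; lia.
Qed.
End staircase.

(** * Infinite sums of coboundaries *)

Section cocycle.
Context (R : realType).
Local Notation T := (circle R).
Variables (h : nat -> T -> int) (a : T).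

Definition transfer_sum (J : nat) (z : T) : int := \sum_(i < J) h i z.

(* The sum of the series of coboundaries where it is eventually constant, and 0 elsewhere. *)
Definition cocycle (z : T) : int :=
  xget 0 [set k | exists J0, forall J, (J0 <= J)%N ->
    transfer_sum J (z + a) - transfer_sum J z = k].

Definition cocycle_sum (n : nat) (z : T) : int := \sum_(k < n) cocycle (z + a *+ k).

Lemma cocycleE (J : nat) (z : T) : (forall i, (J <= i)%N -> h i (z + a) = h i z) ->
  cocycle z = transfer_sum J (z + a) - transfer_sum J z.
Proof.
move=> H; apply: xget_unique.
  exists J => J' JJ'; rewrite -(subnK JJ') /transfer_sum; elim: (J' - J)%N => // k ih.
  by rewrite addSn !big_ord_recr/= H ?leq_addl// -ih; ring.
move=> k [J0 HJ0].
rewrite -(HJ0 (maxn J J0) (leq_maxr _ _)).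
have := leq_maxl J J0 => JJ'; rewrite -(subnK JJ') /transfer_sum; elim: (maxn J J0 - J)%N => // m ih.
by rewrite addSn !big_ord_recr/= H ?leq_addl// -ih; ring.
Qed.

(** The coboundaries telescope. The high terms must be constant along the whole orbit segment, both
    ends included, since each single step is evaluated separately. *)
Lemma cocycle_sumE (J n : nat) (z : T) :
  (forall i k, (J <= i)%N -> (k <= n)%N -> h i (z + a *+ k) = h i z) ->
  cocycle_sum n z = transfer_sum J (z + a *+ n) - transfer_sum J z.
Proof.
elim: n => [|n ih] H; first by rewrite /cocycle_sum big_ord0 mulr0n addr0 subrr.
rewrite /cocycle_sum big_ord_recr/= -/(cocycle_sum n z) ih; last first.
  by move=> i k Ji kn; apply: H => //; exact: leqW.
rewrite (@cocycleE J); last first.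
  by move=> i Ji; rewrite -addrA -mulrSr !H// ltnW.
have -> : z + a *+ n + a = z + a *+ n.+1 by rewrite mulrSr addrA.
by ring.
Qed.

Lemma cocycle_sumD (m n : nat) (z : T) :
  cocycle_sum (m + n) z = cocycle_sum m z + cocycle_sum n (z + a *+ m).
Proof.
rewrite /cocycle_sum big_split_ord/=; congr (_ + _).
by apply: eq_bigr => i _; rewrite mulrnDr addrA.
Qed.

Hypothesis mh : forall i, measurable_fun [set: T] (h i).

Lemma measurable_transfer_sum J : measurable_fun [set: T] (transfer_sum J).
Proof. exact: measurable_int_sum. Qed.

Lemma measurable_cocycle : measurable_fun [set: T] cocycle.
Proof.
pose D J z : int := transfer_sum J (z + a) - transfer_sum J z.
have mD J : measurable_fun [set: T] (D J).
  apply: (@measurable_int_op _ _ (fun x y => x - y)); last exact: measurable_transfer_sum.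
  apply: (measurableT_comp (measurable_transfer_sum J)); exact: measurable_circle_add.
(* Nonzero values come only from eventually constant series; the value 0 is also the default, so its
   level is obtained as the complement of the others. *)
have m1 k : k != 0 -> measurable (cocycle @^-1` [set k]).
  move=> k0; have -> : cocycle @^-1` [set k] =
      \bigcup_J0 \bigcap_(J in [set J | (J0 <= J)%N]) (D J @^-1` [set k]).
    apply/seteqP; split => z /=.
      rewrite /cocycle; case: xgetP => [x _ [J0 HJ0] <-|H e]; last by rewrite -e eqxx in k0.
      by exists J0 => // J /= JJ; exact: HJ0.
    move=> [J0 _ HJ0]; apply: xget_unique; first by exists J0 => J JJ; exact: HJ0.
    move=> y [J1 HJ1]; rewrite -(HJ1 (maxn J0 J1) (leq_maxr _ _)).
    exact: HJ0 (maxn J0 J1) (leq_maxl _ _).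
  apply: bigcup_measurable => J0 _; apply: bigcap_measurable; first by exists J0 => /=.
  by move=> J _; exact: ((measurable_fun_intP _).1 (mD J)).
apply/measurable_fun_intP => k; have [->|] := eqVneq k 0; last exact: m1.
have -> : cocycle @^-1` [set 0] = ~` (\bigcup_k (if k == 0 then set0 else cocycle @^-1` [set k])).
  apply/seteqP; split => z /=.
    by move=> e [j _]; case: eqP => // j0 /= ej; apply: j0; rewrite -ej.
  move=> H; apply: contrapT => e; apply: H; exists (cocycle z) => //.
  by case: eqP => // /e.
apply: measurableC; apply: countable_bigcupT_measurable; first exact: countableP.
by move=> j; case: ifPn => // j0; exact: m1.
Qed.

Lemma measurable_cocycle_sum n : measurable_fun [set: T] (cocycle_sum n).
Proof.
apply: measurable_int_sum => k; apply: (measurableT_comp measurable_cocycle).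
exact: measurable_circle_add.
Qed.
End cocycle.

(** * The staircase cocycle and its moments *)

Section staircase_cocycle.
Context (R : realType) (alpha : R) (K : nat -> int) (th : nat -> R).
Hypothesis fa : fast_approximation alpha K th.
Local Notation T := (circle R).
Local Notation lam := (@circle_measure R).
Local Notation a := (@to_circle R alpha).
Local Notation Q j := (`|K j|%N).

Definition steps (j : nat) : nat := 2 ^ j.+1.
Local Notation N := steps.
Definition stair (j : nat) : T -> int := @staircase R (N j) (K j).
Local Notation M j := (stair_freq (N j) (K j)).
Definition stair_cocycle : T -> int := cocycle stair a.
Local Notation H j := (transfer_sum stair j.+1).
Local Notation S := (cocycle_sum stair a).

Lemma steps_gt0 j : (0 < N j)%N. Proof. by rewrite expn_gt0. Qed.

Lemma natr_steps j : (N j)%:R = 2 ^+ j.+1 :> R. Proof. by rewrite natrX. Qed.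

Lemma stair_freq_neq0 j : M j != 0.
Proof.
rewrite mulf_neq0//; first by rewrite eqz_nat -lt0n steps_gt0.
by rewrite -absz_gt0 (fa_Q_gt0 fa).
Qed.

Lemma measurable_stair j : measurable_fun [set: T] (stair j).
Proof. exact: measurable_staircase. Qed.

Lemma transfer_sum_ge0 j z : 0 <= H j z.
Proof. by apply: sumr_ge0 => i _; exact: staircase_ge0 (steps_gt0 _) _. Qed.

(** As [steps] doubles, all earlier staircases together stay below the height of the last one. *)
Lemma transfer_sum_lt j z : H j z < (2 * N j)%N%:Z.
Proof.
rewrite /transfer_sum; elim: j => [|j ih].
  rewrite big_ord_recr big_ord0/= add0r; have := staircase_lt (K 0%N) (steps_gt0 0) z.
  by rewrite /stair (_ : N 0 = 2%N)//; lia.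
rewrite big_ord_recr/=; have := staircase_lt (K j.+1) (steps_gt0 j.+1) z.
have -> : N j.+1 = (2 * N j)%N by rewrite /steps expnS.
rewrite -/(stair j.+1 z) -[\sum_(i < j.+1) _]/(H j z).
by move: ih; rewrite -[\sum_(i < j.+1) _]/(H j z) /stair; lia.
Qed.

(* Outside this set no staircase of index above [j] moves during the first [1 / th j] iterates. *)
Definition upper_moves (j : nat) : set T :=
  \bigcup_i near_int (M (j.+1 + i)) ((N (j.+1 + i))%:R * th (j.+1 + i) / th j).

Lemma measurable_upper_moves j : measurable (upper_moves j).
Proof. by apply: bigcupT_measurable => i; exact: measurable_near_int. Qed.

Lemma circle_measure_upper_moves j : (lam (upper_moves j) <= (2 ^- (j * j + 6 * j + 8))%:E)%E.
Proof.
apply: measure_bigcup_geometric => [|i|k]; first by rewrite invr_ge0 exprn_ge0.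
  exact: measurable_near_int.
have thj := fa_gt0 fa j; set i := (j.+1 + k)%N; have thi := fa_gt0 fa i.
apply: le_trans (circle_measure_near_int (stair_freq_neq0 _) _) _.
  by rewrite !mulr_ge0// ?invr_ge0 ltW.
rewrite lee_fin.
have ji : (j < i)%N by rewrite /i; lia.
have g0 := growth_gt0 R i.
(* Thus index [i] contributes at most [4 * 2 ^ i.+1 / growth i]; as [i = j.+1 + k], the quadratic
   exponent leaves both the asserted power and the factor [2 ^- k.+1]. *)
have H1 : th i / th j <= (growth R i)^-1.
  rewrite ler_pdivrMr// ler_pdivlMl// mulrC; apply: le_trans (fa_th_lt fa ji).
  by rewrite ler_pM2r// ler_peMl ?(fa_Q_ge1 fa)// ltW.
rewrite -mulrA mulrA natr_steps.
apply: (@le_trans _ _ (4 * 2 ^+ i.+1 * (growth R i)^-1)).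
  by rewrite ler_pM2l// mulr_gt0// exprn_gt0.
rewrite (_ : 4 = 2 ^+ 2); last by rewrite expr2; ring.
rewrite -exprD /growth -invfM -exprD.
rewrite ler_pdivrMr ?exprn_gt0// mulrC ler_pdivlMr ?exprn_gt0// -exprD ler_weXn2l ?ler1n//.
by rewrite /i; nia.
Qed.

Lemma stair_upper_moves j i n z : ~ upper_moves j z -> n%:R <= (th j)^-1 -> (j < i)%N ->
  stair i (z + a *+ n) = stair i z.
Proof.
move=> nz nj ji; have thj := fa_gt0 fa j; have thi := fa_gt0 fa i.
apply: (staircase_near_shift (fa_int fa i)) (ltW thi) _ _.
  move=> nn; apply: nz; exists (i - j.+1)%N => //=.
  by rewrite subnKC//; exact: nn.
by rewrite mulrC ler_pM2l// mulr_gt0// ltr0n steps_gt0.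
Qed.

(** The reduction behind all later estimates: on this time scale the cocycle is the coboundary of a
    function with fewer than [2 * N j] values. *)
Lemma cocycle_sum_upper_moves j n z : ~ upper_moves j z -> n%:R <= (th j)^-1 ->
  S n z = H j (z + a *+ n) - H j z.
Proof.
move=> nz nj; apply: cocycle_sumE => i k ji kn; apply: (stair_upper_moves nz) => //.
by apply: le_trans nj; rewrite ler_nat.
Qed.

Lemma th_le1 j : th j <= 1.
Proof.
apply: le_trans (fa_th_le1 fa j); rewrite mulrAC ler_peMl ?(ltW (fa_gt0 fa _))//.
by rewrite -[leLHS]mulr1 ler_pM// ?(fa_Q_ge1 fa) ?growth_ge1.
Qed.

Lemma stair_cocycle_bound j z : ~ upper_moves j z -> `|stair_cocycle z| <= (2 ^ j.+2)%N%:Z.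
Proof.
move=> nz; have -> : stair_cocycle z = S 1 z.
  by rewrite /cocycle_sum big_ord_recr big_ord0/= add0r mulr0n addr0.
rewrite (cocycle_sum_upper_moves nz).
  have := transfer_sum_ge0 j z; have := transfer_sum_lt j z.
  have := transfer_sum_ge0 j (z + a *+ 1); have := transfer_sum_lt j (z + a *+ 1).
  by rewrite (_ : (2 ^ j.+2 = 2 * N j)%N); [lia|rewrite /steps -expnS].
by rewrite invf_ge1 ?th_le1// (fa_gt0 fa).
Qed.

Lemma measurable_stair_cocycle : measurable_fun [set: T] stair_cocycle.
Proof. exact: measurable_cocycle measurable_stair. Qed.

Lemma measurable_stair_sum n : measurable_fun [set: T] (S n).
Proof. exact: measurable_cocycle_sum measurable_stair _. Qed.

(** On a probability space an integer exponent above [p] suffices; the integral is then cut along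
    the first index at which the point leaves the exceptional sets. *)
Lemma stair_cocycle_Lfun (p : R) : 1 <= p ->
  (fun z => (stair_cocycle z)%:~R : R) \in Lfun lam p%:E.
Proof.
move=> p1; pose n := `|Num.ceil p|%N.
have pn : p <= n%:R.
  apply: le_trans (ceil_ge _) _; rewrite natr_absz ler_int; exact: ler_norm.
have n1 : 1 <= n%:R :> R by exact: le_trans pn.
have n0 : n%:R != 0 :> R by rewrite gt_eqF// (lt_le_trans ltr01).
have mphi : measurable_fun [set: T] (fun z => (stair_cocycle z)%:~R : R).
  move=> _ Y mY; rewrite setTI.
  exact: (measurable_int_preimage [set k | Y k%:~R] ((measurable_fun_intP _).1 measurable_stair_cocycle)).
apply: (@Lfun_subset _ _ _ lam p%:E n%:R%:E) => //.
- exact: circle_measure_fin.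
rewrite inE; apply/andP; split; first by rewrite inE.
rewrite inE/= /finite_norm ltNge leye_eq; apply/negP => /eqP Ny.
(* The index is shifted so that the first [j] with [z] outside [upper_moves j] still has [z] in
   [Y j]. *)
pose Y j := if j is j'.+1 then upper_moves j' else setT.
have mY j : measurable (Y j) by case: j => //= j; exact: measurable_upper_moves.
suff : (\int[lam]_z (`|((stair_cocycle z)%:~R : R)| ^+ n)%:E < +oo)%E.
  have := poweR_Lnorm lam (EFin \o (fun z => (stair_cocycle z)%:~R : R)) n0.
  rewrite [X in _ = X -> _](_ : _ = \int[lam]_z (`|((stair_cocycle z)%:~R : R)| ^+ n)%:E)%E; last first.
    by apply: eq_integral => z _; rewrite /= powR_mulrn.
  by rewrite Ny poweRyr// => <-; rewrite ltxx.
(* The final comparison of exponents rests on [j * n <= j * j + n * n]; this [c] pays for the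
   [n * n]. *)
pose c := 2 ^+ (n * n + 3 * n + 1) : R.
apply: (@le_lt_trans _ _ c%:E); last exact: ltry.
pose f j z : \bar R := ((2 ^+ ((j + 3) * n)) * \1_(Y j) z)%:E.
have f0 j z : (0 <= f j z)%E by rewrite lee_fin mulr_ge0// exprn_ge0.
have mf j : measurable_fun [set: T] (f j) by apply/measurable_EFinP; exact: measurable_funM.
apply: (@le_trans _ _ (\int[lam]_z (\big[+%E/0]_(0 <= j <oo) f j z))%E).
  apply: ge0_le_integral => //.
  - apply/measurable_EFinP; apply: measurable_funX; exact: measurableT_comp.
  - by apply: ge0_emeasurable_sum.
  move=> z _.
  have [j Yj phij] : exists2 j, Y j z & `|stair_cocycle z| <= (2 ^ (j + 3))%N%:Z.
    have [[j nj]|H] := pselect (exists j, ~ Y j z); last first.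
      (* A point in every [Y j] may take any index, and [k < 2 ^ k] makes this one large enough; no
         null set has to be removed. *)
      exists `|stair_cocycle z|%N; first by apply: contrapT => H1; apply: H; eexists; exact: H1.
      rewrite -abszE lez_nat; apply: ltnW; apply: leq_trans (ltn_expl _ (ltnSn 1)) _.
      by rewrite leq_exp2l// leq_addr.
    have ex : exists j, ~~ `[< Y j z >] by exists j; apply/asboolP.
    have [[|m] /asboolP nYm minm] := ex_minnP ex; first by case: nYm.
    exists m.
      by apply: contrapT => H1; have := minm m; rewrite ltnn => H2; apply/notF/H2/asboolP.
    apply: le_trans (stair_cocycle_bound nYm) _; rewrite lez_nat leq_exp2l//; lia.
  apply: (@le_trans _ _ (f j z)).
    rewrite /f indicE mem_set// mulr1 lee_fin exprM lerXn2r ?nnegrE ?exprn_ge0//.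
    rewrite -intr_norm; move: phij; rewrite -(ler_int R) => /le_trans; apply.
    by rewrite -natrX pmulrn.
  apply: le_trans (nneseries_lim_ge j.+1 _) => //.
  by rewrite big_nat_recr//= leeDr// sume_ge0.
rewrite integral_nneseries//; apply: geometric_eseries_le => [||j].
- by rewrite exprn_ge0.
- by move=> i; apply: integral_ge0.
rewrite /f; under eq_integral do rewrite EFinM.
rewrite ge0_integralZl//; last by apply/measurable_EFinP.
rewrite integral_indic// setIT.
apply: (@le_trans _ _ ((2 ^+ ((j + 3) * n))%:E * (8 * 2 ^- (j * j + 4 * j + 3))%:E)%E).
  apply: lee_wpmul2l; first by rewrite lee_fin exprn_ge0.
  case: j => [|j] /=.
    by rewrite circle_measureT lee_fin ler_pdivlMr ?exprn_gt0// mul1r !exprS expr0; lra.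
  apply: le_trans (circle_measure_upper_moves j) _; rewrite lee_fin.
  rewrite (_ : 8 = 2 ^+ 3); last by rewrite !exprS expr0; ring.
  rewrite ler_pdivlMr ?exprn_gt0// mulrC ler_pdivrMr ?exprn_gt0// -exprD ler_weXn2l ?ler1n//.
  by nia.
rewrite -EFinM lee_fin (_ : 8 = 2 ^+ 3); last by rewrite !exprS expr0; ring.
rewrite mulrA -exprD ler_pdivlMr ?exprn_gt0// mulrAC ler_pdivrMr ?exprn_gt0// -!exprD ler_weXn2l ?ler1n//.
by nia.
Qed.
End staircase_cocycle.

(** * The measure on the cylinder, level by level *)

Section cylinder.
Context (R : realType).
Local Notation T := (circle R).
Local Notation lam := (@circle_measure R).
Local Notation mu := (@cylinder_measure R).

Lemma counting_int_shift (k : int) (B : set int) :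
  @counting _ R ((fun y => y + k) @^-1` B) = counting B.
Proof.
have inj : injective (fun y : int => y - k) by move=> x y /addIr.
have e : ((fun y => y + k) @^-1` B #= B)%card.
  have -> : (fun y => y + k) @^-1` B = (fun y => y - k) @` B.
    apply/seteqP; split => y /=; first by move=> By; exists (y + k) => //; rewrite addrK.
    by move=> [x Bx <-]; rewrite subrK.
  by apply: inj_card_eq; exact: in2W.
rewrite /counting (eq_finite_set e); case: asboolP => // fB.
by congr (_%:R%:E); apply/fcard_eq => //; rewrite (eq_finite_set e).
Qed.

Lemma cylinder_measureE (A : set (T * int)) :
  mu A = (\int[lam]_x counting (xsection A x))%E.
Proof. by []. Qed.

Lemma cylinder_measure_level (S : set T) (y : int) : measurable S -> mu (S `*` [set y]) = lam S.
Proof.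
move=> mS; rewrite /cylinder_measure product_measure1E//.
have e : @counting _ R [set y] = 1%E.
  by rewrite /counting asboolT// fset_set1 finmap.cardfs1.
by rewrite [X in (_ * X)%E](_ : _ = 1%E) ?mule1.
Qed.

Lemma measurable_level (S : set T) (y : int) : measurable S -> measurable (S `*` [set y]).
Proof. by move=> mS; exact: measurableX. Qed.

Definition level (A : set (T * int)) (y : int) : set T := [set x | A (x, y)].

Lemma measurable_level_set A y : measurable A -> measurable (level A y).
Proof.
move=> mA; have := measurable_ysection y mA.
by congr measurable; apply/seteqP; split => x /ysectionP.
Qed.

Lemma cylinder_measure_eq0 (A : set (T * int)) : measurable A ->
  (forall y, lam (level A y) = 0%E) -> mu A = 0%E.
Proof.
move=> mA A0; apply: measure_negligible => //.
pose G n := if unpickle n is Some y then level A y `*` [set y] else set0.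
apply: (@negligibleS _ _ _ _ (\bigcup_n G n)).
  move=> [x y] Axy; exists (pickle y); first by [].
  by rewrite /G pickleK; split.
apply: negligible_bigcup => n; rewrite /G; case: (unpickle n) => [y|]; last exact: negligible_set0.
have mL := measurable_level_set y mA.
apply/negligibleP; first exact: measurable_level.
by rewrite -(A0 y) -(cylinder_measure_level y mL).
Qed.
End cylinder.

(** * Skew products over the rotation *)

Section skew.
Context (R : realType) (alpha : R) (phi : circle R -> int).
Hypothesis mphi : measurable_fun [set: circle R] phi.
Local Notation T := (circle R).
Local Notation lam := (@circle_measure R).
Local Notation mu := (@cylinder_measure R).
Local Notation a := (@to_circle R alpha).
Local Notation F := (skew_product alpha phi).

Lemma measurable_skew : measurable_fun [set: T * int] F.
Proof.
apply: measurable_fun_pair.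
  exact: (measurableT_comp (measurable_circle_add a) measurable_fst).
by apply: measurable_int_op; [exact: measurable_snd|exact: measurableT_comp].
Qed.

Lemma skew_measure_preserving : measure_preserving mu F.
Proof.
split; first exact: measurable_skew.
move=> A mA; suff : mu (F @^-1` A) = mu A by [].
rewrite !cylinder_measureE.
(* The fibre of the preimage over [x] is the fibre of [A] over [x + a] shifted by [phi x], and
   counting measure ignores the shift. *)
have -> : (fun x => counting (xsection (F @^-1` A) x)) =
    (fun z : T => @counting _ R (xsection A z)) \o (fun x => x + a).
  apply/funext => x /=; rewrite -[RHS](@counting_int_shift _ (phi x)).
  congr counting; apply/seteqP; split => y; by move=> /xsectionP ?; apply/xsectionP.
have := @ge0_integral_pushforward _ _ _ _ _ _ (measurable_circle_add a) lam setT
  (fun z => @counting _ R (xsection A z)) measurableT.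
rewrite preimage_setT => <- //.
- apply: eq_measure_integral; first exact: measurable_circle_add.
  by move=> mT B mB _; exact: circle_measure_add.
- exact: (measurable_fun_xsection (counting (R := R)) mA).
Qed.

Lemma iter_skew n x y : iter n F (x, y) = (x + a *+ n, y + \sum_(k < n) phi (x + a *+ k)).
Proof.
elim: n => [|n ih]; first by rewrite big_ord0 mulr0n !addr0.
by rewrite iterS ih /skew_product /= big_ord_recr/= mulrSr !addrA.
Qed.
End skew.

(** * An ergodicity criterion for skew products *)

Section ergodicity.
Context (R : realType).
Local Notation T := (circle R).
Local Notation lam := (@circle_measure R).
Local Notation leb := (@lebesgue_measure R).
Local Notation mu := (@cylinder_measure R).
Local Notation pi := (@to_circle R).

Lemma lebesgue_ball_move (A : set (measurableTypeR R)) (x y r : R) : measurable A ->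
  (leb (A `&` ball y r) <= leb (A `&` ball x r) + `|y - x|%:E)%E.
Proof.
move=> mA; rewrite !ball_itv.
have mI (i : interval R) : measurable ([set` i] : set (measurableTypeR R)) by exact: measurable_itv.
have [xy|yx] := leP x y.
  have : A `&` `]y - r, y + r[ `<=` (A `&` `]x - r, x + r[) `|` `[x + r, y + r[.
    move=> z [Az]; rewrite /= !in_itv/= => /andP[z1 z2].
    by have [zx|zx] := ltP z (x + r); [left; split => //; lra|right; apply/andP].
  move=> sub; apply: le_trans (le_measure leb _ _ sub) _; rewrite ?inE//.
  - by apply: measurableI => //; exact: mI.
  - by apply: measurableU; [apply: measurableI => //; exact: mI|exact: mI].
  apply: le_trans (measureU2 _ _ _) _; [by apply: measurableI => //; exact: mI|exact: mI|].
  rewrite leeD2l//= lebesgue_measure_itv/=; case: ifP => _; last by rewrite lee_fin.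
  by rewrite -EFinB lee_fin ger0_norm ?subr_ge0//; lra.
have : A `&` `]y - r, y + r[ `<=` (A `&` `]x - r, x + r[) `|` `]y - r, x - r].
  move=> z [Az]; rewrite /= !in_itv/= => /andP[z1 z2].
  by have [zx|zx] := leP z (x - r); [right; apply/andP|left; split => //; lra].
move=> sub; apply: le_trans (le_measure leb _ _ sub) _; rewrite ?inE//.
- by apply: measurableI => //; exact: mI.
- by apply: measurableU; [apply: measurableI => //; exact: mI|exact: mI].
apply: le_trans (measureU2 _ _ _) _; [by apply: measurableI => //; exact: mI|exact: mI|].
rewrite leeD2l//= lebesgue_measure_itv/=; case: ifP => _; last by rewrite lee_fin.
by rewrite -EFinB lee_fin ltr0_norm ?subr_lt0//; lra.
Qed.

Lemma lebesgue_ball_translate (A : set (measurableTypeR R)) (t x r : R) : measurable A ->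
  leb ((fun u => u + t) @^-1` A `&` ball x r) = leb (A `&` ball (x + t) r).
Proof.
move=> mA; rewrite !ball_itv -[RHS](@lebesgue_measure_translation _ t).
  by congr (leb _); apply/seteqP; split => z /=; rewrite !in_itv/= => -[? ?]; split => //; lra.
by apply: measurableI => //; exact: measurable_itv.
Qed.

Lemma measurable_lift (S : set T) : measurable S -> measurable (pi @^-1` S : set (measurableTypeR R)).
Proof. by rewrite circle_measurableE. Qed.

(** Such a ball lies in one window of length 1, so no point of the circle is counted twice; this is
    the source of the bound on radii below. *)
Lemma lebesgue_lift_ball (D : set T) (x r : R) : measurable D -> r < 2^-1 ->
  (leb (pi @^-1` D `&` ball x r) <= lam D)%E.
Proof.
move=> mD r2; rewrite -(circle_measure_window (x - 2^-1) mD) ball_itv.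
have mDl := measurable_lift mD.
apply: le_measure; rewrite ?inE; [by apply: measurableI => //; exact: measurable_itv..|].
by move=> z [Dz]; rewrite /= !in_itv/= => /andP[? ?]; split => //; lra.
Qed.

(** The points of [D] cost at most [lam D], and moving the centre from [x + t] back to [x] costs at
    most [|t|]. *)
Lemma lebesgue_ball_compare (A B D : set T) (t x r : R) :
  measurable A -> measurable B -> measurable D ->
  (forall u, ~ D u -> A u -> B (u + pi t)) -> r < 2^-1 ->
  (leb (pi @^-1` A `&` ball x r) <= leb (pi @^-1` B `&` ball x r) + lam D + `|t|%:E)%E.
Proof.
move=> mA mB mD H r2.
have [[mAl mBl] mDl] := (measurable_lift mA, measurable_lift mB, measurable_lift mD).
have mBt : measurable ((fun u : measurableTypeR R => u + t) @^-1` (pi @^-1` B)).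
  by rewrite -[X in measurable X]setTI; exact: measurable_addr.
have mb : measurable (ball x r : set (measurableTypeR R)) by exact: measurable_ball.
have sub : pi @^-1` A `&` ball x r `<=`
    ((fun u => u + t) @^-1` (pi @^-1` B) `&` ball x r) `|` (pi @^-1` D `&` ball x r).
  move=> u [Au bu]; have [Du|nDu] := pselect (D (pi u)); first by right.
  by left; split => //=; rewrite to_circleD; exact: H.
apply: le_trans (le_measure leb _ _ sub) _; rewrite ?inE.
- exact: measurableI.
- by apply: measurableU; exact: measurableI.
apply: le_trans (measureU2 _ _ _) _; [exact: measurableI..|].
rewrite [X in (X + _)%E](lebesgue_ball_translate t x r mBl) addeAC; apply: leeD; last exact: lebesgue_lift_ball.
have -> : `|t| = `|x + t - x| by rewrite addrAC subrr add0r.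
exact: lebesgue_ball_move.
Qed.

Lemma lebesgue_ball_compare_rev (A B D : set T) (t x r : R) :
  measurable A -> measurable B -> measurable D ->
  (forall u, ~ D u -> B (u + pi t) -> A u) -> r < 2^-1 ->
  (leb (pi @^-1` B `&` ball x r) <= leb (pi @^-1` A `&` ball x r) + lam D + `|t|%:E)%E.
Proof.
move=> mA mB mD H r2; rewrite -normrN -(circle_measure_add (pi (- t)) mD).
have mD' : measurable ((fun z => z + pi (- t)) @^-1` D).
  by rewrite -[X in measurable X]setTI; exact: measurable_circle_add.
apply: lebesgue_ball_compare => // u nD Bu; apply: H => //.
by rewrite -addrA -to_circleD addNr to_circle_int ?rpred0// addr0.
Qed.

Lemma circle_ae_lift (A B : set T) : measurable A -> measurable B ->
  {ae leb, forall x, (pi @^-1` A) x <-> (pi @^-1` B) x} ->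
  lam ((A `\` B) `|` (B `\` A)) = 0%E.
Proof.
move=> mA mB H.
have mD : measurable ((A `\` B) `|` (B `\` A)) by apply: measurableU; exact: measurableD.
apply: circle_null_lebesgue => //; apply: measure_negligible; first exact: measurable_lift.
apply: negligibleS H => x /= [[? ?]|[? ?]]; tauto.
Qed.

(* Lebesgue density turns the equality of the measures of small balls into equality almost
   everywhere, so invariance under the times [n] makes all levels of an invariant set equal, and
   density of the multiples of [alpha] makes a level trivial. *)
Lemma ergodic_skew (alpha : R) (phi : T -> int) :
  measurable_fun [set: T] phi ->
  (forall eps : R, 0 < eps -> exists k p : int, 0 < k%:~R * alpha - p%:~R < eps) ->
  (forall eps : R, 0 < eps -> exists (n : nat) (t : R), [/\ `|t| <= eps,
     n%:R * alpha - t \is a Num.int &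
     (lam [set x | (\sum_(k < n) phi (x + pi alpha *+ k))%R != 1%R] <= eps%:E)%E]) ->
  ergodic mu (skew_product alpha phi).
Proof.
move=> mphi dense times E mE invE.
set F := skew_product alpha phi in invE.
pose e y := level E y.
have me y : measurable (e y) by exact: measurable_level_set.
have invn n z : E (iter n F z) <-> E z.
  elim: n => // n; rewrite iterS => <-; rewrite -{2}invE; exact: iff_refl.
have mS n : measurable_fun [set: T] (fun x => (\sum_(k < n) phi (x + pi alpha *+ k))%R).
  apply: measurable_int_sum => k; apply: (measurableT_comp mphi); exact: measurable_circle_add.
have step y : lam ((e y `\` e (y + 1)) `|` (e (y + 1) `\` e y)) = 0%E.
  apply: circle_ae_lift => //; apply: lebesgue_density_eq; [exact: measurable_lift..|].
  move=> x r r0 r2.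
  have key eps : 0 < eps -> (leb (pi @^-1` e y `&` ball x r) <= leb (pi @^-1` e (y + 1)%R `&` ball x r) + eps%:E)%E /\
     (leb (pi @^-1` e (y + 1)%R `&` ball x r) <= leb (pi @^-1` e y `&` ball x r) + eps%:E)%E.
    move=> eps0; have eps20 : 0 < eps / 2 by rewrite divr_gt0.
    have [n [t [teps nt Deps]]] := times _ eps20.
    set D := [set x | _] in Deps.
    have mD : measurable D by exact: (measurable_int_preimage [set k | k != 1] ((measurable_fun_intP _).1 (mS n))).
    have et : pi t = pi alpha *+ n.
      by rewrite -to_circleMn; apply/esym/to_circle_eqP.
    (* Off [D] the [n]-th iterate raises the level by exactly one while moving the base point by the
       small [t]. *)
    have He u : ~ D u -> (e y u <-> e (y + 1) (u + pi t)).
      move=> /negP; rewrite negbK => /eqP Su; rewrite /e /level /= -(invn n) iter_skew Su et.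
      exact: iff_refl.
    have le2 z : (z + lam D + `|t|%:E <= z + eps%:E)%E.
      rewrite -addeA leeD2l// [eps]splitr EFinD; apply: leeD => //.
    split.
      apply: le_trans (lebesgue_ball_compare _ (me y) (me (y + 1)) mD _ r2) (le2 _).
      by move=> u nD; rewrite (He u nD).
    apply: le_trans (lebesgue_ball_compare_rev _ (me y) (me (y + 1)) mD _ r2) (le2 _).
    by move=> u nD; rewrite (He u nD).
  by apply/eqP; rewrite eq_le; apply/andP; split; apply/lee_addgt0Pr => eps eps0; have [] := key _ eps0.
(* A single null set outside which membership does not depend on the level. *)
pose N := \bigcup_n (if unpickle n is Some y then (e y `\` e (y + 1)) `|` (e (y + 1) `\` e y) else set0).
have mN : measurable N.
  apply: bigcupT_measurable => n; case: (unpickle n) => // y.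
  by apply: measurableU; exact: measurableD.
have N0 : lam N = 0%E.
  apply: measure_negligible => //; apply: negligible_bigcup => n.
  case: (unpickle n) => [y|]; last exact: negligible_set0.
  apply/negligibleP; last exact: step.
  by apply: measurableU; exact: measurableD.
have eN x y : ~ N x -> (e y x <-> e (y + 1) x).
  move=> nN; split=> H; apply: contrapT => H1; apply: nN;
    (exists (pickle y); first by []); rewrite pickleK; [left|right]; by split.
have e0 x y : ~ N x -> (e y x <-> e 0 x).
  move=> nN; have pos (n : nat) : e n%:Z x <-> e 0 x.
    by elim: n => // n <-; rewrite -addn1 PoszD; apply: iff_sym; exact: eN.
  have neg (n : nat) : e (- n%:Z) x <-> e 0 x.
    elim: n => [|n <-]; first by rewrite oppr0.
    by rewrite (eN x _ nN) -addn1 PoszD opprD subrK.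
  case: y => n; first exact: pos.
  by rewrite NegzE; exact: neg.
pose B := pi @^-1` e 0 : set (measurableTypeR R).
have mB : measurable B by exact: measurable_lift.
(* [F] sends [(u, 0)] to the level [phi u] over [u + alpha], which agrees with level 0 off [N];
   hence [D] must exclude [N] at both base points. *)
have galpha x r : r < 2^-1 -> leb (B `&` ball (x + alpha) r) = leb (B `&` ball x r).
  move=> r2; rewrite -(lebesgue_ball_translate _ _ _ mB).
  pose D := N `|` (fun z => z + pi alpha) @^-1` N.
  have mTN : measurable ((fun z => z + pi alpha) @^-1` N).
    by rewrite -[X in measurable X]setTI; exact: measurable_circle_add.
  have mD : measurable D by exact: measurableU.
  have D0 : lam D = 0%E.
    apply/eqP; rewrite eq_le measure_ge0 andbT; apply: le_trans (measureU2 _ _ _) _ => //.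
    have TN0 : lam ((fun z => z + pi alpha) @^-1` N) = 0%E by rewrite circle_measure_add.
    by rewrite [X in (X + _)%E]N0 [X in (_ + X)%E]TN0 adde0.
  have mTe : measurable ((fun z => z + pi alpha) @^-1` e 0).
    by rewrite -[X in measurable X]setTI; exact: measurable_circle_add.
  have -> : (fun u => u + alpha) @^-1` B = pi @^-1` ((fun z => z + pi alpha) @^-1` e 0).
    by apply/seteqP; split => u; rewrite /B /= to_circleD.
  have HD u : ~ D u -> (e 0 (u + pi alpha) <-> e 0 u).
    move=> nD; have nN : ~ N u by move=> ?; apply: nD; left.
    have nN' : ~ N (u + pi alpha) by move=> ?; apply: nD; right.
    rewrite -(e0 _ (phi u) nN') /e /level /= -[X in _ <-> X](invn 1).
    by rewrite /F /skew_product /= add0r; exact: iff_refl.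
  apply/eqP; rewrite eq_le; apply/andP; split.
    have := @lebesgue_ball_compare _ (e 0) D 0 x r mTe (me 0) mD _ r2.
    rewrite [X in (_ <= _ + X + _)%E]D0 normr0 !adde0; apply => u nD; rewrite (@to_circle_int _ 0) ?rpred0// addr0.
    by move=> /(HD u nD).
  have := @lebesgue_ball_compare (e 0) _ D 0 x r (me 0) mTe mD _ r2.
  rewrite [X in (_ <= _ + X + _)%E]D0 normr0 !adde0; apply => u nD; rewrite (@to_circle_int _ 0) ?rpred0// addr0.
  by move=> /(HD u nD).
have gint (x : R) (p : int) (r : R) : leb (B `&` ball (x + p%:~R) r) = leb (B `&` ball x r).
  rewrite -(lebesgue_ball_translate _ _ _ mB); congr (leb (_ `&` _)).
  by apply/seteqP; split => u; rewrite /B /= to_circleDint// intr_int.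
have gk (x : R) (k p : int) (r : R) : r < 2^-1 ->
    leb (B `&` ball (x + (k%:~R * alpha - p%:~R)) r) = leb (B `&` ball x r).
  move=> r2; rewrite addrA -intrN gint.
  have pos (n : nat) (z : R) : leb (B `&` ball (z + n%:R * alpha) r) = leb (B `&` ball z r).
    by elim: n => [|n <-]; rewrite ?mul0r ?addr0// -natr1 mulrDl mul1r addrA galpha.
  case: k => n; first exact: pos.
  by rewrite NegzE intrN mulNr -(pos n.+1 (x - _)) -pmulrn subrK.
have gmul (x : R) (k p : int) (b : nat) (r : R) : r < 2^-1 ->
    leb (B `&` ball (x + b%:R * (k%:~R * alpha - p%:~R)) r) = leb (B `&` ball x r).
  move=> r2; have -> : b%:R * (k%:~R * alpha - p%:~R) = (b%:Z * k)%:~R * alpha - (b%:Z * p)%:~R.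
    by rewrite !intrM -!pmulrn; ring.
  exact: gk.
have gle (x y r : R) : r < 2^-1 -> x <= y -> leb (B `&` ball x r) = leb (B `&` ball y r).
  move=> r2 xy.
  have key eps : 0 < eps -> exists s, leb (B `&` ball s r) = leb (B `&` ball x r) /\ `|y - s| <= eps.
    move=> eps0; have [k [p /andP[t0 teps]]] := dense _ eps0.
    set t := _ - _ in t0 teps.
    (* Steps of length [t < eps] from [x] stop less than [eps] short of [y]; each preserves the
       measure in the ball, which varies continuously with the centre. *)
    exists (x + (Num.trunc ((y - x) / t))%:R * t); split; first exact: gmul.
    have yx0 : 0 <= (y - x) / t by apply: divr_ge0; [rewrite subr_ge0|exact: ltW].
    have /andP[h1 h2] := truncn_itv yx0.
    move: h1 h2; set q := Num.trunc _; rewrite ler_pdivlMr// ltr_pdivrMr// => h1.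
    have -> : q.+1%:R * t = q%:R * t + t by rewrite -natr1 mulrDl mul1r.
    move=> h2.
    by rewrite ger0_norm; lra.
  apply/eqP; rewrite eq_le; apply/andP; split; apply/lee_addgt0Pr => eps eps0; have [s [<- hs]] := key _ eps0.
    by apply: le_trans (lebesgue_ball_move y s r mB) _; rewrite leeD2l// lee_fin -normrN opprB.
  by apply: le_trans (lebesgue_ball_move s y r mB) _; rewrite leeD2l// lee_fin.
have triv : leb B = 0%E \/ leb (~` B) = 0%E.
  apply: lebesgue_density_const => // x y r r0 r2.
  by have [xy|/ltW xy] := leP x y; [exact: gle|apply/esym; exact: gle].
have le0 (A : set T) : measurable A -> (forall x, ~ N x -> A x -> False) -> lam A = 0%E.
  move=> mA H; apply/eqP; rewrite eq_le measure_ge0 andbT -N0; apply: le_measure; rewrite ?inE//.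
  by move=> x Ax; apply: contrapT => nN; exact: (H x).
have sub0 (A A' : set T) : measurable A -> measurable A' -> lam A' = 0%E ->
    (forall x, ~ N x -> A x -> A' x) -> lam A = 0%E.
  move=> mA mA' A'0 H; apply/eqP; rewrite eq_le measure_ge0 andbT.
  apply: (@le_trans _ _ (lam (A' `|` N))).
    apply: le_measure; rewrite ?inE//; first exact: measurableU.
    by move=> x Ax; have [?|nN] := pselect (N x); [right|left; exact: H].
  by apply: le_trans (measureU2 _ _ _) _ => //; rewrite [X in (X + _)%E]A'0 [X in (_ + X)%E]N0 adde0.
case: triv => B0; [left|right]; apply: cylinder_measure_eq0 => //.
- move=> y; apply: (sub0 _ (e 0)) => //; first exact: circle_null_lebesgue.
  by move=> x nN; rewrite -/(e y) (e0 x y nN).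
- exact: measurableC.
- move=> y; apply: (sub0 _ (~` e 0)) => //.
  + by have := measurableC (me y).
  + exact: measurableC.
  + by apply: circle_null_lebesgue => //; exact: measurableC.
  + by move=> x nN; rewrite /= -(e0 x y nN).
Qed.
End ergodicity.

(** * Counting in progressions and pairs of times *)

Section counting_lemmas.
Context (R : realType).

Lemma count_progression_interval (y s c : R) (m : nat) : 0 < s ->
  \sum_(b < m) ((c <= y + b%:R * s < c + 1)%R%:R : R) <= s^-1 + 1.
Proof.
move=> s0; have s0' : 0 < s^-1 by rewrite invr_gt0.
have shift z k : z + k.+1%:R * s = z + s + k%:R * s :> R by rewrite -natr1; ring.
have recl z k : \sum_(b < k.+1) ((c <= z + b%:R * s < c + 1)%R%:R : R) =
    (c <= z < c + 1)%R%:R + \sum_(b < k) ((c <= z + s + b%:R * s < c + 1)%R%:R : R).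
  rewrite big_ord_recl /= mul0r addr0; congr (_ + _).
  by apply: eq_bigr => i _; rewrite /bump /= add1n shift.
(* A starting point past [c] needs the sharper bound by the remaining length [c + 1 - z] for the
   induction to close. *)
suff H : forall z, (\sum_(b < m) ((c <= z + b%:R * s < c + 1)%R%:R : R) <= s^-1 + 1) /\
    (c <= z -> \sum_(b < m) ((c <= z + b%:R * s < c + 1)%R%:R : R) <= Num.max 0 ((c + 1 - z) / s + 1)).
  exact: (H y).1.
elim: m => [|m ih] z.
  by rewrite big_ord0; split=> [|_]; [rewrite addr_ge0// ltW|rewrite le_max lexx].
have bnd : c <= z -> \sum_(b < m.+1) ((c <= z + b%:R * s < c + 1)%R%:R : R) <= Num.max 0 ((c + 1 - z) / s + 1).
  move=> cz; rewrite recl.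
  have e : (c + 1 - (z + s)) / s + 1 = (c + 1 - z) / s by field; exact: lt0r_neq0.
  have czs : c <= z + s by lra.
  have := (ih (z + s)).2 czs; rewrite e => h.
  have [zc1|zc1] := ltP z (c + 1).
    have t0 : 0 < (c + 1 - z) / s by rewrite divr_gt0// subr_gt0.
    rewrite max_r ?(ltW t0)// in h.
    by rewrite cz/= le_max; apply/orP; right; rewrite addrC lerD2r.
  rewrite andbF add0r; apply: le_trans h _; rewrite ge_max !le_max lexx/=.
  by apply/orP; right; lra.
split => //.
have [cz|zc] := leP c z.
  apply: le_trans (bnd cz) _; rewrite ge_max addr_ge0 ?(ltW s0')//=.
  by rewrite lerD2r ler_pdivrMr// mulVf ?gt_eqF//; lra.
have zc' : (c <= z) = false by rewrite leNgt zc.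
by rewrite recl zc' /= add0r; exact: (ih _).1.
Qed.

Lemma count_progression_mod (y s : R) (m N : nat) (w : int) : 0 < s -> (0 < N)%N -> m%:R * s <= N%:R ->
  \sum_(b < m) (((Num.floor (y + b%:R * s) %% N)%Z == w)%:R : R) <= 2 * (s^-1 + 1).
Proof.
move=> s0 N0 msN.
(* [c] is the first integer from [f0] on congruent to [w]. The floors stay between [f0] and
   [f0 + N], so only [c] and [c + N] can occur, whence the factor 2. *)
pose f0 := Num.floor y; pose c := f0 + ((w - f0) %% N)%Z.
apply: (@le_trans _ _ (\sum_(b < m) (((c%:~R <= y + b%:R * s < c%:~R + 1)%R%:R : R) +
    (((c + N)%R%:~R <= y + b%:R * s < (c + N)%R%:~R + 1)%R%:R : R)))); last first.
  by rewrite big_split/= mulr2n mulrDl !mul1r lerD// count_progression_interval.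
apply: ler_sum => b _.
set f := Num.floor (y + b%:R * s).
have fE d : (d%:~R <= y + b%:R * s < d%:~R + 1) = (f == d).
  by rewrite /f floor_eq intrD.
rewrite !fE; case: eqP => [fw|_]; last by rewrite addr_ge0.
have f0f : f0 <= f by apply: le_floor; rewrite lerDl mulr_ge0// ltW.
have ff0 : f <= f0 + N.
  rewrite -ltzD1 -addrA /f floor_lt_int.
  have bm : b%:R * s < N%:R by apply: lt_le_trans msN; rewrite ltr_pM2r// ltr_nat.
  have := floorD1_gt y; rewrite -/f0 !intrD -pmulrn; lra.
have [k fk] : exists k : int, f = c + k * N.
  exists ((f - c) %/ N)%Z; apply/eqP; rewrite -subr_eq0.
  have : (f = c %[mod N])%Z.
    by rewrite /c modzDmr addrC subrK -fw modz_mod.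
  move/eqP; rewrite eqz_mod_dvd => /divzK ->; apply/eqP; ring.
have := modz_ge0 (w - f0) (lt0r_neq0 (N0 : 0 < N%:Z)); have := ltz_pmod (w - f0) (N0 : 0 < N%:Z) => c1 c2.
have : (k == 0) || (k == 1).
  have Nk : (-1 < k) && (k < 2).
    have N0' : 0 < N%:Z by [].
    rewrite -(ltr_pM2r N0') -(ltr_pM2r N0' k); move: fk c1 c2 f0f ff0; rewrite /c; lia.
  by lia.
by case/orP => /eqP k0; rewrite fk k0 ?mul0r ?mul1r ?addr0 eqxx ?lerDl ?lerDr.
Qed.

(** The coincidences number the sum of the squares of the [V] fibre sizes, which add up to [L]; this
    is the Cauchy-Schwarz inequality. *)
Lemma pigeonhole_pairs (f : nat -> int) (L V : nat) : (0 < V)%N ->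
  (forall n, 0 <= f n < V%:Z) ->
  L%:R ^+ 2 / V%:R <= \sum_(n < L) \sum_(n' < L) ((f n == f n')%:R : R).
Proof.
move=> V0 fV.
have V0' : 0 < V%:R :> R by rewrite ltr0n.
pose D v := \sum_(n < L) ((f n == v%:Z)%:R : R).
have eqD n n' : (f n == f n')%:R = \sum_(v < V) (f n == v%:Z)%:R * (f n' == v%:Z)%:R :> R.
  have /andP[fn0 fnV] := fV n.
  have lt : (`|f n| < V)%N by move: fn0 fnV; case: (f n).
  rewrite (bigD1 (Ordinal lt))//= big1 ?addr0.
    by rewrite gez0_abs// eqxx mul1r eq_sym.
  move=> v vn; rewrite (_ : f n == v%:Z = false) ?mul0r//; apply/negP => /eqP e.
  by move/eqP: vn; apply; apply: val_inj; rewrite /= e.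
have -> : \sum_(n < L) \sum_(n' < L) ((f n == f n')%:R : R) = \sum_(v < V) D v ^+ 2.
  under eq_bigr do (under eq_bigr do rewrite eqD; rewrite exchange_big/=).
  rewrite exchange_big/=; apply: eq_bigr => v _.
  by rewrite expr2 mulr_suml; apply: eq_bigr => n _; rewrite mulr_sumr.
have sumD : \sum_(v < V) D v = L%:R.
  rewrite /D exchange_big/= -[in RHS](card_ord L) -sum1_card natr_sum; apply: eq_bigr => n _.
  have := eqD n n; rewrite eqxx => ->; apply: eq_bigr => v _.
  by case: eqP; rewrite ?mul1r ?mul0r.
(* Convexity at the mean fibre size: each square lies above its tangent line at [t]. *)
pose t : R := L%:R / V%:R.
apply: (@le_trans _ _ (\sum_(v < V) (2 * t * D v - t ^+ 2))).
  rewrite sumrB -mulr_sumr sumD sumr_const card_ord -[X in _ - X]mulr_natr /t.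
  rewrite le_eqVlt; apply/orP; left; apply/eqP; field; exact: lt0r_neq0.
apply: ler_sum => v _; have : 0 <= (D v - t) ^+ 2 by exact: sqr_ge0.
by rewrite sqrrB; lra.
Qed.

(** By symmetry ordered pairs give at least half of the sum; writing them as [n] and [n + d] and
    letting [d] run up to [L] only adds nonnegative terms. *)
Lemma double_sum_shift (g : nat -> nat -> R) (L : nat) :
  (forall n n', 0 <= g n n') -> (forall n n', g n n' = g n' n) ->
  \sum_(n < L) \sum_(n' < L) g n n' <= 2 * \sum_(n < L) \sum_(d < L) g n (n + d)%N.
Proof.
move=> g0 gsym.
pose U := \sum_(n < L) \sum_(n' < L | (n <= n')%N) g n n'.
have UL : U <= \sum_(n < L) \sum_(d < L) g n (n + d)%N.
  apply: ler_sum => n _.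
  rewrite -(big_mkord (fun n' => (n <= n')%N) (fun n' => g n n')) -(big_mkord xpredT (fun d => g n (n + d)%N)).
  rewrite big_mkcond (big_cat_nat (n := n))//=; last exact: ltnW.
  rewrite [X in X + _]big_nat_cond [X in X + _]big1 ?add0r; last first.
    by move=> i /andP[/andP[_ ni] _]; rewrite leqNgt ni.
  rewrite -{1}[nat_of_ord n]add0n big_addn.
  rewrite [leRHS](big_cat_nat (n := L - n))//=; last exact: leq_subr.
  rewrite -[leLHS]addr0 lerD ?sumr_ge0//.
  by apply: ler_sum => i _; rewrite leq_addl addnC.
apply: (@le_trans _ _ (2 * U)); last by rewrite ler_pM2l.
have U2 : U = \sum_(n < L) \sum_(n' < L | (n' <= n)%N) g n n'.
  rewrite /U (exchange_big_dep predT)//=; apply: eq_bigr => n _; apply: eq_bigr => n' _; exact: gsym.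
rewrite mulr2n mulrDl mul1r {2}U2 -big_split/=.
apply: ler_sum => n _; rewrite [X in _ <= X + _]big_mkcond [X in _ <= _ + X]big_mkcond -big_split/=.
apply: ler_sum => n' _.
by case: ltngtP; rewrite ?addr0 ?add0r// => _; rewrite lerDl.
Qed.

Lemma sum_ord_mul (g : nat -> R) (m Q : nat) :
  \sum_(n < m * Q) g n = \sum_(i < Q) \sum_(b < m) g (b * Q + i)%N.
Proof.
rewrite exchange_big/=; elim: m => [|m ih]; first by rewrite mul0n !big_ord0.
rewrite big_ord_recr/= -ih mulSnr -(big_mkord xpredT g) (big_cat_nat (n := m * Q))//=; last exact: leq_addr.
rewrite big_mkord; congr (_ + _).
rewrite -{1}[(m * Q)%N]add0n big_addn addKn big_mkord.
by apply: eq_bigr => i _; rewrite addnC.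
Qed.
End counting_lemmas.

(** * Separation of scales and ergodicity of the cocycle *)

Section staircase_dynamics.
Context (R : realType) (alpha : R) (K : nat -> int) (th : nat -> R).
Hypothesis fa : fast_approximation alpha K th.
Local Notation T := (circle R).
Local Notation lam := (@circle_measure R).
Local Notation pi := (@to_circle R).
Local Notation a := (@to_circle R alpha).
Local Notation Q j := (`|K j|%N).
Local Notation N := steps.
Local Notation M j := (stair_freq (N j) (K j)).
(** From here on [H j] stops strictly below [j]; the sum up to and including index [j] is
    [H j.+1]. *)
Local Notation H j := (transfer_sum (@stair R K) j).
Local Notation S := (cocycle_sum (@stair R K) a).
Local Notation upper_moves j := (upper_moves K th j).

Lemma stair_freq_abs j : `|(M j)%:~R : R| = (N j)%:R * (Q j)%:R.
Proof. by rewrite /stair_freq intrM normrM -pmulrn normr_nat -intr_norm fa_absK. Qed.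

Lemma natr_steps_gt0 j : 0 < (N j)%:R :> R.
Proof. by rewrite ltr0n steps_gt0. Qed.

Lemma natr_Q_gt0 j : 0 < (Q j)%:R :> R.
Proof. by rewrite ltr0n (fa_Q_gt0 fa). Qed.

Lemma steps_growth j : 4 * (N j)%:R <= 2 ^- (j * j + 4 * j + 7) * growth R j.
Proof.
rewrite [leRHS]mulrC ler_pdivlMr ?exprn_gt0// natr_steps (_ : 4 = 2 ^+ 2); last by rewrite expr2; ring.
by rewrite -!exprD ler_weXn2l ?ler1n//; nia.
Qed.

(* Outside this set no staircase of index below [j] moves under a rotation by at most [1 / Q j]. *)
Definition lower_moves (j : nat) : set T :=
  \big[setU/set0]_(i < j) near_int (M i) (`|(M i)%:~R| / (Q j)%:R).

Lemma measurable_lower_moves j : measurable (lower_moves j).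
Proof. by apply: bigsetU_measurable => i _; exact: measurable_near_int. Qed.

(** For [i < j] the frequency [|M i|] is at most [1 / th i], whereas [1 / Q j] is at most
    [th i / growth j]; so each of the [j] sets has measure at most [4 / growth j]. *)
Lemma circle_measure_lower_moves j : (lam (lower_moves j) <= (2 ^- (j * j + 4 * j + 8))%:E)%E.
Proof.
have := @Boole_inequality _ _ _ lam (fun i => near_int (M i) (`|(M i)%:~R| / (Q j)%:R)) j.
move=> /(_ (fun i _ => measurable_near_int _ _))/le_trans; apply.
apply: (@le_trans _ _ (\sum_(i < j) (4 * (growth R j)^-1)%:E)%E).
  apply: lee_sum => i _; apply: le_trans (circle_measure_near_int (stair_freq_neq0 fa _) _) _.
    by rewrite divr_ge0.
  rewrite lee_fin ler_pM2l// stair_freq_abs ler_pdivrMr ?natr_Q_gt0//.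
  rewrite ler_pdivlMl ?growth_gt0//.
  have thi := fa_gt0 fa i.
  have h1 : (N i)%:R * (Q i)%:R * th i <= 1.
    have := fa_th_le1 fa i; have := steps_growth i.
    have : 2 ^- (i * i + 4 * i + 7) <= 1 :> R by rewrite invf_le1 ?exprn_gt0// exprn_ege1// ler1n.
    have q0 := natr_Q_gt0 i; have n0 := natr_steps_gt0 i; have g0 := growth_gt0 R i.
    move=> p1 p2 p3; rewrite -mulrA; apply: le_trans p3.
    rewrite mulrC ler_pM2l ?mulr_gt0//.
    have : 2 ^- (i * i + 4 * i + 7) * growth R i <= growth R i by rewrite ler_piMl// ltW.
    lra.
  have h2 := fa_K_lt fa (ltn_ord i).
  rewrite -(ler_pM2r thi) -mulrA; apply: (@le_trans _ _ (growth R j * 1)).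
    by rewrite ler_pM2l ?growth_gt0.
  by rewrite mulr1.
rewrite sumEFin lee_fin sumr_const card_ord -[X in X <= _]mulr_natr.
rewrite mulrAC ler_pdivrMr ?growth_gt0//.
have jj : 4 * j%:R <= 2 ^+ 2 * 2 ^+ j :> R.
  rewrite (_ : 4 = 2 ^+ 2); last by rewrite expr2; ring.
  by rewrite ler_pM2l ?exprn_gt0// -natrX ler_nat ltnW// ltn_expl.
apply: le_trans jj _; rewrite [leRHS]mulrC ler_pdivlMr ?exprn_gt0// -!exprD ler_weXn2l ?ler1n//.
by nia.
Qed.

Lemma transfer_sum_lower_moves j z t : ~ lower_moves j z -> `|t| <= (Q j)%:R^-1 ->
  H j (z + pi t) = H j z.
Proof.
move=> nz tQ; apply: eq_bigr => i _.
apply: (staircase_small_shift (c := `|(M i)%:~R| / (Q j)%:R)) => [h|].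
  apply: nz; rewrite /lower_moves -(bigcup_mkord _ (fun i => near_int (M i) (`|(M i)%:~R| / (Q j)%:R))).
  by exists i => //=.
by rewrite normrM ler_wpM2l.
Qed.

(** Times are positive while [K j] is signed, so the displacement is known only up to sign; its size
    is all that matters. *)
Lemma rotation_multiple j m : exists t, [/\ `|t| = m%:R * th j, (m * Q j)%N%:R * alpha - t \is a Num.int
  & a *+ (m * Q j) = pi t].
Proof.
have [t [t1 t2]] : exists t, `|t| = m%:R * th j /\ (m * Q j)%N%:R * alpha - t \is a Num.int.
  have /intrP[p hp] := fa_int fa j; have th0 := fa_gt0 fa j.
  have mth0 : 0 <= m%:R * th j by rewrite mulr_ge0// ltW.
  have [k0|k0] := leP 0 (K j).
    exists (m%:R * th j); split; first by rewrite ger0_norm.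
    have QK : (Q j)%:R = (K j)%:~R :> R by rewrite -fa_absK ger0_norm.
    by rewrite natrM -mulrA QK -mulrBr hp rpredM// ?intr_int// natr_int.
  exists (- (m%:R * th j)); split; first by rewrite normrN ger0_norm.
  have QK : (Q j)%:R = - (K j)%:~R :> R by rewrite -fa_absK ltr0_norm// intrN.
  have -> : (m * Q j)%N%:R * alpha - - (m%:R * th j) = - (m%:R * ((K j)%:~R * alpha - th j)) by rewrite natrM QK; ring.
  by rewrite hp rpredN rpredM// ?intr_int// natr_int.
by exists t; split => //; rewrite -to_circleMn; apply/to_circle_eqP.
Qed.

Lemma Qth_le j : (Q j)%:R * ((N j)%:R * th j) <= 2 ^- (j * j + 4 * j + 9).
Proof.
have := fa_th_le1 fa j; have := steps_growth j.
have q0 := natr_Q_gt0 j; have g0 := growth_gt0 R j; have thj := fa_gt0 fa j.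
set e := j * j + 4 * j + 7 => h1 h2.
have -> : (j * j + 4 * j + 9 = 2 + e)%N by rewrite /e addnC; lia.
rewrite exprD invfM (_ : 2 ^+ 2 = 4 :> R); last by rewrite expr2; ring.
rewrite ler_pdivlMl// -(ler_pM2r g0).
have -> : 4 * ((Q j)%:R * ((N j)%:R * th j)) * growth R j = ((Q j)%:R * th j * growth R j) * (4 * (N j)%:R) by ring.
apply: (@le_trans _ _ (1 * (4 * (N j)%:R))); last by rewrite mul1r.
by rewrite ler_pM2r// mulr_gt0// natr_steps_gt0.
Qed.

(** Four obstructions to an increment of exactly one: a higher staircase moves, a lower one moves,
    the point is near a jump of the staircase [j], or it may be on the top step, from which climbing
    wraps to 0. *)
Definition unit_time_exception (j : nat) : set T :=
  upper_moves j `|` lower_moves j `|` near_int (M j) ((Q j)%:R * ((N j)%:R * th j)) `|` near_int (K j) (N j)%:R^-1.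

Lemma unit_time j : exists (n : nat) (t : R), [/\ `|t| <= (N j)%:R^-1,
  n%:R * alpha - t \is a Num.int & forall z, ~ unit_time_exception j z -> S n z = 1].
Proof.
have q0 := natr_Q_gt0 j; have n0 := natr_steps_gt0 j; have thj := fa_gt0 fa j.
set c := (Q j)%:R * ((N j)%:R * th j).
have c0 : 0 < c by rewrite !mulr_gt0.
(* Each block of [Q j] iterates lifts the staircase [j] by [c], so [m] blocks lift it by between
   [1 - c] and [1], without moving the point by more than [1 / (N j * Q j)]. *)
pose m := Num.trunc c^-1.
have ci0 : 0 <= c^-1 by rewrite invr_ge0 ltW.
have /andP[] := truncn_itv ci0; rewrite -/m => m1 m2.
have mc1 : m%:R * c <= 1 by rewrite -ler_pdivlMr// div1r.
have mc2 : 1 - c <= m%:R * c.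
  have : 1 < m.+1%:R * c by rewrite -ltr_pdivrMr// div1r.
  by rewrite -natr1; lra.
have [t [t1 t2 t3]] := rotation_multiple j m.
have N1 : 1 <= (N j)%:R :> R by rewrite ler1n steps_gt0.
have Q1 : 1 <= (Q j)%:R :> R by exact: fa_Q_ge1 fa _.
have mQN : m%:R * th j * (Q j)%:R * (N j)%:R <= 1.
  by apply: le_trans mc1; rewrite /c le_eqVlt; apply/orP; left; apply/eqP; ring.
have mth0 : 0 <= m%:R * th j by rewrite mulr_ge0// ltW.
have mQ : m%:R * th j * (Q j)%:R <= 1.
  by apply: le_trans mQN; rewrite ler_peMr// mulr_ge0// ltW.
exists (m * Q j)%N, t; split => //.
  rewrite t1 -[(N j)%:R^-1]mul1r ler_pdivlMr//; apply: le_trans mQN.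
  by rewrite ler_wpM2r ?(ltW n0)// ler_peMr.
move=> z nz.
have nupper_moves : ~ upper_moves j z by move=> h; apply: nz; left; left; left.
have nlower : ~ lower_moves j z by move=> h; apply: nz; left; left; right.
have nM : ~ near_int (M j) c z by move=> h; apply: nz; left; right.
have nK : ~ near_int (K j) (N j)%:R^-1 z by move=> h; apply: nz; right.
rewrite (cocycle_sum_upper_moves fa nupper_moves); last first.
  by rewrite -[(th j)^-1]mul1r ler_pdivlMr// natrM mulrAC.
have Hrec w : H j.+1 w = H j w + stair K j w by rewrite /transfer_sum big_ord_recr.
have ns : (m * Q j)%N%:R * ((N j)%:R * th j) = m%:R * c :> R by rewrite natrM /c; ring.
rewrite !Hrec {1}t3 transfer_sum_lower_moves//; last by rewrite t1 -[(Q j)%:R^-1]mul1r ler_pdivlMr.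
rewrite /stair (staircase_step (steps_gt0 j) (fa_int fa j) (ltW c0) nM nK) ?ns//.
ring.
Qed.

Lemma measurable_unit_time_exception j : measurable (unit_time_exception j).
Proof.
apply: measurableU; last exact: measurable_near_int.
apply: measurableU; last exact: measurable_near_int.
by apply: measurableU; [exact: measurable_upper_moves|exact: measurable_lower_moves].
Qed.

Lemma circle_measure_unit_time_exception j : (lam (unit_time_exception j) <= (8 * 2 ^- j)%:E)%E.
Proof.
have b0 : 0 < 2 ^- j :> R by rewrite invr_gt0 exprn_gt0.
have le2 k : (j <= k)%N -> 2 ^- k <= 2 ^- j :> R.
  by move=> jk; rewrite lef_pV2 ?posrE ?exprn_gt0// ler_weXn2l// ler1n.
have mt := measurable_upper_moves K th j; have mh := measurable_lower_moves j.
have m1 := @measurable_near_int R (M j) ((Q j)%:R * ((N j)%:R * th j)).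
have m2 := @measurable_near_int R (K j) (N j)%:R^-1.
have q0 := natr_Q_gt0 j; have n0 := natr_steps_gt0 j; have thj := fa_gt0 fa j.
have b1 : (lam (upper_moves j) <= (2 ^- j)%:E)%E.
  by apply: le_trans (circle_measure_upper_moves fa j) _; rewrite lee_fin le2//; nia.
have b2 : (lam (lower_moves j) <= (2 ^- j)%:E)%E.
  by apply: le_trans (circle_measure_lower_moves j) _; rewrite lee_fin le2//; nia.
have b3 : (lam (near_int (M j) ((Q j)%:R * ((N j)%:R * th j))) <= (4 * 2 ^- j)%:E)%E.
  apply: le_trans (circle_measure_near_int (stair_freq_neq0 fa _) _) _.
    by rewrite !mulr_ge0// ltW.
  rewrite lee_fin ler_pM2l//; apply: le_trans (Qth_le j) _; apply: le2; nia.
have b4 : (lam (near_int (K j) (N j)%:R^-1) <= (2 * 2 ^- j)%:E)%E.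
  apply: le_trans (circle_measure_near_int _ _) _.
  - by rewrite -absz_gt0 (fa_Q_gt0 fa).
  - by rewrite invr_ge0 ltW.
  rewrite lee_fin natr_steps exprS invfM mulrA le_eqVlt; apply/orP; left; apply/eqP; congr (_ * _); by field.
rewrite /unit_time_exception.
apply: le_trans (measureU2 _ _ _) _ => //; first by apply: measurableU => //; exact: measurableU.
have -> : 8 * 2 ^- j = (2 ^- j + 2 ^- j + 4 * 2 ^- j) + 2 * 2 ^- j :> R by ring.
rewrite EFinD; apply: leeD => //; apply: le_trans (measureU2 _ _ _) _ => //; first exact: measurableU.
rewrite EFinD; apply: leeD => //; apply: le_trans (measureU2 _ _ _) _ => //.
by rewrite EFinD; apply: leeD.
Qed.

Lemma two_pow_small (eps : R) : 0 < eps -> exists j, 8 * 2 ^- j <= eps :> R.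
Proof.
move=> eps0; exists (Num.trunc (8 / eps)).+1; set j := (Num.trunc _).+1.
have h : 8 / eps < j%:R by have /andP[] := truncn_itv (ltW (divr_gt0 (ltr0n R 8) eps0)).
rewrite ler_pdivrMr ?exprn_gt0// mulrC -ler_pdivrMr//; apply: ltW; apply: lt_trans h _.
by rewrite -natrX ltr_nat ltn_expl.
Qed.

Lemma ergodic_stair : ergodic (@cylinder_measure R) (skew_product alpha (stair_cocycle alpha K)).
Proof.
apply: ergodic_skew; first exact: measurable_stair_cocycle.
  move=> eps eps0; have [j hj] := two_pow_small eps0.
  have /intrP[p hp] := fa_int fa j; exists (K j), p.
  rewrite -hp opprB addrC subrK (fa_gt0 fa)/=; apply: lt_le_trans hj.
  have := Qth_le j; have := fa_Q_ge1 fa j; have thj := fa_gt0 fa j.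
  have N1 : 1 <= (N j)%:R :> R by rewrite ler1n steps_gt0.
  move=> Q1 /(le_trans _) h; apply: (@le_lt_trans _ _ (2 ^- (j * j + 4 * j + 9))).
    apply: h; rewrite mulrA ler_peMl ?(ltW thj)//.
    by rewrite -[leLHS]mulr1 ler_pM.
  apply: (@le_lt_trans _ _ (2 ^- j)).
    by rewrite lef_pV2 ?posrE ?exprn_gt0// ler_weXn2l ?ler1n//; nia.
  have : 0 < 2 ^- j :> R by rewrite invr_gt0 exprn_gt0.
  lra.
move=> eps eps0; have [j hj] := two_pow_small eps0.
have [n [t [t1 t2 t3]]] := unit_time j; exists n, t; split => //.
  apply: le_trans t1 (le_trans _ hj); rewrite natr_steps exprS invfM.
  have : 0 < 2 ^- j :> R by rewrite invr_gt0 exprn_gt0.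
  lra.
apply: (@le_trans _ _ (lam (unit_time_exception j))); last first.
  by apply: le_trans (circle_measure_unit_time_exception j) _; rewrite lee_fin.
apply: le_measure; rewrite ?inE.
- exact: (measurable_int_preimage [set k | k != 1] ((measurable_fun_intP _).1 (@measurable_stair_sum R alpha K n))).
- exact: measurable_unit_time_exception.
by move=> z /= /eqP nS; apply: contrapT => nz; apply: nS; exact: t3.
Qed.
End staircase_dynamics.

(** * Counting returns to a level during one turn *)

Section return_times.
Context (R : realType) (alpha : R) (K : nat -> int) (th : nat -> R).
Hypothesis fa : fast_approximation alpha K th.
Local Notation T := (circle R).
Local Notation lam := (@circle_measure R).
Local Notation pi := (@to_circle R).
Local Notation a := (@to_circle R alpha).
Local Notation Q j := (`|K j|%N).
Local Notation N := steps.
Local Notation M j := (stair_freq (N j) (K j)).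
Local Notation H j := (transfer_sum (@stair R K) j).
Local Notation S := (cocycle_sum (@stair R K) a).
Local Notation upper_moves j := (upper_moves K th j).
Local Notation lower_moves j := (@lower_moves R K j).

(** With this choice [loops j * Q j] is the largest multiple of [Q j] up to [1 / th j]. *)
Definition loops (j : nat) : nat := Num.trunc (((Q j)%:R * th j)^-1).

(* One full turn of the staircase of index [j]. *)
Definition turn (j : nat) : nat := (loops j * Q j)%N.

(* A rotation by [alpha] advances [M j * x] by this amount modulo [N j]. *)
Definition step_rate (j : nat) : R := (N j)%:R * th j.
Local Notation eta := step_rate.

Lemma step_rate_gt0 j : 0 < eta j.
Proof. by rewrite mulr_gt0 ?natr_steps_gt0// (fa_gt0 fa). Qed.

Lemma turn_th j : (turn j)%:R * th j <= 1.
Proof.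
have q0 := natr_Q_gt0 fa j; have thj := fa_gt0 fa j.
have qt0 : 0 < (Q j)%:R * th j by rewrite mulr_gt0.
have ci0 : 0 <= ((Q j)%:R * th j)^-1 by rewrite invr_ge0 ltW.
have /andP[+ _] := truncn_itv ci0; rewrite -/(loops j) => h.
by rewrite /turn natrM -mulrA -ler_pdivlMr// div1r.
Qed.

Lemma turn_le j : (turn j)%:R <= (th j)^-1.
Proof. by rewrite -[leRHS]mul1r ler_pdivlMr ?turn_th// (fa_gt0 fa). Qed.

Lemma Q_step_rate_le j : (Q j)%:R * eta j <= 2^-1.
Proof.
apply: le_trans (Qth_le fa j) _; rewrite -[X in _ <= X^-1]expr1.
by rewrite lef_pV2 ?posrE ?exprn_gt0// ler_weXn2l ?ler1n//; lia.
Qed.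

Lemma Q_th_le j : (Q j)%:R * th j <= 2^-1.
Proof.
apply: le_trans (Q_step_rate_le j); rewrite ler_pM2l ?(natr_Q_gt0 fa)//.
by rewrite ler_peMl ?(ltW (fa_gt0 fa _))// ler1n steps_gt0.
Qed.

Lemma turn_ge j : (2 * th j)^-1 <= (turn j)%:R.
Proof.
have q0 := natr_Q_gt0 fa j; have thj := fa_gt0 fa j.
have qt0 : 0 < (Q j)%:R * th j by rewrite mulr_gt0.
have ci0 : 0 <= ((Q j)%:R * th j)^-1 by rewrite invr_ge0 ltW.
have /andP[_ +] := truncn_itv ci0; rewrite -/(loops j) => h.
have : 1 < (loops j).+1%:R * ((Q j)%:R * th j) by rewrite -ltr_pdivrMr// div1r.
rewrite -natr1 mulrDl mul1r => h2; have h3 := Q_th_le j.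
rewrite -[leLHS]mul1r ler_pdivrMr ?mulr_gt0// /turn natrM; lra.
Qed.

Lemma turn_gt0 j : (0 < turn j)%N.
Proof.
rewrite -(ltr_nat R); apply: lt_le_trans (turn_ge j).
by rewrite invr_gt0 mulr_gt0// (fa_gt0 fa).
Qed.

Lemma turn_lt j : (turn j < turn j.+1)%N.
Proof.
have thj := fa_gt0 fa j; have thj1 := fa_gt0 fa j.+1.
rewrite -(ltr_nat R); apply: le_lt_trans (turn_le j) _; apply: lt_le_trans (turn_ge j.+1).
rewrite ltf_pV2 ?posrE ?mulr_gt0//.
have := fa_th_lt fa (ltnSn j); have q1 := fa_Q_ge1 fa j.+1.
have g1 : 2 ^+ 2 <= growth R j.+1 by apply: growth_ge; lia.
move=> h; apply: lt_le_trans h; rewrite mulrAC [_ * growth _ _]mulrC ltr_pM2r//.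
have : growth R j.+1 <= (Q j.+1)%:R * growth R j.+1 by rewrite ler_peMl// (ltW (growth_gt0 _ _)).
by move: g1; rewrite expr2; lra.
Qed.

(* When [z + a *+ i] is outside [lower_moves j], the lower staircases [H j] are constant along the times
   [i + b * Q j] with [b < loops j]; here too many [i < Q j] are exceptional. *)
Definition crowded (j : nat) : set T :=
  [set z | (Q j)%:R / (N j)%:R < \sum_(i < Q j) (\1_(lower_moves j) (z + a *+ i) : R)].

Lemma measurable_lower_moves_shift j i : measurable ((fun z => z + a *+ i) @^-1` lower_moves j).
Proof.
by rewrite -[X in measurable X]setTI; apply: measurable_circle_add => //; exact: measurable_lower_moves.
Qed.

Lemma indic_shift (A : set T) (w z : T) : \1_A (z + w) = \1_((fun z => z + w) @^-1` A) z :> R.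
Proof. by rewrite !indicE. Qed.

Lemma measurable_crowded j : measurable (crowded j).
Proof.
have mf : measurable_fun [set: T] (fun z => \sum_(i < Q j) (\1_(lower_moves j) (z + a *+ i) : R)).
  apply: measurable_sum => i; under eq_fun do rewrite indic_shift.
  by apply: measurable_indic; exact: measurable_lower_moves_shift.
have := mf measurableT _ (measurable_itv `](Q j)%:R / (N j)%:R, +oo[); rewrite setTI.
by congr measurable; apply/seteqP; split => z /=; rewrite in_itv/= andbT.
Qed.

(** By rotation invariance the mean number of bad residues is [Q j * lam (lower_moves j)]; Markov's
    inequality then loses a factor [N j]. *)
Lemma circle_measure_crowded j : (lam (crowded j) <= (2 ^- (j * j + 3 * j + 7))%:E)%E.
Proof.
have q0 := natr_Q_gt0 fa j; have n0 := natr_steps_gt0 R j.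
have QN0 : 0 < (Q j)%:R / (N j)%:R :> R by rewrite divr_gt0.
have := @measure_le_sum_indic _ _ _ lam _ (index_enum 'I_(Q j))
  (fun i => (fun z => z + a *+ i) @^-1` lower_moves j) (crowded j) _ (ltW QN0)
  (measurable_crowded j) (measurable_lower_moves_shift j).
move=> /(_ _)/wrap[].
  by move=> z /ltW; under eq_bigr do rewrite indic_shift.
move=> h0; have h : (((Q j)%:R / (N j)%:R)%:E * lam (crowded j) <= \sum_(i < Q j) lam (lower_moves j))%E.
  apply: le_trans h0 _; apply: lee_sum => i _; rewrite le_eqVlt; apply/orP; left; apply/eqP.
  by apply: circle_measure_add; exact: measurable_lower_moves.
have hf := circle_measure_fin (measurable_crowded j).
have hh := circle_measure_fin (@measurable_lower_moves R K j).
move: h (circle_measure_lower_moves fa j); rewrite -(fineK hf) -(fineK hh).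
rewrite -EFinM sumEFin !lee_fin sumr_const card_ord => h1 h2.
rewrite -[X in _ <= X]mulr_natl in h1.
have h3 : fine (lam (crowded j)) <= (N j)%:R * fine (lam (lower_moves j)).
  rewrite -(ler_pM2l QN0); apply: le_trans h1 _; rewrite mulrA divfK ?gt_eqF//.
apply: le_trans h3 _; apply: (@le_trans _ _ ((N j)%:R * 2 ^- (j * j + 4 * j + 8))).
  by rewrite ler_pM2l.
rewrite natr_steps ler_pdivrMr ?exprn_gt0// mulrC ler_pdivlMr ?exprn_gt0// -!exprD ler_weXn2l ?ler1n//.
by nia.
Qed.

Definition return_exception (j : nat) : set T := upper_moves j `|` crowded j.

Lemma measurable_return_exception j : measurable (return_exception j).
Proof. by apply: measurableU; [exact: measurable_upper_moves|exact: measurable_crowded]. Qed.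

(** The square matches the second moment: on this set the count is only bounded by
    [1 / th j = N j / eta j], so its squared contribution remains [O(eta j ^- 2)]. *)
Lemma circle_measure_return_exception j :
  (lam (return_exception j) <= ((N j)%:R ^- 2)%:E)%E.
Proof.
apply: le_trans (measureU2 _ _ _) _; [exact: measurable_upper_moves|exact: measurable_crowded|].
apply: le_trans (leeD (circle_measure_upper_moves fa j) (circle_measure_crowded j)) _.
rewrite -EFinD lee_fin natr_steps -exprM.
have le2 k : (j.+1 * 2 < k)%N -> 2 ^- k <= 2 ^- (j.+1 * 2) / 2 :> R.
  move=> jk; rewrite -invfM mulrC -exprS lef_pV2 ?posrE ?exprn_gt0// ler_weXn2l ?ler1n//.
have h1 := le2 (j * j + 6 * j + 8)%N; have h2 := le2 (j * j + 3 * j + 7)%N.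
rewrite [leRHS]splitr lerD// ?h1 ?h2//; nia.
Qed.

Lemma return_count_le j z v : ~ return_exception j z ->
  \sum_(n < turn j) ((S n z == v)%:R : R) <= 5 / eta j.
Proof.
move=> nz; have nupper_moves : ~ upper_moves j z by move=> ?; apply: nz; left.
have ncrowd : \sum_(i < Q j) (\1_(lower_moves j) (z + a *+ i) : R) <= (Q j)%:R / (N j)%:R.
  by rewrite leNgt; apply/negP => ?; apply: nz; right.
have q0 := natr_Q_gt0 fa j; have n0 := natr_steps_gt0 R j; have thj := fa_gt0 fa j.
have e0 := step_rate_gt0 j.
have tth := turn_th j.
set s := (Q j)%:R * eta j.
have s0 : 0 < s by rewrite mulr_gt0.
pose w := v + H j.+1 z.
have -> : \sum_(n < turn j) ((S n z == v)%:R : R) =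
    \sum_(n < turn j) ((H j.+1 (z + a *+ n) == w)%:R : R).
  apply: eq_bigr => n _; rewrite (cocycle_sum_upper_moves fa nupper_moves) ?subr_eq//.
  by apply: le_trans (turn_le j); rewrite ler_nat ltnW.
rewrite (sum_ord_mul (fun n => (H j.+1 (z + a *+ n) == w)%:R)).
(* Bad residues are counted trivially. Along a good one the lower staircases are frozen, and the
   staircase [j] advances by [s] per block within a total of [N j]. *)
have bound (i : 'I_(Q j)) : \sum_(b < loops j) ((H j.+1 (z + a *+ (b * Q j + i)) == w)%:R : R) <=
    (loops j)%:R * \1_(lower_moves j) (z + a *+ i) + 2 * (s^-1 + 1).
  rewrite indicE; case: (boolP (_ \in _)) => [_|]; last rewrite notin_setE => nh.
    rewrite mulr1; apply: (@le_trans _ _ (loops j)%:R); last first.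
      by rewrite lerDl mulr_ge0// addr_ge0// invr_ge0 ltW.
    rewrite -[in leRHS](card_ord (loops j)) -sum1_card natr_sum; apply: ler_sum => b _.
    by case: eqP.
  rewrite mulr0 add0r.
  have -> : \sum_(b < loops j) ((H j.+1 (z + a *+ (b * Q j + i)) == w)%:R : R) =
      \sum_(b < loops j) (((Num.floor (((M j)%:~R * repr z + i%:R * eta j) + b%:R * s) %% N j)%Z ==
          w - H j (z + a *+ i))%:R : R).
    apply: eq_bigr => b _.
    have [t [t1 t2 t3]] := rotation_multiple fa j b.
    rewrite {1}/transfer_sum big_ord_recr/= -/(H j _).
    have -> : H j (z + a *+ (b * Q j + i)) = H j (z + a *+ i).
      rewrite addnC mulrnDr addrA t3 transfer_sum_lower_moves// t1.
      rewrite -[leRHS]mul1r ler_pdivlMr//; apply: le_trans tth.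
      rewrite /turn natrM mulrAC ler_pM2r// ler_pM2r// ler_nat; exact: ltnW.
    have -> : stair K j (z + a *+ (b * Q j + i)) =
        (Num.floor (((M j)%:~R * repr z + i%:R * eta j) + b%:R * s) %% N j)%Z.
      rewrite -[in LHS](to_circle_repr z) /stair (staircase_rot _ (fa_int fa j)).
      congr ((Num.floor _ %% _)%Z); rewrite -/(eta j) natrD natrM /s; ring.
    by congr ((nat_of_bool _)%:R); rewrite [RHS]eq_sym subr_eq eq_sym addrC.
  apply: count_progression_mod => //; first exact: steps_gt0.
  have -> : (loops j)%:R * s = (N j)%:R * ((turn j)%:R * th j) by rewrite /turn natrM /s /eta; ring.
  by rewrite -[leRHS]mulr1 ler_pM2l.
apply: (@le_trans _ _ (\sum_(i < Q j) ((loops j)%:R * \1_(lower_moves j) (z + a *+ i) + 2 * (s^-1 + 1)))).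
  by apply: ler_sum => i _; exact: bound.
rewrite big_split/= -mulr_sumr sumr_const card_ord -[X in _ + X]mulr_natl.
apply: (@le_trans _ _ ((loops j)%:R * ((Q j)%:R / (N j)%:R) + (Q j)%:R * (2 * (s^-1 + 1)))).
  by rewrite lerD2r ler_wpM2l.
(* The first summand pays for the bad residues, the other two for [2 / s] and for [2] summed over
   the [Q j] residues. *)
have -> : 5 / eta j = (eta j)^-1 + (2 * (eta j)^-1 + 2 * (eta j)^-1) by ring.
apply: lerD.
  rewrite -[leRHS]mul1r ler_pdivlMr//.
  have -> : (loops j)%:R * ((Q j)%:R / (N j)%:R) * eta j = (turn j)%:R * th j.
    by rewrite /turn natrM /eta; field; exact: lt0r_neq0.
  by [].
have -> : (Q j)%:R * (2 * (s^-1 + 1)) = 2 * (eta j)^-1 + 2 * (Q j)%:R.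
  by rewrite /s; field; rewrite !lt0r_neq0.
rewrite lerD2l ler_pM2l// -[leRHS]mul1r ler_pdivlMr//.
by have := Q_step_rate_le j; rewrite -/s; lra.
Qed.

Lemma measurable_return_set n v : measurable [set z | S n z = v].
Proof. exact: ((measurable_fun_intP _).1 (@measurable_stair_sum R alpha K n) v). Qed.

(** Equal sums at times [n] and [n + d] mean a zero sum of length [d] at the rotated point, so by
    invariance the expected number of coincident pairs is [turn j] times the expected number of
    returns. *)
Lemma return_count_ge j :
  (((16 * eta j)^-1)%:E <= \sum_(n < turn j) lam [set z | S n z = 0%R])%E.
Proof.
have n0 := natr_steps_gt0 R j; have thj := fa_gt0 fa j.
have L0 : 0 < (turn j)%:R :> R by rewrite ltr0n turn_gt0.
have lamr n : lam [set z | S n z = 0%R] \is a fin_num by apply: circle_measure_fin; exact: measurable_return_set.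
pose r n := fine (lam [set z | S n z = 0%R]).
have lamE n : lam [set z | S n z = 0%R] = (r n)%:E by rewrite fineK.
under eq_bigr do rewrite lamE; rewrite sumEFin lee_fin.
have mt := measurable_upper_moves K th j.
have mtC : measurable (~` upper_moves j) by exact: measurableC.
pose A (p : 'I_(turn j) * 'I_(turn j)) : set T := [set z | S (p.1 + p.2)%N z = S p.1 z].
have AE p : A p = (fun z => z + a *+ p.1) @^-1` [set z | S p.2 z = 0].
  apply/seteqP; split => z; rewrite /A /= cocycle_sumD.
    by move=> e; apply: (addrI (S p.1 z)); rewrite addr0.
  by move=> ->; rewrite addr0.
have mA p : measurable (A p).
  rewrite AE -[X in measurable X]setTI; apply: measurable_circle_add => //; exact: measurable_return_set.
(* Pigeonhole among [2 * N j] values, halved by [double_sum_shift]. *)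
pose c : R := (turn j)%:R ^+ 2 / (4 * (N j)%:R).
have c0 : 0 <= c by rewrite divr_ge0 ?exprn_ge0// mulr_ge0.
have := @measure_le_sum_indic _ _ _ lam _ (index_enum ('I_(turn j) * 'I_(turn j))%type)
  A (~` upper_moves j) c c0 mtC mA.
move=> /(_ _)/wrap[].
  move=> z nz.
  pose f n := H j.+1 (z + a *+ n).
  pose g n n' : R := (S n z == S n' z)%:R.
  have V0 : (0 < 2 * N j)%N by rewrite muln_gt0 steps_gt0.
  have fV n : 0 <= f n < (2 * N j)%N%:Z by rewrite transfer_sum_ge0 transfer_sum_lt.
  have h1 := @pigeonhole_pairs R f (turn j) _ V0 fV.
  have h2 := @double_sum_shift R g (turn j) (fun _ _ => ler0n _ _).
  have gE : \sum_(n < turn j) \sum_(n' < turn j) g n n' =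
      \sum_(n < turn j) \sum_(n' < turn j) ((f n == f n')%:R : R).
    apply: eq_bigr => n _; apply: eq_bigr => n' _.
    have nle (k : 'I_(turn j)) : k%:R <= (th j)^-1 by apply: le_trans (turn_le j); rewrite ler_nat ltnW.
    by rewrite /g !(cocycle_sum_upper_moves fa nz)// (inj_eq (addIr _)).
  have := h2 (fun n n' => _); rewrite gE => /(_ _)/wrap[]; first by move=> n n'; rewrite /g eq_sym.
  move=> h3; have := le_trans h1 h3.
  have -> : \sum_(p <- index_enum ('I_(turn j) * 'I_(turn j))%type) (\1_(A p) z : R) =
      \sum_(n < turn j) \sum_(d < turn j) g n (n + d)%N.
    rewrite pair_bigA/=; apply: eq_bigr => -[n d] _; rewrite indicE /g /A/= eq_sym.
    by congr ((nat_of_bool _)%:R); apply/idP/eqP; rewrite inE.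
  rewrite /c natrM.
  have -> : (turn j)%:R ^+ 2 / (2 * (N j)%:R) = 2 * ((turn j)%:R ^+ 2 / (4 * (N j)%:R)) :> R.
    by field; exact: lt0r_neq0.
  by rewrite ler_pM2l.
have -> : (\sum_(p <- index_enum ('I_(turn j) * 'I_(turn j))%type) lam (A p) =
    ((turn j)%:R * \sum_(n < turn j) r n)%:E)%E.
  have lamA p : lam (A p) = (r p.2)%:E.
    rewrite AE -lamE; apply: circle_measure_add; exact: measurable_return_set.
  rewrite (eq_bigr (fun p : 'I_(turn j) * 'I_(turn j) => (r p.2)%:E)); last by move=> p _; exact: lamA.
  rewrite sumEFin -(pair_bigA _ (fun (_ : 'I_(turn j)) (d : 'I_(turn j)) => r d))/=.
  by rewrite sumr_const card_ord mulr_natl.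
have half : ((2^-1)%:E <= lam (~` upper_moves j))%E.
  have : (lam (upper_moves j) + lam (~` upper_moves j) = 1)%E.
    have -> : (lam (upper_moves j) + lam (~` upper_moves j) = lam (upper_moves j `|` ~` upper_moves j))%E.
      by apply/esym; apply: measureU => //; exact: setICr.
    by rewrite setUCr; exact: circle_measureT.
  have f1 := circle_measure_fin mt; have f2 := circle_measure_fin mtC.
  have := circle_measure_upper_moves fa j.
  rewrite -(fineK f1) -(fineK f2) -EFinD !lee_fin => h [e].
  have : 2 ^- (j * j + 6 * j + 8) <= 2^-1 :> R.
    by rewrite -[X in _ <= X^-1]expr1 lef_pV2 ?posrE ?exprn_gt0// ler_weXn2l ?ler1n//; lia.
  lra.
move=> h; have : ((c / 2)%:E <= ((turn j)%:R * \sum_(n < turn j) r n)%:E)%E.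
  by apply: le_trans h; rewrite EFinM lee_wpmul2l.
rewrite lee_fin => h2.
have h3 : (turn j)%:R / (8 * (N j)%:R) <= \sum_(n < turn j) r n.
  rewrite -(ler_pM2l L0); apply: le_trans h2; rewrite /c le_eqVlt; apply/orP; left; apply/eqP.
  by field; exact: lt0r_neq0.
apply: le_trans h3; rewrite ler_pdivlMr ?mulr_gt0//; apply: le_trans (turn_ge j).
rewrite le_eqVlt; apply/orP; left; apply/eqP; rewrite /eta; field.
by rewrite !lt0r_neq0.
Qed.
End return_times.

(** * Manipulation of almost everywhere statements *)

Section almost_everywhere.
Context d (X : measurableType d) (R : realType) (mu : {measure set X -> \bar R}).

Lemma ae_mp (P P' : X -> Prop) : (forall x, P x -> P' x) ->
  {ae mu, forall x, P x} -> {ae mu, forall x, P' x}.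
Proof. by move=> PP' H; apply: negligibleS H => x /= nP Px; apply: nP; exact: PP'. Qed.

Lemma ae_and (P P' : X -> Prop) :
  {ae mu, forall x, P x} -> {ae mu, forall x, P' x} -> {ae mu, forall x, P x /\ P' x}.
Proof.
move=> H H'; apply: negligibleS (negligibleU H H') => x /= nP.
have [Px|?] := pselect (P x); last by left.
by right => P'x; apply: nP.
Qed.

Lemma ae_of_null (A : set X) : measurable A -> mu (~` A) = 0%E -> {ae mu, forall x, A x}.
Proof. by move=> mA A0; apply/negligibleP => //; exact: measurableC. Qed.
End almost_everywhere.

Lemma harmonic_small (R : realType) (eps : R) : 0 < eps -> exists n, harmonic n <= eps.
Proof.
move=> e0; exists (Num.trunc eps^-1); rewrite /harmonic.
have ei : 0 <= eps^-1 by rewrite invr_ge0 ltW.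
have /andP[_ h] := truncn_itv ei.
by rewrite -[leRHS]invrK lef_pV2 ?posrE ?invr_gt0// ltW.
Qed.

(** * From bounds on one set of measure 1 to a law of large numbers *)

Section law.
Context d (X : measurableType d) (R : realType) (mu : {measure set X -> \bar R}) (F : X -> X).
Hypothesis mpF : measure_preserving mu F.
Hypothesis ergF : ergodic mu F.
Local Notation S := (@birkhoff_sum d X R F).

Lemma birkhoff_sum_shift A n z : `|S A n (F z) - S A n z| <= 1.
Proof.
have -> : S A n (F z) - S A n z = \1_A (iter n F z) - \1_A z.
  have e1 : S A n.+1 z = \1_A z + S A n (F z) by exact: ergodic_sumS.
  have e2 : S A n.+1 z = S A n z + \1_A (iter n F z) by rewrite /birkhoff_sum big_ord_recr.
  lra.
by rewrite !indicE; do 2 case: (_ \in _); rewrite /= ?subrr ?subr0 ?sub0r ?normrN ?normr0 ?normr1.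
Qed.

Lemma birkhoff_sum_ge0 A n z : 0 <= S A n z.
Proof. by apply: sumr_ge0. Qed.

Lemma birkhoff_sum_le A n z : S A n z <= n%:R.
Proof.
apply: (@le_trans _ _ (\sum_(j < n) 1)); last by rewrite sumr_const card_ord.
by apply: ler_sum => i _; rewrite indicE; case: (_ \in _).
Qed.

Lemma birkhoff_sum_mono A A' n z : A `<=` A' -> S A n z <= S A' n z.
Proof.
move=> AA'; apply: ler_sum => i _; rewrite !indicE ler_nat.
by case: (boolP (_ \in A)) => //; rewrite inE => /AA'/mem_set->.
Qed.

Lemma measurable_birkhoff_sum A n : measurable A -> measurable_fun [set: X] (S A n).
Proof.
move=> mA; apply: measurable_sum => i; apply: measurableT_comp; first exact: measurable_indic.
exact: measurable_fun_iter mpF _.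
Qed.

Variable B : set X.
Hypothesis mB : measurable B.
Hypothesis B1 : mu B = 1%E.

(** The combination of indicators has negative integral, so its ergodic sums are bounded above. With
    [p] equal to [1] or [-1] this confines [S A] to multiples of [S B] close to [x], up to a bounded
    error. *)
Lemma hopf_ratio (A : set X) (x p q : R) : measurable A -> mu A = x%:E ->
  p * x + q < 0 ->
  {ae mu, forall z, exists M, forall n, p * S A n z + q * S B n z <= M}.
Proof.
move=> mA Ax pq.
have integ (A' : set X) (x' : R) : measurable A' -> mu A' = x'%:E ->
    mu.-integrable [set: X] (EFin \o (\1_A' : X -> R)) /\ (\int[mu]_z (\1_A' z)%:E = x'%:E)%E.
  move=> mA' e; have ei : (\int[mu]_z (\1_A' z)%:E = x'%:E)%E by rewrite integral_indic// setIT.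
  split => //; apply/integrableP; split; first by apply/measurable_EFinP.
  under eq_integral do rewrite /= ger0_norm//.
  by rewrite ei ltry.
have [iA eA] := integ _ _ mA Ax; have [iB eB] := integ _ _ mB B1.
pose h z : R := p * \1_A z + q * \1_B z.
have ih : mu.-integrable [set: X] (EFin \o h).
  have := integrableD measurableT (integrableZl measurableT p iA) (integrableZl measurableT q iB).
  by congr (mu.-integrable _ _).
have eh : (\int[mu]_z (h z)%:E = (p * x + q)%:E)%E.
  rewrite /h; under eq_integral do rewrite EFinD !EFinM.
  rewrite integralD//; [|exact: integrableZl|exact: integrableZl].
  by rewrite !integralZl// eA eB -!EFinM -EFinD mulr1.
have hb : exists C, forall z, `|h z| <= C.
  exists (`|p| + `|q|) => z; apply: le_trans (ler_normD _ _) _; rewrite !normrM.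
  by apply: lerD; rewrite ler_piMr// indicE; case: (_ \in _); rewrite /= ?normr0 ?normr1.
have := ergodic_sum_bounded_above mpF ergF hb ih; rewrite eh lte_fin => /(_ pq).
apply: ae_mp => z [M HM]; exists M => n; apply: le_trans (HM n).
by rewrite /birkhoff_sum /ergodic_sum !mulr_sumr -big_split.
Qed.

Variables (L : nat -> nat) (r : nat -> R).
Hypothesis r0 : forall k, 0 < r k.
Hypothesis rcv : forall eps, 0 < eps -> exists k0, forall k, (k0 <= k)%N -> r k <= eps.
Hypothesis upper : exists C, {ae mu, forall z, exists k0, forall k, (k0 <= k)%N -> r k * S B (L k) z <= C}.
Hypothesis lower : exists2 c0, 0 < c0 &
  ~ {ae mu, forall z, exists k0, forall k, (k0 <= k)%N -> r k * S B (L k) z < c0}.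

(** The explicit gap encodes a strict inequality and leaves room for the change by at most [r k]
    between [z] and [F z], so that the set is exactly invariant, as [ergodic] requires. *)
Definition limsup_lt (t : R) : set X :=
  [set z | exists n k0 : nat, forall k, (k0 <= k)%N -> r k * S B (L k) z <= t - harmonic n].

Lemma measurable_limsup_lt t : measurable (limsup_lt t).
Proof.
have -> : limsup_lt t = \bigcup_n \bigcup_k0 \bigcap_(k in [set k | (k0 <= k)%N])
    ((fun z => r k * S B (L k) z) @^-1` [set` `]-oo, t - harmonic n]]).
  apply/seteqP; split => z /=.
    by move=> [n [k0 H]]; exists n => //; exists k0 => // k /= kk; rewrite in_itv/= H.
  by move=> [n _ [k0 _ H]]; exists n, k0 => k kk; have := H k kk; rewrite /= in_itv.
apply: bigcupT_measurable => n; apply: bigcupT_measurable => k0.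
apply: bigcap_measurable; first by exists k0 => /=.
move=> k _; rewrite -[X in measurable X]setTI.
have mS : measurable_fun [set: X] (fun z => r k * S B (L k) z).
  by apply: measurable_funM => //; exact: measurable_birkhoff_sum.
by apply: mS => //; exact: measurable_itv.
Qed.

Lemma invariant_limsup_lt t : F @^-1` limsup_lt t = limsup_lt t.
Proof.
have key z w : (forall k, S B (L k) w <= S B (L k) z + 1) -> limsup_lt t z -> limsup_lt t w.
  move=> zw [n [k0 H]].
  have e0 : 0 < harmonic n / 2 :> R by rewrite divr_gt0// harmonic_gt0.
  have [k1 H1] := rcv e0.
  (* The index [(2 * n).+1] halves the gap; the other half absorbs [r k]. *)
  exists (2 * n).+1, (maxn k0 k1) => k; rewrite geq_max => /andP[h0 h1].
  apply: (@le_trans _ _ (r k * (S B (L k) z + 1))); first by rewrite ler_pM2l.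
  rewrite mulrDr mulr1; have := H k h0; have := H1 k h1.
  have -> : harmonic (2 * n).+1 = harmonic n / 2 :> R.
    by rewrite /harmonic -invfM -natrM; congr (_%:R^-1); lia.
  lra.
apply/seteqP; split => z /=; apply: key => k; have := birkhoff_sum_shift B (L k) z; rewrite ler_norml => /andP[]; lra.
Qed.

(** Each [limsup_lt t] is null or conull, and [c] is the threshold between the two cases; [upper]
    makes it finite and [lower] makes it positive. *)
Lemma limsup_constant : exists2 c, 0 < c & {ae mu, forall z,
  (forall eps, 0 < eps -> exists k0, forall k, (k0 <= k)%N -> r k * S B (L k) z <= c + eps) /\
  (forall eps, 0 < eps -> forall k0, exists2 k, (k0 <= k)%N & c - eps < r k * S B (L k) z)}.
Proof.
have [C HC] := upper; have [c0 c00 Hc0] := lower.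
pose U := [set t : R | mu (~` limsup_lt t) = 0%E].
have mU t := measurable_limsup_lt t.
have mono t t' : t <= t' -> limsup_lt t `<=` limsup_lt t'.
  by move=> tt' z [n [k0 H]]; exists n, k0 => k kk; apply: le_trans (H k kk) _; rewrite lerD2r.
have UC : U (C + 1).
  apply: measure_negligible; first exact: measurableC.
  apply: negligibleS HC => z /= nz [k0 H]; apply: nz; exists 0%N, k0 => k kk.
  have h0 : harmonic 0 = 1 :> R by rewrite /harmonic/= invr1.
  by rewrite h0 addrK; exact: H.
have Ulb t : U t -> c0 <= t.
  move=> Ut; rewrite leNgt; apply/negP => tc0; apply: Hc0.
  apply: ae_mp (ae_of_null (mU t) Ut) => z [n [k0 H]]; exists k0 => k kk.
  by apply: le_lt_trans (H k kk) _; apply: lt_trans tc0; rewrite ltrBlDr ltrDl harmonic_gt0.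
have Un0 : U !=set0 by exists (C + 1).
pose c := inf U.
have c0c : c0 <= c by apply: lb_le_inf.
have cU t : c < t -> {ae mu, forall z, limsup_lt t z}.
  move=> ct; have [s Us st] := inf_lt Un0 ct.
  by apply: ae_mp (ae_of_null (mU s) Us) => z; apply: mono; exact: ltW.
have ncU t : t < c -> {ae mu, forall z, ~ limsup_lt t z}.
  move=> tc; have [Ut0|Ut] := ergF (mU t) (invariant_limsup_lt t).
    apply: (ae_of_null (A := ~` limsup_lt t)); first exact: measurableC.
    by rewrite setCK.
  exfalso; suff : c <= t by rewrite leNgt tc.
  by apply: ge_inf => //; exists c0.
exists c; first exact: lt_le_trans c0c.
have inv0 := @harmonic_gt0 R.
have H1 : {ae mu, forall z, forall n, limsup_lt (c + harmonic n) z}.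
  by apply: ae_foralln => n; apply: cU; rewrite ltrDl inv0.
have H2 : {ae mu, forall z, forall n, ~ limsup_lt (c - harmonic n) z}.
  by apply: ae_foralln => n; apply: ncU; rewrite ltrBlDr ltrDl inv0.
have small := @harmonic_small R.
apply: ae_mp (ae_and H1 H2) => z [z1 z2]; split => eps e0.
  have [n hn] := small _ e0; have [m [k0 H]] := z1 n; exists k0 => k kk.
  by apply: le_trans (H k kk) _; have := inv0 m; lra.
move=> k0; have [n hn] := small _ (divr_gt0 e0 (ltr0n R 2)).
apply: contrapT => nk; apply: (z2 n); exists n, k0 => k kk.
rewrite leNgt; apply/negP => h; apply: nk; exists k => //; apply: le_lt_trans h; lra.
Qed.

Lemma birkhoff_sum_unbounded : {ae mu, forall z, forall M : R, exists n, M < S B n z}.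
Proof.
have [c c0 H] := limsup_constant; apply: ae_mp H => z [_ H2] M.
have M1 : 0 < `|M| + 1 by rewrite ltr_wpDl.
have e1 : 0 < c / (2 * (`|M| + 1)) by rewrite divr_gt0// mulr_gt0.
have [k1 h1] := rcv e1.
have [k kk hk] := H2 (c / 2) (divr_gt0 c0 (ltr0n R 2)) k1.
exists (L k); have := h1 _ kk; rewrite ler_pdivlMr ?mulr_gt0// mulrCA => h2.
rewrite -(ltr_pM2l (r0 k)); apply: (@le_lt_trans _ _ (r k * (`|M| + 1))).
  by rewrite ler_pM2l//; have := ler_norm M; lra.
lra.
Qed.

Lemma not_ae_false : ~ {ae mu, forall z : X, False}.
Proof.
move=> H; have B0 : mu B = 0%E by apply: measure_negligible => //; apply: negligibleS H => z _ [].
by move: B1; rewrite B0 => /eqP; rewrite eq_sym onee_eq0.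
Qed.

(** An orbit meets a wandering set at most once but [B] unboundedly often; if the wandering set had
    finite positive measure [x], then [x / 2 * S B] would be bounded by [hopf_ratio]. *)
Lemma ergodic_conservative : sigma_finite [set: X] mu -> conservative mu F.
Proof.
move=> [E ET HE] W mW triv.
have fin W' : measurable W' -> W' `<=` W -> (mu W' < +oo)%E -> mu W' = 0%E.
  move=> mW' W'W finW'; apply: contrapT => n0.
  have W'fin : mu W' \is a fin_num by rewrite ge0_fin_numE.
  pose x := fine (mu W'); have Wx : mu W' = x%:E by rewrite /x fineK.
  have x0 : 0 < x.
    rewrite lt_neqAle fine_ge0// andbT; apply/negP => /eqP x0; apply: n0.
    by rewrite Wx -x0.
  apply: not_ae_false.
  have pq : -1 * x + x / 2 < 0 by lra.
  apply: ae_mp (ae_and (hopf_ratio mW' Wx pq) birkhoff_sum_unbounded) => z [[M HM] unb].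
  have W1 n : S W' n z <= 1.
    have [[i0 h]|no] := pselect (exists i : 'I_n, W' (iter i F z)).
      rewrite /birkhoff_sum (bigD1 i0)//= big1 ?addr0; first by rewrite indicE; case: (_ \in _).
      move=> i ii; rewrite indicE memNset// => Wi.
      have e : (i : nat) = i0 := triv i i0 I I (ex_intro _ z (conj (W'W _ Wi) (W'W _ h))).
      by move/eqP: ii; apply; exact: val_inj.
    rewrite /birkhoff_sum big1// => i _; rewrite indicE memNset// => Wi.
    by apply: no; exists i.
  have [n hn] := unb ((M + 1) / (x / 2)).
  move: hn; rewrite ltr_pdivrMr ?divr_gt0// => hn.
  by have := HM n; have := W1 n; rewrite mulrC in hn; lra.
have -> : W = \bigcup_i (W `&` E i) by rewrite -setI_bigcupr -ET setIT.
have mWE i : measurable (W `&` E i) by apply: measurableI => //; exact: (HE i).1.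
apply: measure_negligible; first exact: bigcupT_measurable.
apply: negligible_bigcup => i; apply/negligibleP; first exact: mWE.
apply: fin => //.
by apply: le_lt_trans (HE i).2; apply: le_measure; rewrite ?inE//; exact: (HE i).1.
Qed.

(* The upper limit of the normalized counts, as the supremum of the values attained infinitely often. *)
Definition law (c : R) (s : nat -> bool) : \bar R :=
  ereal_sup [set t%:E | t in [set t | 0 <= t /\
    forall k0, exists2 k, (k0 <= k)%N & t <= r k / c * \sum_(n < L k) (s n)%:R]].

Lemma law_orbitE c A z : law c (fun n => iter n F z \in A) =
  ereal_sup [set t%:E | t in [set t | 0 <= t /\
    forall k0, exists2 k, (k0 <= k)%N & t <= r k / c * S A (L k) z]].
Proof. by []. Qed.

Lemma law_ge0 c s : 0 < c -> (0 <= law c s)%E.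
Proof.
move=> c0; apply: ereal_sup_ubound => /=; exists 0 => //; split => // k0; exists k0 => //.
by rewrite mulr_ge0 ?sumr_ge0// divr_ge0// ltW.
Qed.

Lemma law_mono c A A' z : 0 < c -> A `<=` A' ->
  (law c (fun n => iter n F z \in A) <= law c (fun n => iter n F z \in A'))%E.
Proof.
move=> c0 AA'; rewrite !law_orbitE; apply: ge_ereal_sup => _ [t [t0 H] <-]; apply: ereal_sup_ubound.
exists t => //; split => // k0; have [k kk h] := H k0; exists k => //; apply: le_trans h _.
by rewrite ler_pM2l ?divr_gt0// birkhoff_sum_mono.
Qed.

Let limsup_eq c z :=
  (forall eps, 0 < eps -> exists k0, forall k, (k0 <= k)%N -> r k * S B (L k) z <= c + eps) /\
  (forall eps, 0 < eps -> forall k0, exists2 k, (k0 <= k)%N & c - eps < r k * S B (L k) z).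

Lemma law_finite c (A : set X) (x : R) : 0 < c -> {ae mu, forall z, limsup_eq c z} ->
  measurable A -> mu A = x%:E ->
  {ae mu, forall z, law c (fun n => iter n F z \in A) = x%:E}.
Proof.
move=> c0 Hc mA Ax.
have x0 : 0 <= x by rewrite -lee_fin -Ax.
have inv0 := @harmonic_gt0 R.
have H1 : {ae mu, forall z, forall n, exists M, forall m, 1 * S A m z + (- (x + harmonic n)) * S B m z <= M}.
  by apply: ae_foralln => n; apply: (hopf_ratio mA Ax); have := inv0 n; lra.
have H2 : {ae mu, forall z, forall n, exists M, forall m, -1 * S A m z + (x - harmonic n) * S B m z <= M}.
  by apply: ae_foralln => n; apply: (hopf_ratio mA Ax); have := inv0 n; lra.
have small := @harmonic_small R.
apply: ae_mp (ae_and Hc (ae_and H1 H2)) => z [[G1 G2] [h1 h2]].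
rewrite law_orbitE; apply/eqP; rewrite eq_le; apply/andP; split.
  apply: ge_ereal_sup => _ [t [t0 Ht] <-]; rewrite lee_fin leNgt; apply/negP => xt.
  have d0 : 0 < t - x by rewrite subr_gt0.
  have [n hn] := small _ (divr_gt0 d0 (ltr0n R 2)).
  have [M HM] := h1 n; set t' := x + harmonic n in HM.
  have t'0 : 0 < t' by rewrite ltr_wpDl.
  have tt' : 0 < t - t' by rewrite /t'; lra.
  have M1 : 0 < `|M| + 1 by rewrite ltr_wpDl.
  (* The two tolerances cost a quarter of [c * (t - t')] each: one for the upper limit on [B], one
     for the bounded error [M]. *)
  have e1 : 0 < c * (t - t') / (4 * t') by rewrite divr_gt0 ?mulr_gt0.
  have e2 : 0 < c * (t - t') / (4 * (`|M| + 1)) by rewrite divr_gt0 ?mulr_gt0.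
  have [k1 hk1] := G1 _ e1; have [k2 hk2] := rcv e2.
  have [k] := Ht (maxn k1 k2); rewrite geq_max => /andP[/hk1 b1 /hk2 b2] b3.
  move: b2; rewrite ler_pdivlMr ?mulr_gt0// => b2.
  have b4 : c * t <= r k * S A (L k) z.
    by rewrite mulrC -ler_pdivlMr// mulrAC.
  have b5 : r k * S A (L k) z <= t' * (r k * S B (L k) z) + r k * (`|M| + 1).
    rewrite mulrCA -mulrDr ler_pM2l//; have := HM (L k); have := ler_norm M; lra.
  have b6 : t' * (r k * S B (L k) z) <= t' * c + c * (t - t') / 4.
    apply: (@le_trans _ _ (t' * (c + c * (t - t') / (4 * t')))); first by rewrite ler_pM2l.
    by rewrite le_eqVlt; apply/orP; left; apply/eqP; field; exact: lt0r_neq0.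
  have b7 : r k * (`|M| + 1) <= c * (t - t') / 4 by lra.
  have : c * (t - t') <= c * (t - t') / 2 by lra.
  have : 0 < c * (t - t') by rewrite mulr_gt0.
  lra.
apply/lee_subgt0Pr => s s0; rewrite -EFinB.
(* Only nonnegative [t] enter the supremum, so a negative [x - s] is handled by [law_ge0]. *)
have [xs|xs] := ltP (x - s) 0.
  apply: le_trans (_ : 0%:E <= _)%E; first by rewrite lee_fin ltW.
  rewrite -law_orbitE; exact: law_ge0.
apply: ereal_sup_ubound => /=; exists (x - s) => //; split => // k0.
have [n hn] := small _ (divr_gt0 s0 (ltr0n R 2)).
have [M HM] := h2 n; set t' := x - harmonic n in HM.
have t's : x - s < t' by rewrite /t'; lra.
have t'0 : 0 < t' by apply: le_lt_trans t's.
set g := t' - (x - s).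
have g0 : 0 < g by rewrite subr_gt0.
have M1 : 0 < `|M| + 1 by rewrite ltr_wpDl.
have e1 : 0 < c * g / (4 * t') by rewrite divr_gt0 ?mulr_gt0.
have e2 : 0 < c * g / (4 * (`|M| + 1)) by rewrite divr_gt0 ?mulr_gt0.
have [k2 hk2] := rcv e2; have [k] := G2 _ e1 (maxn k0 k2).
rewrite geq_max => /andP[kk /hk2 b2] b1; exists k => //.
move: b2; rewrite ler_pdivlMr ?mulr_gt0// => b2.
rewrite mulrAC ler_pdivlMr// mulrC.
have b5 : t' * (r k * S B (L k) z) - r k * (`|M| + 1) <= r k * S A (L k) z.
  rewrite mulrCA -mulrBr ler_pM2l//; have := HM (L k); have := ler_norm M; lra.
have b6 : t' * c - c * g / 4 <= t' * (r k * S B (L k) z).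
  apply: (@le_trans _ _ (t' * (c - c * g / (4 * t')))); last by rewrite ler_pM2l// ltW.
  by rewrite le_eqVlt; apply/orP; left; apply/eqP; field; exact: lt0r_neq0.
have : c * (x - s) = t' * c - c * g by rewrite /g; ring.
have : 0 < c * g by rewrite mulr_gt0.
lra.
Qed.

Lemma ergodic_law_of_large_numbers : sigma_finite [set: X] mu -> has_law_of_large_numbers mu F.
Proof.
move=> sf; split; first by split => //; exact: ergodic_conservative.
have [c c0 Hc] := limsup_constant.
exists (law c); split; first by move=> s; exact: law_ge0.
move=> A mA; have [Afin|] := boolP (mu A \is a fin_num).
  by rewrite -(fineK Afin); apply: law_finite => //; rewrite fineK.
rewrite ge0_fin_numE// -leNgt leye_eq => /eqP Ay; rewrite Ay.
(* A set of infinite measure is exhausted by parts of finite measure, where the law is known, and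
   the law is monotone in the set. *)
have [E ET HE] := sf.
pose E' n := \big[setU/set0]_(i < n) E i.
have mE' n : measurable (E' n) by apply: bigsetU_measurable => i _; exact: (HE i).1.
have finE' n : (mu (E' n) < +oo)%E.
  elim: n => [|n ih]; first by rewrite /E' big_ord0 measure0.
  rewrite /E' big_ord_recr/=; apply: le_lt_trans (measureU2 _ _ _) _; [exact: mE'|exact: (HE n).1|].
  by rewrite lte_add_pinfty//; exact: (HE n).2.
have mAE n : measurable (A `&` E' n) by exact: measurableI.
have AEfin n : mu (A `&` E' n) \is a fin_num.
  rewrite ge0_fin_numE//; apply: le_lt_trans (finE' n).
  by apply: le_measure; rewrite ?inE.
have AU : \bigcup_n (A `&` E' n) = A.
  rewrite -setI_bigcupr [X in _ `&` X](_ : _ = setT) ?setIT//.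
  apply/seteqP; split => // z _; have : (\bigcup_i E i) z by rewrite -ET.
  by move=> [i _ Ei]; exists i.+1 => //; rewrite /E' big_ord_recr/=; right.
have cv : (mu \o (fun n => A `&` E' n)) x @[x --> \oo] --> mu A.
  rewrite -[in X in _ --> X]AU; apply: nondecreasing_cvg_mu => //; first exact: bigcupT_measurable.
  move=> n m nm; apply/subsetPset; apply: setIS.
  move=> z; rewrite /E' -!(bigcup_mkord _ E) => -[i /= im Ei].
  by exists i => //=; exact: leq_trans nm.
have H : {ae mu, forall z, forall n, law c (fun k => iter k F z \in A `&` E' n) = (fine (mu (A `&` E' n)))%:E}.
  by apply: ae_foralln => n; apply: law_finite => //; rewrite fineK.
apply: ae_mp H => z Hz; apply/eqP; rewrite -leye_eq -Ay.
rewrite -(cvg_lim (@ereal_hausdorff R) cv); apply: lime_le.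
  by apply/cvg_ex; eexists; exact: cv.
apply: nearW => n /=; rewrite -(fineK (AEfin n)) -(Hz n); apply: law_mono => //.
Qed.
End law.

Section sum_of_measures.
Context d (X : measurableType d) (R : realType) (mu : {measure set X -> \bar R}).

Lemma sum_measure_le (I J : Type) (s : seq I) (s' : seq J) (A : I -> set X) (D : J -> set X) (c : J -> R) :
  (forall i, measurable (A i)) -> (forall j, measurable (D j)) -> (forall j, 0 <= c j) ->
  (forall x, \sum_(i <- s) \1_(A i) x <= \sum_(j <- s') c j * \1_(D j) x) ->
  (\sum_(i <- s) mu (A i) <= \sum_(j <- s') (c j)%:E * mu (D j))%E.
Proof.
move=> mA mD c0 H.
have -> : (\sum_(j <- s') (c j)%:E * mu (D j) = \int[mu]_x (\sum_(j <- s') (c j * \1_(D j) x)%:E))%E.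
  rewrite ge0_integral_sum//; last 2 first.
  - by move=> j; apply/measurable_EFinP; exact: measurable_funM.
  - by move=> j x _; rewrite lee_fin mulr_ge0.
  apply: eq_bigr => j _; under eq_integral do rewrite EFinM.
  rewrite ge0_integralZl//; [|by apply/measurable_EFinP|by rewrite lee_fin].
  by rewrite integral_indic// setIT.
have -> : (\sum_(i <- s) mu (A i) = \int[mu]_x (\sum_(i <- s) (\1_(A i) x)%:E))%E.
  rewrite ge0_integral_sum//; last by move=> i; apply/measurable_EFinP.
  by apply: eq_bigr => i _; rewrite integral_indic// setIT.
apply: ge0_le_integral => //.
- by move=> x _; apply: sume_ge0 => i _; rewrite lee_fin.
- by apply: emeasurable_sum => i; apply/measurable_EFinP.
- by apply: emeasurable_sum => j; apply/measurable_EFinP; exact: measurable_funM.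
- by move=> x _; rewrite !sumEFin lee_fin.
Qed.
End sum_of_measures.

(** * Rational ergodicity and the law for the staircase cocycle *)

Section staircase_law.
Context (R : realType) (alpha : R) (K : nat -> int) (th : nat -> R).
Hypothesis fa : fast_approximation alpha K th.
Local Notation T := (circle R).
Local Notation lam := (@circle_measure R).
Local Notation mu := (@cylinder_measure R).
Local Notation a := (@to_circle R alpha).
Local Notation phi := (stair_cocycle alpha K).
Local Notation F := (skew_product alpha phi).
Local Notation N := steps.
Local Notation CS := (cocycle_sum (@stair R K) a).
Local Notation eta := (step_rate th).
Local Notation L := (turn K th).
Local Notation X := (return_exception alpha K th).
Local Notation B := ([set: T] `*` [set (0 : int)]).
Local Notation S := (@birkhoff_sum _ (T * int)%type R F).

Lemma measurable_base : measurable B.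
Proof. exact: measurable_level. Qed.

Lemma base_measure : mu B = 1%E.
Proof. by rewrite cylinder_measure_level// circle_measureT. Qed.

Lemma cylinder_sigma_finite : sigma_finite [set: T * int] mu.
Proof.
exists (fun n => if unpickle n is Some y then [set: T] `*` [set y] else set0).
  apply/seteqP; split => // -[x y] _; exists (pickle y); first by [].
  by rewrite pickleK.
move=> n; case: (unpickle n) => [y|].
  split; first exact: measurable_level.
  apply: (@le_lt_trans _ _ 1%E); last exact: ltry.
  have := @cylinder_measure_level R setT y measurableT; rewrite circle_measureT => e.
  by rewrite le_eqVlt; apply/orP; left; apply/eqP.
by split=> //; rewrite measure0 ltry.
Qed.

Lemma iter_base k x y : iter k F (x, y) \in B = (CS k x == - y).
Proof.
rewrite iter_skew; apply/idP/eqP; rewrite inE /=.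
  by move=> [_ /eqP]; rewrite addrC addr_eq0 => /eqP.
by move=> e; split => //; rewrite -/(cocycle_sum _ _ _ _); apply/eqP; rewrite addrC addr_eq0; apply/eqP.
Qed.

Lemma birkhoff_base n x y : S B n (x, y) = \sum_(k < n) ((CS k x == - y)%:R : R).
Proof. by apply: eq_bigr => k _; rewrite indicE iter_base. Qed.

Lemma birkhoff_base_le k x y : ~ X k x -> eta k * S B (L k) (x, y) <= 5.
Proof.
move=> nx; rewrite birkhoff_base mulrC -ler_pdivlMr ?(step_rate_gt0 fa)//.
exact: return_count_le.
Qed.

Lemma birkhoff_base_le_steps k z : eta k * S B (L k) z <= (N k)%:R.
Proof.
apply: (@le_trans _ _ (eta k * (L k)%:R)).
  by rewrite ler_pM2l ?(step_rate_gt0 fa)// birkhoff_sum_le.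
rewrite /step_rate -mulrA [th k * _]mulrC -[leRHS]mulr1 ler_pM2l ?natr_steps_gt0//.
exact: (turn_th fa).
Qed.

Lemma step_rate_le k : eta k <= 2 ^- k.
Proof.
have := Qth_le fa k; have Q1 := fa_Q_ge1 fa k; have e0 := step_rate_gt0 fa k => h.
apply: (@le_trans _ _ ((`|K k|%N)%:R * eta k)); first by rewrite ler_peMl// ltW.
by apply: le_trans h _; rewrite lef_pV2 ?posrE ?exprn_gt0// ler_weXn2l ?ler1n//; nia.
Qed.

Lemma step_rate_cvg0 (eps : R) : 0 < eps -> exists k0, forall k, (k0 <= k)%N -> eta k <= eps.
Proof.
move=> /(@two_pow_small R)[k0 hk]; exists k0 => k kk.
apply: le_trans (step_rate_le k) _; apply: le_trans hk.
apply: (@le_trans _ _ (2 ^- k0)).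
  by rewrite lef_pV2 ?posrE ?exprn_gt0// ler_weXn2l ?ler1n.
have : 0 < 2 ^- k0 :> R by rewrite invr_gt0 exprn_gt0.
lra.
Qed.

(** Borel-Cantelli, the measures being at most [4 ^- k.+1]. *)
Lemma return_exception_limsup : lam (lim_sup_set X) = 0%E.
Proof.
apply: lim_sup_set_cvg0; first by move=> k; exact: measurable_return_exception.
apply: (@le_lt_trans _ _ 1%E); last exact: ltry.
apply: geometric_eseries_le => // k.
apply: le_trans (circle_measure_return_exception fa k) _.
rewrite lee_fin mul1r natr_steps -exprM lef_pV2 ?posrE ?exprn_gt0//.
by rewrite ler_weXn2l ?ler1n//; lia.
Qed.

Lemma measurable_lim_sup d' (Y : measurableType d') (D : (set Y)^nat) :
  (forall k, measurable (D k)) -> measurable (lim_sup_set D).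
Proof.
move=> mD; apply: bigcapT_measurable => n; apply: bigcup_measurable => k _; exact: mD.
Qed.

Lemma return_upper : exists C, {ae mu, forall z, exists k0, forall k, (k0 <= k)%N -> eta k * S B (L k) z <= C}.
Proof.
exists 5.
have mX : measurable (lim_sup_set X) by apply: measurable_lim_sup => k; exact: measurable_return_exception.
have mX' : measurable (lim_sup_set X `*` [set: int]) by exact: measurableX.
have X0 : mu (lim_sup_set X `*` [set: int]) = 0%E.
  apply: cylinder_measure_eq0 => // y; rewrite -[RHS]return_exception_limsup; congr (lam _).
  by apply/seteqP; split => x //= -[].
apply: (@negligibleS _ _ _ _ (lim_sup_set X `*` [set: int])); last exact/negligibleP.
move=> [x y] /= nz; split => //= k0 _; apply: contrapT => nk; apply: nz; exists k0 => k kk.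
by apply: birkhoff_base_le => Xk; apply: nk; exists k.
Qed.

Let A n := [set z : T | CS n z = 0].

Lemma return_count_integral k :
  (\int[mu]_(z in B) (S B (L k) z)%:E = \sum_(n < L k) lam (A n))%E.
Proof.
have mB := measurable_base; have mpF := skew_measure_preserving alpha (measurable_stair_cocycle alpha K).
under eq_integral do rewrite /birkhoff_sum -sumEFin.
have mi n : measurable (iter n F @^-1` B).
  by rewrite -[X in measurable X]setTI; exact: (measurable_fun_iter mpF n).
rewrite ge0_integral_sum//; last first.
  move=> n; apply/measurable_EFinP; apply: measurable_funTS.
  exact: (measurable_indic (mi n)).
apply: eq_bigr => n _.
transitivity (\int[mu]_(z in B) (\1_(iter n F @^-1` B) z)%:E)%E; first exact: eq_integral.
rewrite integral_indic//.
have -> : iter n F @^-1` B `&` B = A n `*` [set 0].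
  apply/seteqP; split => -[x y].
    move=> [h [_ /= y0]]; split => //=; move: h; rewrite y0 => h.
    by have := mem_set (h : B (iter n F (x, 0))); rewrite iter_base oppr0 => /eqP.
  move=> [/= An ->]; split => //; have : iter n F (x, 0) \in B by rewrite iter_base oppr0; exact/eqP.
  by move=> /set_mem.
by apply: cylinder_measure_level; exact: measurable_return_set.
Qed.

Definition frequent (k : nat) : set T := [set x | 64^-1 <= eta k * S B (L k) (x, 0)].

Lemma measurable_frequent k : measurable (frequent k).
Proof.
have mS : measurable_fun [set: T] (fun x => eta k * S B (L k) (x, 0)).
  apply: measurable_funM => //.
  have mpF := skew_measure_preserving alpha (measurable_stair_cocycle alpha K).
  have := @measurable_birkhoff_sum _ _ _ _ _ mpF B (L k) measurable_base.
  exact: measurable_fun_pair1.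
have := mS measurableT _ (measurable_itv `[64^-1, +oo[); rewrite setTI.
by congr measurable; apply/seteqP; split => x /=; rewrite in_itv/= andbT.
Qed.

(** The normalized count has mean at least [1/16] and is at most 5 off [X k]. Infrequent points
    contribute at most [1/64], and [X k] at most [1 / N k <= 1/32] once [4 <= k]; what remains is
    [1/64 <= 5 * lam (frequent k)]. *)
Lemma frequent_measure k : (4 <= k)%N -> ((320^-1)%:E <= lam (frequent k))%E.
Proof.
move=> k4; have e0 := step_rate_gt0 fa k; have n0 := natr_steps_gt0 R k.
have mX := measurable_return_exception alpha K th k; have mD := measurable_frequent k.
have mA n : measurable (A n) by exact: measurable_return_set.
pose c (j : 'I_3) : R := [:: 64^-1 / eta k; 5 / eta k; (N k)%:R / eta k]`_j.
pose D (j : 'I_3) : set T := nth set0 [:: setT; frequent k; X k] j.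
have mDj j : measurable (D j) by case: j => -[|[|[|//]]] ?; rewrite /D/=.
have c0 j : 0 <= c j by case: j => -[|[|[|//]]] ?; rewrite /c/= divr_ge0// ltW.
have := @sum_measure_le _ _ _ lam _ _ (index_enum 'I_(L k)) (index_enum 'I_3) (fun n => A n) D c mA mDj c0.
move=> /(_ _)/wrap[].
  move=> x; rewrite !big_ord_recl big_ord0/= /c /D/= addr0.
  have -> : \sum_(n <- index_enum 'I_(L k)) (\1_(A n) x : R) = S B (L k) (x, 0).
    rewrite birkhoff_base; apply: eq_bigr => n _; rewrite indicE oppr0.
    by congr ((nat_of_bool _)%:R); apply/idP/eqP; rewrite inE.
  rewrite -(ler_pM2l e0).
  set s := eta k * _.
  have -> : eta k * (64^-1 / eta k * \1_[set: T] x + (5 / eta k * \1_(frequent k) x + (N k)%:R / eta k * \1_(X k) x)) =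
     64^-1 * \1_[set: T] x + (5 * \1_(frequent k) x + (N k)%:R * \1_(X k) x).
    by field; exact: lt0r_neq0.
  rewrite [\1_setT x]indicE in_setT mulr1 [\1_(X k) x]indicE.
  case: (boolP (x \in X k)) => [_|]; last rewrite notin_setE => nX.
    have := birkhoff_base_le_steps k (x, 0); rewrite -/s => h.
    have : 0 <= \1_(frequent k) x :> R by [].
    by rewrite mulr1; lra.
  rewrite mulr0 addr0 indicE; case: (boolP (x \in frequent k)) => [_|].
    by have h : s <= 5 := birkhoff_base_le 0 nX; rewrite mulr1; lra.
  by rewrite notin_setE /frequent /= -/s => /negP; rewrite -ltNge; lra.
move=> h1; have := le_trans (return_count_ge fa k) h1.
rewrite !big_ord_recl big_ord0/= /c /D/= adde0 circle_measureT mule1.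
have fD := circle_measure_fin mD; have fX := circle_measure_fin mX.
have := circle_measure_return_exception fa k.
rewrite -(fineK fD) -(fineK fX) -!EFinM -!EFinD !lee_fin => h2 h3.
have N32 : 32 <= (N k)%:R :> R by rewrite (ler_nat R 32) (@leq_trans (2 ^ 5))// leq_exp2l.
have h4 : (N k)%:R * fine (lam (X k)) <= 32^-1.
  apply: (@le_trans _ _ (N k)%:R^-1); last by rewrite lef_pV2 ?posrE.
  rewrite -[leRHS]mul1r ler_pdivlMr//.
  have : (N k)%:R ^+ 2 * fine (lam (X k)) <= 1.
    by rewrite -ler_pdivlMl ?exprn_gt0// mulr1.
  by rewrite expr2; lra.
have h5 : 16^-1 <= 64^-1 + (5 * fine (lam (frequent k)) + (N k)%:R * fine (lam (X k))).
  rewrite -(ler_pM2r (_ : 0 < (eta k)^-1)) ?invr_gt0//.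
  move: h3; rewrite invfM => /le_trans; apply.
  by rewrite le_eqVlt; apply/orP; left; apply/eqP; ring.
lra.
Qed.

(** Sets of measure at least [1/320] have an upper limit of at least that measure, since the space
    is a probability space. *)
Lemma return_lower : exists2 c0, 0 < c0 &
  ~ {ae mu, forall z, exists k0, forall k, (k0 <= k)%N -> eta k * S B (L k) z < c0}.
Proof.
exists 64^-1 => // H.
have mD := measurable_lim_sup measurable_frequent.
have D0 : lam (lim_sup_set frequent) = 0%E.
  rewrite -(cylinder_measure_level 0 mD); apply: measure_negligible; first exact: measurable_level.
  apply: negligibleS H => -[x y] /= [Dx ->] [k0 h].
  by have [k /= kk] := Dx k0 I; rewrite /frequent /= leNgt h.
have := lim_sup_set_cvg lam frequent measurable_frequent.
move=> /(_ _)/wrap[].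
  apply: (@le_lt_trans _ _ 1%E); last exact: ltry.
  by apply: circle_measure_le1; apply: bigcup_measurable => k _; exact: measurable_frequent.
move=> cv.
suff : ((320^-1)%:E <= lam (lim_sup_set frequent))%E.
  by rewrite D0 lee_fin; lra.
rewrite -(cvg_lim (@ereal_hausdorff R) cv); apply: lime_ge.
  by apply/cvg_ex; eexists; exact: cv.
exists 4%N => // n /= n4; apply: le_trans (frequent_measure n4) _.
apply: le_measure; rewrite ?inE.
- exact: measurable_frequent.
- by apply: bigcup_measurable => k _; exact: measurable_frequent.
- by move=> x Dx; exists n => /=.
Qed.

Lemma stair_law : has_law_of_large_numbers mu F.
Proof.
apply: (ergodic_law_of_large_numbers (skew_measure_preserving alpha (measurable_stair_cocycle alpha K))
  (ergodic_stair fa) measurable_base base_measure (step_rate_gt0 fa) step_rate_cvg0 return_upper return_lower).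
exact: cylinder_sigma_finite.
Qed.

Lemma stair_rationally_ergodic : rationally_ergodic_subseq mu F.
Proof.
have mpF := skew_measure_preserving alpha (measurable_stair_cocycle alpha K).
split; first by have [] := stair_law.
(* [26 = 5 ^ 2 + 1] bounds the second moment, the [1] coming from [X k], and [256 = 16 ^ 2] comes
   from the lower bound of the mean. *)
exists B, L, (26 * 256); split.
- exact: measurable_base.
- by rewrite [X in (0 < X < _)%E]base_measure lte_fin ltr01 ltry.
- split; first by move=> k; exact: (turn_gt0 fa).
  by apply: homo_ltn; [exact: ltn_trans|move=> k; exact: (turn_lt fa)].
- by rewrite mulr_gt0 ?ltr0n.
move=> k; have e0 := step_rate_gt0 fa k; have n0 := natr_steps_gt0 R k; have thk := fa_gt0 fa k.
have mB := measurable_base; have mX := measurable_return_exception alpha K th k.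
have mXl : measurable (X k `*` [set (0:int)]) by exact: measurable_level.
have mS := @measurable_birkhoff_sum _ _ _ _ _ mpF B (L k) mB.
apply: (@le_trans _ _ (\int[mu]_(z in B)
    ((5 / eta k) ^+ 2 * \1_B z + (th k) ^- 2 * \1_(X k `*` [set (0:int)]) z)%:E)%E).
  apply: ge0_le_integral => //.
  - by move=> z _; rewrite lee_fin sqr_ge0.
  - by apply: measurable_funTS; apply/measurable_EFinP; exact: measurable_funX.
  - by apply: measurable_funTS; apply/measurable_EFinP; apply: measurable_funD; apply: measurable_funM.
  move=> [x y] [_ /= y0]; rewrite lee_fin y0.
  have S0 : 0 <= S B (L k) (x, 0) by exact: birkhoff_sum_ge0.
  rewrite [\1_B _]indicE mem_set// mulr1 indicE.
  case: (boolP (_ \in _)) => [_|]; last rewrite notin_setE => nX.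
    rewrite mulr1; apply: (@le_trans _ _ (th k ^- 2)); last by rewrite lerDr sqr_ge0.
    rewrite -exprVn lerXn2r ?nnegrE ?invr_ge0 ?(ltW thk)//.
    by apply: le_trans (turn_le fa k); exact: birkhoff_sum_le.
  rewrite mulr0 addr0 lerXn2r ?nnegrE ?divr_ge0 ?(ltW e0)//.
  rewrite ler_pdivlMr// mulrC; apply: birkhoff_base_le => Xx; apply: nX; by split.
apply: (@le_trans _ _ ((26 / eta k ^+ 2)%:E)).
  under eq_integral do rewrite EFinD !EFinM.
  rewrite ge0_integralD//; last 4 first.
  - by move=> z _; rewrite -EFinM lee_fin mulr_ge0// sqr_ge0.
  - by apply: measurable_funTS; under eq_fun do rewrite -EFinM; apply/measurable_EFinP; exact: measurable_funM.
  - by move=> z _; rewrite -EFinM lee_fin mulr_ge0// invr_ge0 sqr_ge0.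
  - by apply: measurable_funTS; under eq_fun do rewrite -EFinM; apply/measurable_EFinP; exact: measurable_funM.
  rewrite !ge0_integralZl//; last 4 first.
  - by apply: measurable_funTS; apply/measurable_EFinP.
  - by rewrite lee_fin invr_ge0 sqr_ge0.
  - by apply: measurable_funTS; apply/measurable_EFinP.
  - by rewrite lee_fin sqr_ge0.
  rewrite !integral_indic// setIid.
  have -> : X k `*` [set 0] `&` B = X k `*` [set 0].
    by apply/seteqP; split => z; [move=> []|move=> [? ?]].
  rewrite [X in (_ * X + _)%E](base_measure) [X in (_ + _ * X)%E](cylinder_measure_level 0 mX) mule1.
  have fX := circle_measure_fin mX; have := circle_measure_return_exception fa k.
  rewrite -(fineK fX) -EFinM -EFinD !lee_fin => h.
  have : th k ^- 2 * fine (lam (X k)) <= (eta k ^+ 2)^-1.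
    by rewrite /step_rate exprMn [X in _ <= X]invfM [X in _ <= X]mulrC ler_pM2l// invr_gt0 exprn_gt0.
  have -> : 5 / eta k * (5 / eta k) = 25 * eta k ^- 2 by field; exact: lt0r_neq0.
  by lra.
have := return_count_ge fa k; rewrite -(return_count_integral k) => h.
apply: (@le_trans _ _ ((26 * 256)%:E * ((16 * eta k)^-1)%:E ^+ 2)%E).
  rewrite expe2 -!EFinM lee_fin le_eqVlt; apply/orP; left; apply/eqP; field; exact: lt0r_neq0.
apply: lee_wpmul2l; first by rewrite lee_fin mulr_ge0 ?ler0n.
by rewrite !expe2; apply: lee_pmul => //; rewrite lee_fin invr_ge0 mulr_ge0 ?(ltW e0).
Qed.
End staircase_law.
Theorem theorem1p1 (R : realType) (alpha : R)
    (alpha_irrational : irrational alpha)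
    (liminf0 : limn_einf
       (fun q : nat => (q%:R * dist_int (q%:R * alpha))%:E) = 0%E) :
  exists phi : circle R -> int,
    let mu := @cylinder_measure R in
    let F := skew_product alpha phi in
    [/\ forall p : R, 1 <= p ->
          (fun x => (phi x)%:~R : R) \in Lfun (@circle_measure R) p%:E,
        measure_preserving mu F /\ ergodic mu F &
        divisible alpha ->
          rationally_ergodic_subseq mu F /\ has_law_of_large_numbers mu F].

Proof.
have [K [th fa]] := fast_approximation_exists alpha_irrational liminf0.
exists (stair_cocycle alpha K); split.
- by move=> p p1; exact: (stair_cocycle_Lfun fa p1).
- split; last exact: (ergodic_stair fa).
  exact: (skew_measure_preserving alpha (measurable_stair_cocycle alpha K)).
- by move=> _; split; [exact: (stair_rationally_ergodic fa)|exact: (stair_law fa)].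
Qed.
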